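(* Let $\Bbbk$ be a field of characteristic zero, let $V$ be a counital coaugmented simply-connected DG open Frobenius algebra of degree $\mathsf m$ over $\Bbbk$, and let $C$ be its coaugmentation coideal $\mathrm{Coker}(\eta)$ (one can also take $C$ to be $V$ itself). Let $L=\mathrm{CC}_*(C)[\mathsf m-1]$ with the differential $b$ and the operations $\{\,,\,\}:L\otimes L\to L$ and $\delta:L\to L\otimes L$ defined in the context. Then $(L,\{\,,\,\},\delta)$ forms an involutive DG Lie bialgebra.
   Context: **Conventions.** $W[k]$ denotes the graded space $W$ with degrees of elements shifted down by $k$. The symbol $\pm$ denotes the sign determined by the usual Koszul convention. All structures are graded. **DG open Frobenius algebra** of degree $\mathsf m$: a DG vector space $V$ with $(V,\cdot,\Delta)$ such that $(V,\cdot)$ is a commutative DG algebra whose product has degree $-\mathsf m$; $(V,\Delta)$ is a cocommutative DG coalgebra; and for all $a,b\in V$, $\Delta(a\cdot b)=\sum(-1)^{\mathsf m|a'|}a'\otimes a''\cdot b=\sum a\cdot b'\otimes b''$, where $\Delta a=\sum a'\otimes a''$, $\Delta b=\sum b'\otimes b''$. It is counital and coaugmented if it has a counit $\varepsilon:V\to\Bbbk$ and a coaugmentation $\eta:\Bbbk\hookrightarrow V$. Simply-connected means $V$ is concentrated in degrees $\ge 0$, $V_0=\eta(\Bbbk)$ and $V_1=0$. The coaugmentation coideal is the quotient DG coalgebra $\mathrm{Coker}(\eta)$. For $a,b\in C=\mathrm{Coker}(\eta)$, $\varepsilon(a\cdot b)$ is computed in $V$ after identifying $C$ with $\ker\varepsilon$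 via $V=\eta(\Bbbk)\oplus\ker\varepsilon$. **Connes complex of a DG coalgebra $(C,d)$.** $\mathrm{Hoch}_*(C)=\bigoplus_{n\ge0}C\otimes C[1]^{\otimes n}$ with differential $$b(a_0,\dots,a_n)=-\sum_{i=0}^n(-1)^{\varepsilon_{i-1}}(a_0,\dots,da_i,\dots,a_n)+\sum_{i=0}^n\sum_{(a_i)}(-1)^{\varepsilon_{i-1}+|a_i'|-1}(a_0,\dots,a_i',a_i'',\dots,a_n)+\sum_{(a_0)}(-1)^{(|a_0'|-1)(\varepsilon_n-|a_0'|)}(a_0'',a_1,\dots,a_n,a_0'),$$ where $\varepsilon_i=|a_0|+\cdots+|a_i|-i$ and $\sum_{(a)}a'\otimes a''$ is the coproduct of $a$. Put $t(a_0,\dots,a_n)=(-1)^{(|a_0|-1)(\varepsilon_n-|a_0|)}(a_1,\dots,a_n,a_0)$ and $N=id+t+\cdots+t^n$. The image of $N$ is a subcomplex $\mathrm{CC}_*(C)$, the Connes complex. **Operations.** Elements of $L=\mathrm{CC}_*(C)[\mathsf m-1]$ are written as combinations of $N([a_1|\cdots|a_n])$, $a_i\in C[1]$ (an empty word is read as $0$). For $\alpha=N([a_1|\cdots|a_n])$, $\beta=N([b_1|\cdots|b_m])$ set $$\{\alpha,\beta\}=\sum_{i,j}\pm\varepsilon(a_i\cdot b_j)N([a_{i+1}|\cdots|a_n|a_1|\cdots|a_{i-1}|b_{j+1}|\cdots|b_m|b_1|\cdots|b_{j-1}]),$$ $$\delta(\alpha)=\sum_{i<j}\pm\varepsilon(a_i\cdot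 a_j)N([a_1|\cdots|a_{i-1}|a_{j+1}|\cdots|a_n])\wedge N([a_{i+1}|\cdots|a_{j-1}]),$$ where $x\wedge y=x\otimes y-y\otimes x$. (Thus $\{\,,\,\}$ has degree $0$ and $\delta$ has degree $2(2-\mathsf m)$.) **Lie bialgebra.** A Lie coalgebra is a space $L$ with a skew-symmetric $\delta:L\to L\otimes L$ satisfying $(\tau^2+\tau+id)\circ(\delta\otimes id)\circ\delta=0$, $\tau(a\otimes b\otimes c)=\pm c\otimes a\otimes b$. $(L,\{\,,\,\},\delta)$ is a Lie bialgebra if $(L,\{\,,\,\})$ is a Lie algebra, $(L,\delta)$ is a Lie coalgebra, and $\delta\{a,b\}=\{id\otimes a+a\otimes id,\delta(b)\}+\{\delta(a),id\otimes b+b\otimes id\}$. It is involutive if $\{\,,\,\}\circ\delta=0$. It is DG if the differential $b$ is compatible with both the bracket and the cobracket (a derivation of the bracket and a coderivation of the cobracket, with Koszul signs).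
   Formalization: The last sum in the displayed formula for the differential b is taken with sign − instead of +: with + the image of N is not a subcomplex (e.g. for the homology of CP², b(y)=2(x,x) is not in the image of N). *)

(* Defs.v *)
From HB Require Import structures.
From mathcomp Require Import all_boot all_order all_algebra.
From mathcomp Require Import boolp.
From mathcomp Require Import finmap monalg.

Set Implicit Arguments.
Unset Strict Implicit.
Unset Printing Implicit Defensive.

Import GRing.Theory.
Local Open Scope ring_scope.
Local Open Scope quotient_scope.

Reserved Notation "u ⊗ v" (at level 40, left associativity).


Section Span.
Variables (k : fieldType) (M : lmodType k) (S : M -> Prop).

Definition span (x : M) : Prop :=
  exists s : seq (k * M),
    (forall p, p \in s -> S p.2) /\ x = \sum_(p <- s) p.1 *: p.2.

Definition spanb : {pred M} := fun x => `[< span x >].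

Lemma span_gen x : S x -> span x.
Proof.
move=> Sx; exists [:: (1, x)]; split=> [p|]; last by rewrite big_seq1 scale1r.
by rewrite inE => /eqP ->.
Qed.

Fact spanb_submod_closed : submod_closed spanb.
Proof.
split; first by apply/asboolP; exists [::]; split; rewrite ?big_nil.
move=> c x y /asboolP[s [sS ->]] /asboolP[t [tS ->]]; apply/asboolP.
exists ([seq (c * p.1, p.2) | p <- s] ++ t); split.
  move=> p; rewrite mem_cat => /orP[/mapP[q qs ->]|/tS //].
  exact: (sS _ qs).
rewrite big_cat big_map /= scaler_sumr; congr (_ + _).
by apply: eq_bigr => p _; rewrite scalerA.
Qed.

HB.instance Definition _ :=
  GRing.isSubmodClosed.Build k M spanb spanb_submod_closed.

Definition subspace := {x : M | x \in spanb}.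
HB.instance Definition _ := SubChoice.on subspace.
HB.instance Definition _ := [SubChoice_isSubLmodule of subspace by <:].

Definition quotient := Quotient.quot spanb.
HB.instance Definition _ := GRing.Zmodule.on quotient.

Definition qclass (x : M) : quotient := \pi_(Quotient.quot spanb) x.

Lemma qclassP x y : qclass x = qclass y <-> span (x - y).
Proof.
by split=> [/eqmodP|xy]; [|apply/eqmodP]; rewrite /= /Quotient.equiv;
   [move/asboolP | apply/asboolP].
Qed.

Lemma qclassK (x : quotient) : qclass (repr x) = x.
Proof. exact: reprK. Qed.

Lemma qclassD x y : qclass (x + y) = qclass x + qclass y.
Proof. exact: pi_addr. Qed.

Definition qscale (c : k) (x : quotient) : quotient := qclass (c *: repr x).

Lemma qscaleE c x : qscale c (qclass x) = qclass (c *: x).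
Proof.
apply/qclassP; rewrite -scalerBr; apply/asboolP.
by apply: (rpredZ (s := spanb) c); apply/asboolP/qclassP; rewrite qclassK.
Qed.

Fact qscaleA a b x : qscale a (qscale b x) = qscale (a * b) x.
Proof. by rewrite -[x]qclassK !qscaleE scalerA. Qed.
Fact qscale1 : left_id 1 qscale.
Proof. by move=> x; rewrite -[x]qclassK qscaleE scale1r. Qed.
Fact qscaleDr : right_distributive qscale +%R.
Proof.
move=> c x y; rewrite -[x]qclassK -[y]qclassK -qclassD !qscaleE.
by rewrite scalerDr qclassD.
Qed.
Fact qscaleDl x : {morph qscale^~ x : a b / a + b}.
Proof. by move=> a b; rewrite -[x]qclassK !qscaleE scalerDl qclassD. Qed.

HB.instance Definition _ :=
  GRing.Zmodule_isLmodule.Build k quotient qscaleA qscale1 qscaleDr qscaleDl.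

Fact qclass_linear : linear qclass.
Proof. by move=> c x y; rewrite qclassD -qscaleE. Qed.

HB.instance Definition _ :=
  GRing.isLinear.Build k M quotient _ qclass qclass_linear.

End Span.


Section Tensor.
Variables (k : fieldType) (U W : lmodType k).

Definition tensor_rel (x : {malg k[(U * W)%type]}) : Prop :=
  (exists c u u' w,
     x = << (c *: u + u', w) >> - (c *: << (u, w) >> + << (u', w) >>)) \/
  (exists c u w w',
     x = << (u, c *: w + w') >> - (c *: << (u, w) >> + << (u, w') >>)).

Definition tensor := quotient tensor_rel.
HB.instance Definition _ := GRing.Lmodule.on tensor.

Definition tens (u : U) (w : W) : tensor := qclass tensor_rel << (u, w) >>.

End Tensor.

Notation "u ⊗ v" := (tens u v) : ring_scope.

(* The map U ⊗ W -> Z induced by f; meaningful when f is bilinear. *)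
Definition tlift (k : fieldType) (U W Z : lmodType k) (f : U -> W -> Z)
    (t : tensor U W) : Z :=
  \sum_(p <- msupp (repr t)) (repr t)@_p *: f p.1 p.2.

Definition bilin (k : fieldType) (U W Z : lmodType k) (f : U -> W -> Z) : Prop :=
  (forall u, linear (f u)) /\ (forall w, linear (f^~ w)).

Section TensorTheory.
Variables (k : fieldType) (U W Z : lmodType k).

Lemma tens_bilin : bilin (@tens k U W).
Proof.
split=> [u c w w'|w c u u'] /=; rewrite -linearP; apply/qclassP/span_gen.
  by right; exists c, u, w, w'.
by left; exists c, u, u', w.
Qed.

Variable f : U -> W -> Z.
Hypothesis f_bilin : bilin f.

Let ext (x : {malg k[(U * W)%type]}) : Z :=
  \sum_(p <- msupp x) x@_p *: f p.1 p.2.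

Let extE (x : {malg k[(U * W)%type]}) (D : {fset U * W}) :
  (msupp x `<=` D)%fset -> ext x = \sum_(p <- D) x@_p *: f p.1 p.2.
Proof.
move=> sxD; rewrite /ext (big_fset_incl _ sxD) // => p _ px.
by rewrite mcoeff_outdom ?scale0r.
Qed.

Let ext_linear : linear ext.
Proof.
move=> c x y; pose D := (msupp x `|` msupp y)%fset.
rewrite (@extE x D) ?fsubsetUl // (@extE y D) ?fsubsetUr // (@extE _ D).
  rewrite scaler_sumr -big_split /=; apply: eq_bigr => p _.
  by rewrite mcoeffD mcoeffZ scalerDl scalerA.
apply: (fsubset_trans (msuppD_le _ _)); apply: fsetSU.
apply/fsubsetP=> p; rewrite -!mcoeff_neq0 mcoeffZ.
by apply: contra_neq => ->; rewrite mulr0.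
Qed.

Let extU p : ext << p >> = f p.1 p.2.
Proof. by rewrite (@extE _ [fset p]%fset) ?msuppU_le // big_seq_fset1 mcoeffUU scale1r. Qed.

Let extL : {linear {malg k[(U * W)%type]} -> Z} :=
  HB.pack ext (GRing.isLinear.Build _ _ _ _ ext ext_linear).

Let ext_rel x : span (@tensor_rel k U W) x -> ext x = 0.
Proof.
case=> s [sr ->]; rewrite -[ext]/(extL : _ -> _) linear_sum big1_seq //= => p.
case/sr=> -[c [u [u' [w ->]]]]; rewrite -[ext]/(extL : _ -> _);
  rewrite linearZ linearB linearD linearZ /= !extU /=.
  by rewrite f_bilin.2 subrr scaler0.
by rewrite f_bilin.1 subrr scaler0.
Qed.

Lemma tlift_linear : linear (tlift f).
Proof.
have tE x : tlift f (qclass (@tensor_rel k U W) x) = ext x.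
  apply/eqP; rewrite -subr_eq0 -[tlift _ _]/(ext _) -[ext]/(extL : _ -> _).
  by rewrite -linearB; apply/eqP/ext_rel/qclassP; rewrite qclassK.
move=> c s t; rewrite -[s]qclassK -[t]qclassK -linearP !tE.
exact: ext_linear.
Qed.

Lemma tliftE u w : tlift f (u ⊗ w) = f u w.
Proof.
rewrite -[f u w]/(f (u, w).1 (u, w).2) -extU.
apply/eqP; rewrite -subr_eq0 -[tlift _ _]/(ext _) -[ext]/(extL : _ -> _).
by rewrite -linearB; apply/eqP/ext_rel/qclassP; rewrite qclassK.
Qed.

End TensorTheory.

(* The direct sum of all tensor powers of C; [pure w] is the pure
   tensor of the letters of w. *)
Section Words.
Variables (k : fieldType) (C : lmodType k).

Definition word_rel (x : {malg k[seq C]}) : Prop :=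
  exists c a a' p q,
    x = << p ++ (c *: a + a') :: q >>
        - (c *: << p ++ a :: q >> + << p ++ a' :: q >>).

Definition tensor_powers := quotient word_rel.
HB.instance Definition _ := GRing.Lmodule.on tensor_powers.

Definition pure (w : seq C) : tensor_powers := qclass word_rel << w >>.

End Words.


Section Graded.
Variables (k : fieldType) (V : lmodType k) (gr : int -> V -> Prop).

(* Homogeneous elements are handled as pairs (degree, element), since the
   element 0 has no degree of its own. *)
Definition homog (s : seq (int * V)) : Prop :=
  forall p, p \in s -> gr p.1 p.2.

Record grading : Prop := {
  gr_sub : forall n, gr n 0 /\
    forall (c : k) x y, gr n x -> gr n y -> gr n (c *: x + y);
  gr_span : forall v, exists s, homog s /\ v = \sum_(p <- s) p.2;
  gr_free : forall s, homog s -> uniq [seq p.1 | p <- s] ->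
    \sum_(p <- s) p.2 = 0 -> forall p, p \in s -> p.2 = 0
}.

(* [sweedler n t s]: t is the sum of the x ⊗ y for ((i, x), (j, y)) in s, a
   decomposition into homogeneous tensors of total degree n. *)
Definition sweedler (n : int) (t : tensor V V)
    (s : seq ((int * V) * (int * V))) : Prop :=
  (forall p, p \in s ->
     [/\ gr p.1.1 p.1.2, gr p.2.1 p.2.2 & p.1.1 + p.2.1 = n]) /\
  t = \sum_(p <- s) p.1.2 ⊗ p.2.2.

Record dg_space (d : V -> V) : Prop := {
  dg_grading : grading;
  dg_linear : linear d;
  dg_degree : forall n x, gr n x -> gr (n - 1) (d x);
  dg_square : forall x, d (d x) = 0
}.

End Graded.

Definition sgn (k : fieldType) (n : int) : k := (-1) ^ n.
Arguments sgn {k} n.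


Section Frobenius.
Variables (k : fieldType) (m : int) (V : lmodType k) (gr : int -> V -> Prop).
Variables (d : V -> V) (mul : V -> V -> V) (Delta : V -> tensor V V).

(* As a product of degree -m is an operation of degree -m, the Koszul rule
   gives the axioms of a commutative DG algebra the following meaning: the
   product * := s^-1 o mul o (s ⊗ s) on the desuspension V[m] (where s has degree
   m), that is a * b = (-1)^(m|a|) a.b, makes V[m] a commutative DG algebra in
   the usual sense; a has degree |a| - m there.  For even m this is
   a.b = (-1)^(|a||b|) b.a and (a.b).c = a.(b.c). *)
Definition shifted_mul (i : int) (a b : V) : V := sgn (m * i) *: mul a b.

Record shifted_cdga : Prop := {
  mul_bilin : bilin mul;
  mul_degree : forall i j a b, gr i a -> gr j b -> gr (i + j - m) (mul a b);
  mul_comm : forall i j a b, gr i a -> gr j b ->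
    shifted_mul i a b = sgn ((i - m) * (j - m)) *: shifted_mul j b a;
  mul_assoc : forall i j l a b c, gr i a -> gr j b -> gr l c ->
    shifted_mul (i + j - m) (shifted_mul i a b) c =
    shifted_mul i a (shifted_mul j b c);
  mul_leibniz : forall i j a b, gr i a -> gr j b ->
    d (shifted_mul i a b) =
    shifted_mul (i - 1) (d a) b + sgn (i - m) *: shifted_mul i a (d b)
}.

Record dg_cocomm_coalgebra : Prop := {
  comul_linear : linear Delta;
  comul_degree : forall n a, gr n a -> exists s, sweedler gr n (Delta a) s;
  comul_cocomm : forall n a s, gr n a -> sweedler gr n (Delta a) s ->
    Delta a = \sum_(p <- s) sgn (p.1.1 * p.2.1) *: (p.2.2 ⊗ p.1.2);
  comul_coassoc : forall n a s r, gr n a -> sweedler gr n (Delta a) s ->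
    (forall p, p \in s -> sweedler gr p.1.1 (Delta p.1.2) (r p.1) /\
                          sweedler gr p.2.1 (Delta p.2.2) (r p.2)) ->
    \sum_(p <- s) \sum_(q <- r p.1) q.1.2 ⊗ q.2.2 ⊗ p.2.2 =
    \sum_(p <- s) \sum_(q <- r p.2) p.1.2 ⊗ q.1.2 ⊗ q.2.2;
  comul_coleibniz : forall n a s, gr n a -> sweedler gr n (Delta a) s ->
    Delta (d a) = \sum_(p <- s)
      (d p.1.2 ⊗ p.2.2 + sgn p.1.1 *: (p.1.2 ⊗ d p.2.2))
}.

Record dg_open_frobenius : Prop := {
  frob_dg : dg_space gr d;
  frob_mul : shifted_cdga;
  frob_comul : dg_cocomm_coalgebra;
  frob_left : forall i j a b s, gr i a -> gr j b -> sweedler gr i (Delta a) s ->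
    Delta (mul a b) =
    \sum_(p <- s) sgn (m * p.1.1) *: (p.1.2 ⊗ mul p.2.2 b);
  frob_right : forall i j a b s, gr i a -> gr j b -> sweedler gr j (Delta b) s ->
    Delta (mul a b) = \sum_(p <- s) mul a p.1.2 ⊗ p.2.2
}.

Record counit (eps : V -> k^o) : Prop := {
  counit_linear : linear eps;
  counit_degree : forall n a, gr n a -> n != 0 -> eps a = 0;
  counit_d : forall a, eps (d a) = 0;
  counit_l : forall a, tlift (fun x y => eps x *: y) (Delta a) = a;
  counit_r : forall a, tlift (fun x y => eps y *: x) (Delta a) = a
}.

Record coaugmentation (eps : V -> k^o) (eta : k^o -> V) : Prop := {
  coaug_linear : linear eta;
  coaug_degree : gr 0 (eta 1);
  coaug_d : forall c, d (eta c) = 0;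
  coaug_comul : Delta (eta 1) = eta 1 ⊗ eta 1;
  coaug_counit : forall c, eps (eta c) = c
}.

Record simply_connected (eta : k^o -> V) : Prop := {
  sc_nonneg : forall n a, gr n a -> n < 0 -> a = 0;
  sc_zero : forall a, gr 0 a -> exists c, a = eta c;
  sc_one : forall a, gr 1 a -> a = 0
}.

End Frobenius.

Section Coker.
Variables (k : fieldType) (V : lmodType k) (gr : int -> V -> Prop).
Variables (d : V -> V) (mul : V -> V -> V) (Delta : V -> tensor V V).
Variables (eps : V -> k^o) (eta : k^o -> V).

Definition eta_image (x : V) : Prop := exists c, x = eta c.
Definition coker := quotient eta_image.
HB.instance Definition _ := GRing.Lmodule.on coker.
Definition to_coker : V -> coker := qclass eta_image.

Definition coker_gr (n : int) (x : coker) : Prop :=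
  exists2 v, gr n v & x = to_coker v.
Definition coker_d (x : coker) : coker := to_coker (d (repr x)).
Definition coker_comul (x : coker) : tensor coker coker :=
  tlift (fun u v => to_coker u ⊗ to_coker v) (Delta (repr x)).
(* The inverse of ker eps -> coker. *)
Definition coker_section (x : coker) : V := repr x - eta (eps (repr x)).
Definition coker_pairing (x y : coker) : k :=
  eps (mul (coker_section x) (coker_section y)).

End Coker.

Arguments coker_gr {k V} gr eta n x.
Arguments coker_d {k V} d eta x.
Arguments coker_comul {k V} Delta eta x.
Arguments coker_pairing {k V} mul eps eta x y.


Section LieBialgebra.
Variables (k : fieldType) (L : lmodType k) (gr : int -> L -> Prop).
Variables (b : L -> L) (br : L -> L -> L) (cobr : L -> tensor L L).

Record lie_algebra : Prop := {
  br_bilin : bilin br;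
  br_degree : forall i j x y, gr i x -> gr j y -> gr (i + j) (br x y);
  br_skew : forall i j x y, gr i x -> gr j y ->
    br x y = - sgn (i * j) *: br y x;
  br_jacobi : forall i j l x y z, gr i x -> gr j y -> gr l z ->
    br x (br y z) = br (br x y) z + sgn (i * j) *: br y (br x z)
}.

(* The cobracket has degree e, an even integer, so that it contributes no Koszul
   sign of its own here and below. *)
Record lie_coalgebra (e : int) : Prop := {
  cobr_linear : linear cobr;
  cobr_degree : forall n x, gr n x -> exists s, sweedler gr (n + e) (cobr x) s;
  cobr_skew : forall n x s, gr n x -> sweedler gr (n + e) (cobr x) s ->
    cobr x = - \sum_(p <- s) sgn (p.1.1 * p.2.1) *: (p.2.2 ⊗ p.1.2);
  cobr_jacobi : forall n x s r, gr n x -> sweedler gr (n + e) (cobr x) s ->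
    (forall p, p \in s -> sweedler gr (p.1.1 + e) (cobr p.1.2) (r p.1)) ->
    \sum_(p <- s) \sum_(q <- r p.1)
      (sgn (q.1.1 * (q.2.1 + p.2.1)) *: (q.2.2 ⊗ p.2.2 ⊗ q.1.2)
       + sgn (p.2.1 * (q.1.1 + q.2.1)) *: (p.2.2 ⊗ q.1.2 ⊗ q.2.2)
       + q.1.2 ⊗ q.2.2 ⊗ p.2.2) = 0
}.

Record involutive_dg_lie_bialgebra (e : int) : Prop := {
  lb_even : exists f, e = 2 * f;
  lb_dg : dg_space gr b;
  lb_lie : lie_algebra;
  lb_colie : lie_coalgebra e;
  lb_compat : forall i j x y s t, gr i x -> gr j y ->
    sweedler gr (i + e) (cobr x) s -> sweedler gr (j + e) (cobr y) t ->
    cobr (br x y) =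
    \sum_(p <- t) (sgn (i * p.1.1) *: (p.1.2 ⊗ br x p.2.2)
                   + br x p.1.2 ⊗ p.2.2)
    + \sum_(p <- s) (p.1.2 ⊗ br p.2.2 y
                     + sgn (p.2.1 * j) *: (br p.1.2 y ⊗ p.2.2));
  lb_involutive : forall x, tlift br (cobr x) = 0;
  lb_derivation : forall i x y, gr i x ->
    b (br x y) = br (b x) y + sgn i *: br x (b y);
  lb_coderivation : forall n x s, gr n x -> sweedler gr (n + e) (cobr x) s ->
    cobr (b x) = \sum_(p <- s)
      (b p.1.2 ⊗ p.2.2 + sgn p.1.1 *: (p.1.2 ⊗ b p.2.2))
}.

End LieBialgebra.


Section Connes.
Variables (k : fieldType) (C : lmodType k) (gr : int -> C -> Prop).
Variables (d : C -> C) (Delta : C -> tensor C C) (pairing : C -> C -> k).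
Variable m : int.

Local Notation letter := (int * C)%type.
Implicit Types (u v w : seq letter) (a : letter).

(* The Hochschild complex is the part of [tensor_powers C] spanned by non-empty
   words, with (a_0, ..., a_n) in degree |a_0| + ... + |a_n| - n. *)
Definition hword w : tensor_powers C := pure [seq a.2 | a <- w].

(* For w = (a_0, ..., a_i) this is eps_i; in particular eps_{-1} = 1. *)
Definition epsilon w : int := \sum_(a <- w) a.1 - (size w)%:Z + 1.

(* The degree of w as a word in C[1]. *)
Definition wdeg w : int := \sum_(a <- w) (a.1 - 1).

(* The operator t on a word with a coefficient. *)
Definition rotate (x : k * seq letter) : k * seq letter :=
  if x.2 is a :: w then
    (x.1 * sgn ((a.1 - 1) * (epsilon x.2 - a.1)), rcons w a)
  else x.

Definition cycN w : tensor_powers C :=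
  \sum_(i < size w) let x := iter i rotate (1, w) in x.1 *: hword x.2.

Definition cc_gen (x : tensor_powers C) : Prop :=
  exists2 w, homog gr w & x = cycN w.

Definition CC := subspace cc_gen.
HB.instance Definition _ := GRing.Lmodule.on CC.
Definition cc_val (x : CC) : tensor_powers C := val x.

Definition ccN w : CC := insubd (0 : CC) (cycN w).

Lemma ccNE w : homog gr w -> cc_val (ccN w) = cycN w.
Proof.
move=> hw; rewrite /cc_val /ccN insubdK //; apply/asboolP/span_gen.
by exists w.
Qed.

(* The grading of L = CC[m - 1]. *)
Definition ldeg w : int := epsilon w - (m - 1).
Definition L_gr (n : int) (x : CC) : Prop :=
  span (fun z => exists w, [/\ homog gr w, ldeg w = n & z = cycN w]) (cc_val x).

Local Notation "w `_ i" := (nth (0 : int, 0 : C) w i).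

(* The sign of the last sum is the one for which b squares to 0 and preserves
   the image of N. *)
Definition hochschild_differential (b : tensor_powers C -> tensor_powers C) :=
  forall w (s : letter -> seq (letter * letter)),
    w <> [::] -> homog gr w ->
    (forall a, a \in w -> sweedler gr a.1 (Delta a.2) (s a)) ->
    b (hword w) =
      - \sum_(i < size w) sgn (epsilon (take i w)) *:
          hword (take i w ++ ((w`_i).1 - 1, d (w`_i).2) :: drop i.+1 w)
      + \sum_(i < size w) \sum_(p <- s w`_i)
          sgn (epsilon (take i w) + p.1.1 - 1) *:
          hword (take i w ++ [:: p.1; p.2] ++ drop i.+1 w)
      - \sum_(p <- s w`_0) sgn ((p.1.1 - 1) * (epsilon w - p.1.1)) *:
          hword (p.2 :: behead w ++ [:: p.1]).

(* Koszul sign of the (i, j) term of the bracket.  Writing u = P a Q and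
   v = P' c Q', rotating u to Q P a and v to c Q' P' brings a next to c; the
   last summand moves the desuspensions of degree 1 (for C[1]) and m (for L)
   past a to reach the pairing. *)
Definition bracket_sign u v (i j : nat) : k :=
  let P := take i u in let a := u`_i in let Q := drop i.+1 u in
  let P' := take j v in let c := v`_j in let Q' := drop j.+1 v in
  sgn (wdeg Q * (wdeg P + (a.1 - 1)) + wdeg P' * ((c.1 - 1) + wdeg Q')
       + (m + 1) * a.1).

Definition bracket_formula (br : CC -> CC -> CC) :=
  forall u v, homog gr u -> homog gr v ->
    br (ccN u) (ccN v) =
      \sum_(i < size u) \sum_(j < size v)
        (bracket_sign u v i j * pairing (u`_i).2 (v`_j).2) *:
        ccN (drop i.+1 u ++ take i u ++ drop j.+1 v ++ take j v).

(* Koszul sign of the (i, j) term of the cobracket: w = P a Q c R is permuted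
   to a c (P R) Q, and the desuspensions move past P R and a. *)
Definition cobracket_sign w (i j : nat) : k :=
  let P := take i w in let a := w`_i in
  let Q := drop i.+1 (take j w) in let c := w`_j in let R := drop j.+1 w in
  sgn ((a.1 - 1) * wdeg P + (c.1 - 1) * (wdeg P + wdeg Q) + wdeg Q * wdeg R
       + m * (wdeg P + wdeg R) + a.1).

Definition cobracket_formula (cobr : CC -> tensor CC CC) :=
  forall w, homog gr w ->
    cobr (ccN w) =
      \sum_(j < size w) \sum_(i < j)
        let x := take i w ++ drop j.+1 w in let y := drop i.+1 (take j w) in
        (cobracket_sign w i j * pairing (w`_i).2 (w`_j).2) *:
        (ccN x ⊗ ccN y - sgn (ldeg x * ldeg y) *: (ccN y ⊗ ccN x)).

(* Homogeneous words span, so the formulas determine b on the Hochschild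
   complex, bL, br and cobr uniquely; that they are well defined, and that the
   image of N is a subcomplex, is part of the assertion. *)
Definition CC_involutive_dg_lie_bialgebra : Prop :=
  exists (b : {linear tensor_powers C -> tensor_powers C})
         (bL : CC -> CC) (br : CC -> CC -> CC) (cobr : CC -> tensor CC CC),
    [/\ hochschild_differential b,
        forall x, cc_val (bL x) = b (cc_val x),
        bracket_formula br,
        cobracket_formula cobr
      & involutive_dg_lie_bialgebra L_gr bL br cobr (2 * (2 - m))].

End Connes.

(* Main.v *)
(* Homogeneous words span, and on the image of N dividing by the length of a word
   is, up to rotation, a section of N (characteristic 0).  So a linear map on the
   Connes complex is the same as a multilinear function of homogeneous words that
   is compatible with rotation, and the bracket, the cobracket and the differential
   become sums over the cuts of cyclic words.  Each identity is a matching of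
   summands that perform the same cuts in a different order.  The Lie bialgebra
   axioms and involutivity use only that the pairing <a, c> = eps(a.c) is graded
   symmetric of degree m.

   The compatibility of b with the bracket and the cobracket reduces to one local
   identity around the two paired letters a and c, in which b acts on either of
   them; it follows from the Frobenius relation
     sum <a, c'> c'' = sum +- <a'', c> a'.
   On Coker(eta) this relation fails by the terms <a, eta(1)> c and <c, eta(1)> a,
   since the reduced pairing does not see the image of eta.  These terms move a
   letter from one side of a cut to the other, and their sum over all the positions
   in a word telescopes to zero. *)

Require Import Defs.
From HB Require Import structures.
From mathcomp Require Import all_boot all_order all_algebra.
From mathcomp Require Import boolp.
From mathcomp Require Import finmap monalg ring.

Set Implicit Arguments.
Unset Strict Implicit.
Unset Printing Implicit Defensive.

Import GRing.Theory.
Local Open Scope ring_scope.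

(** * Signs *)

(** Signs are the main obstacle. Every Koszul sign is [sgn] of an integer polynomial in the degrees,
    so two signs agree once their exponents agree modulo 2, and this is decided by splitting on the
    parities of the atomic degrees. Many comparisons hold only when the degrees of two paired
    letters add up to m; [sgn_pr] and [sgn_pr2] grant this relation, because otherwise the pairing
    vanishes. Since 0 lies in every degree, functions take letters with an explicit degree and are
    linear only within a degree; [hlift], [mlift] and [clift] turn them into linear maps on C, on
    its tensor powers and on the Connes complex. Sweedler decompositions are arbitrary
    representatives, so the cobracket is studied with a general bilinear map T in place of ⊗, and b
    through its effect on an arbitrary multilinear function G of words ([nab], [dw]). In this form
    one local identity around the two paired letters serves both the bracket and the cobracket: only
    the function that receives the remaining words changes. *)

Definition parity (n : int) : bool := odd `|n|%N.

Lemma parityN n : parity (- n) = parity n.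
Proof. by rewrite /parity abszN. Qed.

Lemma parityD n p : parity (n + p) = parity n (+) parity p.
Proof.
have sub (i j : nat) : parity (i%:Z - j%:Z) = odd i (+) odd j.
  rewrite /parity; case: (leqP i j) => ij; last first.
    by rewrite subzn ?oddB // ltnW.
  by rewrite -opprB abszN subzn // oddB // addbC.
case: n p => [i|i] [j|j]; rewrite ?NegzE.
- by rewrite /parity -PoszD /= oddD.
- by rewrite sub parityN.
- by rewrite addrC sub parityN addbC.
- by rewrite -(opprD i.+1%:Z j.+1%:Z) !parityN /parity -PoszD absz_nat oddD.
Qed.

Lemma parityM n p : parity (n * p) = parity n && parity p.
Proof. by rewrite /parity abszM oddM. Qed.

Lemma parity1 : parity 1 = true. Proof. by []. Qed.
Lemma parity0 : parity 0 = false. Proof. by []. Qed.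

Definition parityE := (parityD, parityM, parityN, parity1, parity0).

Section Sgn.
Variable k : fieldType.

Lemma sgn_parity n : sgn n = (-1) ^+ parity n :> k.
Proof.
rewrite /sgn /parity; case: n => i; first by rewrite -exprnP signr_odd.
by rewrite NegzE abszN absz_nat signr_odd -exprz_inv invrN1 -exprnP.
Qed.

Lemma sgn_eq n p : parity n = parity p -> sgn n = sgn p :> k.
Proof. by rewrite !sgn_parity => ->. Qed.

Lemma sgnD n p : sgn (n + p) = sgn n * sgn p :> k.
Proof. by rewrite !sgn_parity parityD signr_addb. Qed.

Lemma sgnS n : - sgn n = sgn (n + 1) :> k.
Proof. by rewrite sgnD /sgn expr1z mulrN1. Qed.

Variable Z : lmodType k.

Lemma sgn_scaleA n p (z : Z) : sgn n *: (sgn p *: z) = sgn (n + p) *: z.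
Proof. by rewrite scalerA sgnD. Qed.

Lemma sgn_scaleN n (z : Z) : - (sgn n *: z) = sgn (n + 1) *: z.
Proof. by rewrite -scaleNr sgnS. Qed.

Lemma sgn_scale0 (z : Z) : sgn 0 *: z = z.
Proof. exact: scale1r. Qed.

Lemma sgn_scale_even n (z : Z) : parity n = false -> sgn n *: z = z.
Proof. by move=> en; rewrite sgn_parity en scale1r. Qed.

Lemma sgn_scale_odd n (z : Z) : parity n = true -> sgn n *: z = - z.
Proof. by move=> en; rewrite sgn_parity en scaleN1r. Qed.

Lemma sgn_scaleC n (c : k) (z : Z) : c *: (sgn n *: z) = sgn n *: (c *: z).
Proof. by rewrite !scalerA mulrC. Qed.

End Sgn.

(** After [parityE] both exponents are polynomials over the field with two elements in the parities
    of the atomic degrees, and a split on all of these decides their equality. *)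
Ltac parity_cases :=
  rewrite ?parityE;
  repeat match goal with |- context [parity ?x] => case: (parity x) end;
  done.

Ltac ksign := apply: sgn_eq; parity_cases.
Ltac kscale := congr (_ *: _); ksign.

(** * Sums over the positions of a word *)

Section Splits.
Variables (T : Type) (Z : zmodType).
Implicit Types (w u v P Q : seq T) (a : T).

(** Recursion replaces indexed sums, so that concatenation, nested cuts and telescoping become
    inductions without index arithmetic; [spl_nth] translates back to the indexed sums of the
    formulas. *)
Fixpoint spl w (F : seq T -> T -> seq T -> Z) : Z :=
  if w is a :: w' then F [::] a w' + spl w' (fun P => F (a :: P)) else 0.

Lemma eq_spl w F G :
  (forall P a Q, w = P ++ a :: Q -> F P a Q = G P a Q) -> spl w F = spl w G.
Proof.
elim: w F G => //= a w IH F G FG; rewrite FG //; congr (_ + _).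
by apply: IH => P b Q e; apply: FG; rewrite e.
Qed.

Lemma spl_cat u v F : spl (u ++ v) F =
  spl u (fun P a Q => F P a (Q ++ v)) + spl v (fun P => F (u ++ P)).
Proof.
by elim: u F => [|a u IH] F /=; rewrite ?add0r // IH addrA.
Qed.

Lemma splD w F G :
  spl w (fun P a Q => F P a Q + G P a Q) = spl w F + spl w G.
Proof. by elim: w F G => [|a w IH] F G /=; rewrite ?addr0 // IH addrACA. Qed.

Lemma spl0 w : spl w (fun _ _ _ => 0) = 0.
Proof. by elim: w => [|a w IH] //=; rewrite IH addr0. Qed.

(** Two letters of w are marked, w = P a Q b R, the left one first or the right one first. *)
Lemma splA w F :
  spl w (fun P a S => spl S (fun Q b R => F P a Q b R)) =
  spl w (fun S b R => spl S (fun P a Q => F P a Q b R)).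
Proof.
elim: w F => [|a w IH] F //=; rewrite add0r IH -splD.
by apply: eq_spl.
Qed.

Lemma spl_nth (x0 : T) w F :
  spl w F = \sum_(i < size w) F (take i w) (nth x0 w i) (drop i.+1 w).
Proof.
elim: w F => [|a w IH] F /=; first by rewrite big_ord0.
by rewrite big_ord_recl IH /= drop0.
Qed.

(** The summand is the change when the bar between P and Q moves past the letter a. All defects of
    the Frobenius relation on the coideal cancel through this. *)
Lemma spl_telescope w (F : seq T -> seq T -> Z) :
  spl w (fun P a Q => F (rcons P a) Q - F P (a :: Q)) = F w [::] - F [::] w.
Proof.
elim: w F => [|a w IH] F /=; first by rewrite subrr.
by rewrite (IH (fun P => F (a :: P))) /= addrC addrA subrK.
Qed.

End Splits.

Lemma spl_sum (T : Type) (Z : zmodType) (I : Type) (r : seq I) (w : seq T)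
    (F : I -> seq T -> T -> seq T -> Z) :
  spl w (fun P a Q => \sum_(i <- r) F i P a Q) = \sum_(i <- r) spl w (F i).
Proof.
elim: w F => [|a w IH] F /=; first by rewrite big1.
by rewrite IH -big_split.
Qed.

Lemma spl_exchange (T T' : Type) (Z : zmodType) (u : seq T) (v : seq T')
    (F : seq T -> T -> seq T -> seq T' -> T' -> seq T' -> Z) :
  spl u (fun P a Q => spl v (fun P' c Q' => F P a Q P' c Q')) =
  spl v (fun P' c Q' => spl u (fun P a Q => F P a Q P' c Q')).
Proof.
by elim: u F => [|a u IH] F /=; rewrite ?spl0 // splD IH.
Qed.

Lemma spl_additive (T : Type) (Z Z' : zmodType) (f : {additive Z -> Z'})
    (w : seq T) F : f (spl w F) = spl w (fun P a Q => f (F P a Q)).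
Proof. by elim: w F => [|a w IH] F /=; rewrite ?raddf0 // raddfD IH. Qed.

Section SplitsLinear.
Variables (k : fieldType) (T : Type) (Z Z' : lmodType k).

Lemma spl_linear (f : Z -> Z') (w : seq T) F : linear f ->
  f (spl w F) = spl w (fun P a Q => f (F P a Q)).
Proof.
move=> lf; pose g : {linear Z -> Z'} :=
  HB.pack f (GRing.isLinear.Build _ _ _ _ f lf).
exact: (spl_additive g).
Qed.

Lemma splZ (c : k) (w : seq T) (F : seq T -> T -> seq T -> Z) :
  c *: spl w F = spl w (fun P a Q => c *: F P a Q).
Proof. exact: (spl_additive ( *:%R c)). Qed.

Lemma splN (w : seq T) (F : seq T -> T -> seq T -> Z) :
  - spl w F = spl w (fun P a Q => - F P a Q).
Proof. exact: (spl_additive (@GRing.opp Z)). Qed.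

End SplitsLinear.

(** * Linear maps out of free modules and their quotients *)

Lemma scaleCA (k : fieldType) (Z : lmodType k) (b c : k) (z : Z) :
  b *: (c *: z) = c *: (b *: z).
Proof. by rewrite !scalerA mulrC. Qed.

Section FreeLift.
Variables (k : fieldType) (K : choiceType) (Z : lmodType k) (f : K -> Z).

Definition free_lift (x : {malg k[K]}) : Z := \sum_(p <- msupp x) x@_p *: f p.

Lemma free_liftE (x : {malg k[K]}) (D : {fset K}) :
  (msupp x `<=` D)%fset -> free_lift x = \sum_(p <- D) x@_p *: f p.
Proof.
move=> sxD; rewrite /free_lift (big_fset_incl _ sxD) // => p _ px.
by rewrite mcoeff_outdom ?scale0r.
Qed.

Lemma free_lift_linear : linear free_lift.
Proof.
move=> c x y; pose D := (msupp x `|` msupp y)%fset.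
rewrite (@free_liftE x D) ?fsubsetUl // (@free_liftE y D) ?fsubsetUr //.
rewrite (@free_liftE _ D).
  rewrite scaler_sumr -big_split /=; apply: eq_bigr => p _.
  by rewrite mcoeffD mcoeffZ scalerDl scalerA.
apply: (fsubset_trans (msuppD_le _ _)); apply: fsetSU.
by apply/fsubsetP=> p; rewrite -!mcoeff_neq0 mcoeffZ; apply: contra_neq => ->; rewrite mulr0.
Qed.

HB.instance Definition _ :=
  GRing.isLinear.Build k {malg k[K]} Z _ free_lift free_lift_linear.

Lemma free_liftU p : free_lift << p >> = f p.
Proof.
by rewrite (@free_liftE _ [fset p]%fset) ?msuppU_le // big_seq_fset1 mcoeffUU scale1r.
Qed.

End FreeLift.

Section QuotientLift.
Variables (k : fieldType) (M Z : lmodType k) (S : M -> Prop).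
Variable f : {linear M -> Z}.
Hypothesis fS : forall x, S x -> f x = 0.

Lemma quotient_liftE x : f (repr (qclass S x)) = f x.
Proof.
apply/eqP; rewrite -subr_eq0 -linearB; apply/eqP.
have /qclassP[s [sS ->]] : qclass S (repr (qclass S x)) = qclass S x.
  exact: qclassK.
rewrite linear_sum big1_seq //= => p /sS /fS; rewrite linearZ /= => ->.
exact: scaler0.
Qed.

Lemma quotient_lift_linear : linear (fun x : quotient S => f (repr x)).
Proof.
move=> c x y; rewrite -[x]qclassK -[y]qclassK -linearP !quotient_liftE.
exact: linearP.
Qed.

End QuotientLift.

Lemma linear_fun_sum (k : fieldType) (U Z : lmodType k) (f : U -> Z) I
    (r : seq I) (c : I -> k) (F : I -> U) : linear f ->
  f (\sum_(i <- r) c i *: F i) = \sum_(i <- r) c i *: f (F i).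
Proof.
move=> lf; pose g : {linear U -> Z} :=
  HB.pack f (GRing.isLinear.Build _ _ _ _ f lf).
by rewrite -[f]/(g : _ -> _) linear_sum; apply: eq_bigr => i _; rewrite linearZ.
Qed.

Section LinearFun.
Variables (k : fieldType) (U Z : lmodType k) (f : U -> Z).
Hypothesis lf : linear f.

Lemma linear_fun0 : f 0 = 0.
Proof. by have := lf (-1) 0 0; rewrite scaler0 addr0 scaleN1r addNr. Qed.

Lemma linear_funD x y : f (x + y) = f x + f y.
Proof. by have := lf 1 x y; rewrite !scale1r. Qed.

Lemma linear_funZ c x : f (c *: x) = c *: f x.
Proof. by have := lf c x 0; rewrite linear_fun0 !addr0. Qed.

Lemma linear_funN x : f (- x) = - f x.
Proof. by rewrite -!scaleN1r linear_funZ. Qed.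

Lemma linear_fun_bigop I (r : seq I) (P : pred I) (F : I -> U) :
  f (\sum_(i <- r | P i) F i) = \sum_(i <- r | P i) f (F i).
Proof. exact: (big_morph f linear_funD linear_fun0). Qed.

End LinearFun.

Section LinearClosure.
Variables (k : fieldType) (U W Z : lmodType k).

Lemma lin_comp (f : W -> Z) (g : U -> W) :
  linear f -> linear g -> linear (fun x => f (g x)).
Proof. by move=> lf lg c x y; rewrite lg lf. Qed.

Lemma lin_add (f g : U -> Z) :
  linear f -> linear g -> linear (fun x => f x + g x).
Proof. by move=> lf lg c x y; rewrite lf lg scalerDr addrACA. Qed.

Lemma lin_scale (c : k) (f : U -> Z) : linear f -> linear (fun x => c *: f x).
Proof. by move=> lf e x y; rewrite lf scalerDr scaleCA. Qed.

Lemma lin_opp (f : U -> Z) : linear f -> linear (fun x => - f x).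
Proof. by move=> lf c x y; rewrite lf opprD scalerN. Qed.

Lemma lin_zero : linear (fun _ : U => 0 : Z).
Proof. by move=> c x y; rewrite scaler0 addr0. Qed.

End LinearClosure.

(** * Maps defined on homogeneous elements *)

Section HomogeneousLift.
Variables (k : fieldType) (C : lmodType k) (gr : int -> C -> Prop).
Hypothesis grC : grading gr.
Local Notation letter := (int * C)%type.

Lemma gr0 n : gr n 0. Proof. by case: (gr_sub grC n). Qed.

Lemma grP n c a a' : gr n a -> gr n a' -> gr n (c *: a + a').
Proof. by case: (gr_sub grC n) => _; apply. Qed.

Lemma grZ n c a : gr n a -> gr n (c *: a).
Proof. by move=> ga; rewrite -[_ *: _]addr0; apply: grP => //; apply: gr0. Qed.

Lemma gr_sum n I (r : seq I) (P : pred I) (F : I -> C) :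
  (forall i, P i -> gr n (F i)) -> gr n (\sum_(i <- r | P i) F i).
Proof.
move=> gF; elim/big_rec: _ => [|i x Pi gx]; first exact: gr0.
by rewrite -[F i]scale1r; apply: grP => //; apply: gF.
Qed.

Lemma homog_nil : homog gr [::]. Proof. by []. Qed.

Lemma homog_cons a w : homog gr (a :: w) <-> gr a.1 a.2 /\ homog gr w.
Proof.
split=> [h|[ga hw] p]; last by rewrite inE => /orP[/eqP->|/hw].
by split=> [|p pw]; apply: h; rewrite inE ?eqxx ?pw ?orbT.
Qed.

Lemma homog_cat u v : homog gr (u ++ v) <-> homog gr u /\ homog gr v.
Proof.
split=> [h|[hu hv] p]; last by rewrite mem_cat => /orP[/hu|/hv].
by split=> p pw; apply: h; rewrite mem_cat pw ?orbT.
Qed.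

(** Linearity is asked only inside one degree: a letter carries its degree because signs depend on
    it and because 0 belongs to every degree. *)
Definition hlin (Z : lmodType k) (K : letter -> Z) : Prop :=
  forall n c a a', gr n a -> gr n a' ->
    K (n, c *: a + a') = c *: K (n, a) + K (n, a').

Section One.
Variables (Z : lmodType k) (K : letter -> Z).
Hypothesis hK : hlin K.

Lemma hlin0 n : K (n, 0) = 0.
Proof.
have := hK 1 (gr0 n) (gr0 n); rewrite !scale1r addr0 => /eqP.
by rewrite -[X in X == _]addr0 => /eqP/addrI.
Qed.

Lemma hlinZ n c a : gr n a -> K (n, c *: a) = c *: K (n, a).
Proof.
by move=> ga; have := hK c ga (gr0 n); rewrite hlin0 !addr0.
Qed.

Lemma hlin_sum n (r : seq letter) (P : pred letter) :
    (forall p, p \in r -> P p -> gr n p.2) ->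
  K (n, \sum_(p <- r | P p) p.2) = \sum_(p <- r | P p) K (n, p.2).
Proof.
elim: r => [|p r IH] gP; first by rewrite !big_nil hlin0.
have gr' q : q \in r -> P q -> gr n q.2.
  by move=> qr; apply: gP; rewrite inE qr orbT.
rewrite !big_cons; case: ifP => Pp; last exact: IH.
rewrite -IH // -[p.2]scale1r hK ?scale1r //.
  by apply: gP; rewrite ?inE ?eqxx.
by rewrite big_seq_cond; apply: gr_sum => q /andP[]; apply: gr'.
Qed.

(** This is what makes [hlift] well defined. The entries of r are grouped by degree, since a degree
    may occur several times; each group has sum 0 by [gr_free], and K is additive within a
    degree. *)
Lemma hlin_relation r : homog gr r -> \sum_(p <- r) p.2 = 0 ->
  \sum_(p <- r) K p = 0.
Proof.
move=> hr r0; pose D := undup [seq p.1 | p <- r].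
pose part n := \sum_(p <- r | p.1 == n) p.2.
have split_deg (Y : nmodType) (F : letter -> Y) :
    \sum_(p <- r) F p = \sum_(n <- D) \sum_(p <- r | p.1 == n) F p.
  rewrite (exchange_big_dep predT) //= [LHS]big_seq [RHS]big_seq.
  apply: eq_bigr => p pr; rewrite -big_filter.
  rewrite (perm_big [:: p.1]) ?big_seq1 //.
  apply: uniq_perm; rewrite ?filter_uniq ?undup_uniq // => n.
  rewrite mem_filter inE eq_sym; case: eqP => // ->.
  by rewrite mem_undup map_f.
have gpart n : forall p, p \in r -> p.1 == n -> gr n p.2.
  by move=> p /hr gp /eqP <-.
have part0 n : n \in D -> part n = 0.
  move=> nD; pose s := [seq (i, part i) | i <- D].
  apply: (gr_free grC (s := s) _ _ _ (p := (n, part n))).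
  - move=> p /mapP[i _ ->] /=; rewrite /part big_seq_cond.
    by apply: gr_sum => q /andP[]; apply: gpart.
  - by rewrite -map_comp map_id undup_uniq.
  - by rewrite big_map -split_deg.
  - exact: map_f.
rewrite split_deg big1_seq // => n /= /part0 p0.
rewrite (eq_bigr (fun p => K (n, p.2))); last by case=> i x /= /eqP ->.
by rewrite -hlin_sum -/(part n) ?p0 ?hlin0 //; apply: gpart.
Qed.

Lemma hlin_sum_eq s t : homog gr s -> homog gr t ->
  \sum_(p <- s) p.2 = \sum_(p <- t) p.2 -> \sum_(p <- s) K p = \sum_(p <- t) K p.
Proof.
move=> hs ht st; pose t' := [seq (p.1, - p.2) | p <- t].
have: \sum_(p <- s ++ t') K p = 0.
  apply: hlin_relation.
    apply/homog_cat; split=> // p /mapP[q /ht gq ->] /=.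
    by rewrite -scaleN1r; apply: grZ.
  by rewrite big_cat big_map /= st sumrN subrr.
rewrite big_cat big_map /= => /eqP; rewrite addr_eq0 => /eqP ->.
rewrite -sumrN [LHS]big_seq [RHS]big_seq; apply: eq_bigr => -[n x] /ht /= gx.
by rewrite -scaleN1r hlinZ // scaleN1r opprK.
Qed.

End One.

(** An arbitrary choice; [hlin_sum_eq] makes everything built from it independent of the
    decomposition. *)
Definition decomp (v : C) : seq letter := projT1 (cid (gr_span grC v)).

Lemma decomp_homog v : homog gr (decomp v).
Proof. by rewrite /decomp; case: cid => s []. Qed.

Lemma decompE v : v = \sum_(p <- decomp v) p.2.
Proof. by rewrite /decomp; case: cid => s []. Qed.

Definition hlift (Z : lmodType k) (K : letter -> Z) (v : C) : Z :=
  \sum_(p <- decomp v) K p.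

Section Hlift.
Variable Z : lmodType k.
Implicit Types K : letter -> Z.

Lemma hliftE K n a : hlin K -> gr n a -> hlift K a = K (n, a).
Proof.
move=> hK ga; rewrite -[RHS](big_seq1 +%R _ K); apply: hlin_sum_eq => //.
- exact: decomp_homog.
- by apply/homog_cons.
- by rewrite big_seq1 -decompE.
Qed.

Lemma hlift_linear K : hlin K -> linear (hlift K).
Proof.
move=> hK c v v'; pose s := [seq (p.1, c *: p.2) | p <- decomp v] ++ decomp v'.
rewrite /hlift (hlin_sum_eq hK (t := s)).
- rewrite big_cat big_map /= scaler_sumr; congr (_ + _).
  rewrite [LHS]big_seq [RHS]big_seq; apply: eq_bigr => -[n x] /decomp_homog /= gx.
  by rewrite hlinZ.
- exact: decomp_homog.
- apply/homog_cat; split; last exact: decomp_homog.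
  by move=> p /mapP[q /decomp_homog gq ->] /=; apply: grZ.
- by rewrite -decompE big_cat big_map /= -scaler_sumr -!decompE.
Qed.

Lemma eq_hlift K K' v : (forall n a, gr n a -> K (n, a) = K' (n, a)) ->
  hlift K v = hlift K' v.
Proof.
move=> KK'; rewrite /hlift [LHS]big_seq [RHS]big_seq.
by apply: eq_bigr => -[n a] /decomp_homog /KK'.
Qed.

Lemma hliftP K K' c v :
  hlift (fun p => c *: K p + K' p) v = c *: hlift K v + hlift K' v.
Proof. by rewrite /hlift big_split /= scaler_sumr. Qed.

End Hlift.

End HomogeneousLift.

Section HomogeneousBilinear.
Variables (k : fieldType) (U W : lmodType k).
Variables (grU : int -> U -> Prop) (grW : int -> W -> Prop).
Hypotheses (gU : grading grU) (gW : grading grW).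

Definition hbilin (Z : lmodType k) (F : int * U -> int * W -> Z) : Prop :=
  (forall n u, grU n u -> hlin grW (F (n, u))) /\
  (forall n w, grW n w -> hlin grU (F^~ (n, w))).

Definition hlift2 (Z : lmodType k) (F : int * U -> int * W -> Z) :
    tensor U W -> Z :=
  tlift (fun u w => hlift gU (fun p => hlift gW (F p) w) u).

Variables (Z : lmodType k) (F : int * U -> int * W -> Z).
Hypothesis hF : hbilin F.

Let hF1 w : hlin grU (fun p => hlift gW (F p) w).
Proof.
move=> n c u u' gu gu'.
rewrite -hliftP; apply: eq_hlift => j x gx; exact: (hF.2 j x gx).
Qed.

Lemma hlift2_bilin : bilin (fun u w => hlift gU (fun p => hlift gW (F p) w) u).
Proof.
split=> [u c w w'|w]; last exact: hlift_linear (hF1 w).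
rewrite -hliftP; apply: eq_hlift => n x gx.
exact: (hlift_linear _ (hF.1 n x gx)).
Qed.

Lemma hlift2_linear : linear (hlift2 F).
Proof. exact: (tlift_linear hlift2_bilin). Qed.

Lemma hlift2E i j u w : grU i u -> grW j w ->
  hlift2 F (u ⊗ w) = F (i, u) (j, w).
Proof.
move=> gu gw; rewrite /hlift2 (tliftE hlift2_bilin) (hliftE _ (hF1 w) gu).
exact: (hliftE _ (hF.1 i u gu) gw).
Qed.

End HomogeneousBilinear.

(** The right side depends on t alone, so a Sweedler sum of a function linear in each letter does
    not depend on the decomposition. Identities between such sums thereby become identities between
    linear maps. *)
Lemma sweedler_hlift2 (k : fieldType) (V Z : lmodType k) (gr : int -> V -> Prop)
    (gV : grading gr) (F : int * V -> int * V -> Z) n t s :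
    hbilin gr gr F -> sweedler gr n t s ->
  \sum_(p <- s) F p.1 p.2 = hlift2 gV gV F t.
Proof.
move=> hF [hs ->]; rewrite (linear_fun_bigop (hlift2_linear gV gV hF)).
rewrite [LHS]big_seq [RHS]big_seq; apply: eq_bigr => -[[i u] [j w]] /hs[/= gu gw _].
by rewrite (hlift2E gV gV hF gu gw).
Qed.

(** * Multilinear functions of homogeneous words *)

Section Words.
Variables (k : fieldType) (C : lmodType k) (gr : int -> C -> Prop).
Hypothesis grC : grading gr.
Local Notation letter := (int * C)%type.
Local Notation homog := (homog gr).
Local Notation hlin := (hlin gr).

Definition mlin (Z : lmodType k) (g : seq letter -> Z) : Prop :=
  forall p q n c a a', homog p -> homog q -> gr n a -> gr n a' ->
    g (p ++ (n, c *: a + a') :: q) =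
    c *: g (p ++ (n, a) :: q) + g (p ++ (n, a') :: q).

Lemma mlin_head (Z : lmodType k) (g : seq letter -> Z) q : mlin g -> homog q ->
  hlin (fun a => g (a :: q)).
Proof. by move=> mg hq n c a a' ga ga'; apply: (mg [::]). Qed.

Lemma mlin_behead (Z : lmodType k) (g : seq letter -> Z) a : mlin g ->
  gr a.1 a.2 -> mlin (fun w => g (a :: w)).
Proof.
move=> mg ga p q n c x x' hp hq gx gx'; apply: (mg (a :: p)) => //.
exact/homog_cons.
Qed.

Fixpoint mlift_seq (Z : lmodType k) (w : seq C) (g : seq letter -> Z) : Z :=
  if w is c :: w' then hlift grC (fun a => mlift_seq w' (fun v => g (a :: v))) c
  else g [::].

Lemma eq_mlift_seq (Z : lmodType k) w (g g' : seq letter -> Z) :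
  (forall v, homog v -> g v = g' v) -> mlift_seq w g = mlift_seq w g'.
Proof.
elim: w g g' => [|c w IH] g g' gg' /=; first by apply: gg'.
apply: eq_hlift => n a ga; apply: IH => v hv; apply: gg'.
exact/homog_cons.
Qed.

Lemma mlift_seqP (Z : lmodType k) w c (g g' : seq letter -> Z) :
  mlift_seq w (fun v => c *: g v + g' v) = c *: mlift_seq w g + mlift_seq w g'.
Proof.
elim: w g g' => [|x w IH] g g' //=.
by rewrite -hliftP; apply: eq_hlift => n a ga; rewrite IH.
Qed.

Lemma mlift_seq_hlin (Z : lmodType k) w (g : seq letter -> Z) : mlin g ->
  hlin (fun a => mlift_seq w (fun v => g (a :: v))).
Proof.
move=> mg n c a a' ga ga'; rewrite -mlift_seqP; apply: eq_mlift_seq => v hv.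
exact: (mlin_head mg hv).
Qed.

Lemma mlift_seq_mlin (Z : lmodType k) p q c x x' (g : seq letter -> Z) :
  mlin g -> mlift_seq (p ++ (c *: x + x') :: q) g =
  c *: mlift_seq (p ++ x :: q) g + mlift_seq (p ++ x' :: q) g.
Proof.
elim: p g => [|y p IH] g mg /=.
  exact: (hlift_linear _ (mlift_seq_hlin _ mg)).
rewrite -hliftP; apply: eq_hlift => n a ga; apply: IH.
exact: mlin_behead.
Qed.

Lemma mlift_seqE (Z : lmodType k) w (g : seq letter -> Z) : mlin g -> homog w ->
  mlift_seq [seq a.2 | a <- w] g = g w.
Proof.
elim: w g => [|[n a] w IH] g mg //= /homog_cons[/= ga hw].
rewrite (hliftE _ (mlift_seq_hlin _ mg) ga).
by apply: IH => //; apply: mlin_behead.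
Qed.

Definition mlift (Z : lmodType k) (g : seq letter -> Z) (x : tensor_powers C) : Z :=
  free_lift (fun w => mlift_seq w g) (repr x).

Section Mlift.
Variables (Z : lmodType k) (g : seq letter -> Z).
Hypothesis mg : mlin g.

Let word_rel0 x : word_rel x -> free_lift (fun w => mlift_seq w g) x = 0.
Proof.
case=> c [a [a' [p [q ->]]]].
by rewrite linearB linearD linearZ /= !free_liftU mlift_seq_mlin // subrr.
Qed.

Lemma mlift_linear : linear (mlift g).
Proof. exact: (quotient_lift_linear word_rel0). Qed.

Lemma mliftE w : homog w -> mlift g (hword w) = g w.
Proof.
move=> hw; rewrite /mlift (quotient_liftE word_rel0) /= free_liftU.
exact: mlift_seqE.
Qed.

End Mlift.

Lemma hword_mlin : mlin (@hword k C).
Proof.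
move=> p q n c a a' _ _ _ _; rewrite /hword !map_cat /= /pure -linearP.
by apply/qclassP/span_gen; exists c, a, a', [seq x.2 | x <- p], [seq x.2 | x <- q].
Qed.

(** ** Operations preserving multilinearity *)

Section MlinOps.
Variable Z : lmodType k.
Implicit Types (g : seq letter -> Z) (A B : seq letter).

Lemma mlin_lin (Z' : lmodType k) (f : Z -> Z') g : linear f -> mlin g ->
  mlin (fun w => f (g w)).
Proof. by move=> lf mg p q n c a a' *; rewrite mg // lf. Qed.

Lemma mlin_ctx g A B : mlin g -> homog A -> homog B ->
  mlin (fun w => g (A ++ w ++ B)).
Proof.
move=> mg hA hB p q n c a a' hp hq ga ga'.
by rewrite -!catA !(catA A) mg //; apply/homog_cat.
Qed.

Lemma mlin_scale (s : seq letter -> k) g :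
    (forall p q n a a', s (p ++ (n, a) :: q) = s (p ++ (n, a') :: q)) ->
  mlin g -> mlin (fun w => s w *: g w).
Proof.
move=> es mg p q n c a a' hp hq ga ga'; rewrite mg //.
rewrite (es p q n (c *: a + a') a) (es p q n a' a) scalerDr.
by rewrite !scalerA mulrC.
Qed.

Lemma mlin_cst (c : k) g : mlin g -> mlin (fun w => c *: g w).
Proof. exact: mlin_scale. Qed.

Lemma mlin_add g g' : mlin g -> mlin g' -> mlin (fun w => g w + g' w).
Proof.
by move=> mg mg' p q n c a a' *; rewrite mg // mg' // scalerDr addrACA.
Qed.

Lemma mlin_opp g : mlin g -> mlin (fun w => - g w).
Proof. by move=> mg p q n c a a' *; rewrite mg // opprD -scalerN. Qed.

Lemma mlin_spl (F : seq letter -> letter -> seq letter -> Z) :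
    (forall a Q, gr a.1 a.2 -> homog Q -> mlin (fun P => F P a Q)) ->
    (forall P Q, homog P -> homog Q -> hlin (fun a => F P a Q)) ->
    (forall P a, homog P -> gr a.1 a.2 -> mlin (F P a)) ->
  mlin (fun w => spl w F).
Proof.
move=> mP ma mQ p q n c x x' hp hq gx gx'.
rewrite !spl_cat /= !cats0 ma //.
rewrite (eq_spl (w := p) (G := fun P a Q => c *: F P a (Q ++ (n, x) :: q)
                                    + F P a (Q ++ (n, x') :: q))); last first.
  move=> P a Q ep; move: hp; rewrite ep => /homog_cat[hP /homog_cons[ga hQ]].
  exact: mQ.
rewrite (eq_spl (w := q) (G := fun P a Q => c *: F (p ++ (n, x) :: P) a Q
                                    + F (p ++ (n, x') :: P) a Q)); last first.
  move=> P a Q eq; move: hq; rewrite eq => /homog_cat[hP /homog_cons[ga hQ]].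
  exact: mP.
rewrite !splD -!splZ !scalerDr !addrA.
by rewrite [LHS](ACl (1*3*5*2*4*6))%AC.
Qed.

End MlinOps.

End Words.

(** * Cyclic words *)

Section WordDegree.
Variables (k : fieldType) (C : lmodType k).
Local Notation letter := (int * C)%type.
Implicit Types (u v w P Q X Y : seq letter) (a c : letter).

Lemma wdeg_nil : wdeg ([::] : seq letter) = 0.
Proof. by rewrite /wdeg big_nil. Qed.

Lemma wdeg_cons a w : wdeg (a :: w) = a.1 - 1 + wdeg w.
Proof. by rewrite /wdeg big_cons. Qed.

Lemma wdeg_cat u v : wdeg (u ++ v) = wdeg u + wdeg v.
Proof. by rewrite /wdeg big_cat. Qed.

Lemma wdeg_rcons w a : wdeg (rcons w a) = wdeg w + (a.1 - 1).
Proof. by rewrite -cats1 wdeg_cat wdeg_cons wdeg_nil addr0. Qed.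

Lemma epsilonE w : epsilon w = wdeg w + 1.
Proof.
rewrite /epsilon /wdeg sumrB; congr (_ - _ + 1).
by rewrite big_const_seq count_predT iter_addr_0 natz.
Qed.

Lemma ldegE m w : ldeg m w = wdeg w - m + 2.
Proof. by rewrite /ldeg epsilonE; ring. Qed.

End WordDegree.

Definition wdegE := (wdeg_cat, wdeg_cons, wdeg_rcons, wdeg_nil).

Ltac word_sign := rewrite ?wdegE /=; ksign.

Section CyclicSums.
Variables (k : fieldType) (C Z : lmodType k) (gr : int -> C -> Prop).
Local Notation letter := (int * C)%type.
Local Notation homog := (homog gr).
Implicit Types (u v w P Q X Y : seq letter) (a c : letter).

Lemma eq_splh w (F G : seq letter -> letter -> seq letter -> Z) : homog w ->
    (forall P a Q, homog P -> gr a.1 a.2 -> homog Q ->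
       wdeg w = wdeg P + (a.1 - 1) + wdeg Q -> F P a Q = G P a Q) ->
  spl w F = spl w G.
Proof.
move=> hw FG; apply: eq_spl => P a Q ew.
move: hw; rewrite ew => /homog_cat[hP /homog_cons[ga hQ]]; apply: FG => //.
by rewrite ew !wdegE addrA.
Qed.

(* The sum over all letters a of the cyclic word w of F a A, where w is a A
   after a rotation with its Koszul sign. *)
Definition cyc1 w (F : letter -> seq letter -> Z) : Z :=
  spl w (fun P a Q => sgn (wdeg P * (wdeg Q + (a.1 - 1))) *: F a (Q ++ P)).

(** A sum over the ordered pairs of distinct letters of the cyclic word, X and Y being the two arcs
    that they bound. *)
Definition cyc2 w (H : letter -> seq letter -> letter -> seq letter -> Z) : Z :=
  cyc1 w (fun a A => spl A (fun X c Y => H a X c Y)).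

Lemma eq_cyc1 w (F G : letter -> seq letter -> Z) : homog w ->
    (forall a A, gr a.1 a.2 -> homog A -> wdeg w = a.1 - 1 + wdeg A ->
       F a A = G a A) ->
  cyc1 w F = cyc1 w G.
Proof.
move=> hw FG; apply: eq_splh => // P a Q hP ga hQ ew; congr (_ *: _).
by apply: FG => //; [apply/homog_cat | rewrite ew wdeg_cat; ring].
Qed.

Lemma eq_cyc2 w (F G : letter -> seq letter -> letter -> seq letter -> Z) :
    homog w ->
    (forall a X c Y, gr a.1 a.2 -> homog X -> gr c.1 c.2 -> homog Y ->
       wdeg w = a.1 - 1 + wdeg X + (c.1 - 1) + wdeg Y ->
       F a X c Y = G a X c Y) ->
  cyc2 w F = cyc2 w G.
Proof.
move=> hw FG; apply: eq_cyc1 => // a A ga hA ew; apply: eq_splh => //.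
by move=> X c Y hX gc hY eA; apply: FG => //; rewrite ew eA !addrA.
Qed.

Lemma cyc1_cat u v F : cyc1 (u ++ v) F =
  spl u (fun P a Q => sgn (wdeg P * (wdeg Q + wdeg v + (a.1 - 1))) *:
                      F a (Q ++ v ++ P)) +
  spl v (fun P a Q => sgn ((wdeg u + wdeg P) * (wdeg Q + (a.1 - 1))) *:
                      F a (Q ++ u ++ P)).
Proof.
rewrite /cyc1 spl_cat; congr (_ + _).
  by apply: eq_spl => P a Q _; rewrite wdeg_cat catA.
by apply: eq_spl => P a Q _; rewrite wdeg_cat.
Qed.

Lemma cyc1_rot u v F :
  cyc1 (u ++ v) F = sgn (wdeg u * wdeg v) *: cyc1 (v ++ u) F.
Proof.
rewrite !cyc1_cat addrC scalerDr !splZ; congr (_ + _).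
  by apply: eq_spl => P a Q ->; rewrite sgn_scaleA; congr (_ *: _); word_sign.
by apply: eq_spl => P a Q ->; rewrite sgn_scaleA; congr (_ *: _); word_sign.
Qed.

(** Each pair of positions P a X c Y is met twice, once with the reading started at a and once with
    the reading started at c. *)
Lemma cyc2E w H : cyc2 w H =
  spl w (fun P a T => spl T (fun X c Y =>
    sgn (wdeg P * (a.1 - 1 + wdeg X + (c.1 - 1) + wdeg Y)) *: H a X c (Y ++ P)
    + sgn ((wdeg P + (a.1 - 1) + wdeg X) * (c.1 - 1 + wdeg Y)) *:
        H c (Y ++ P) a X)).
Proof.
rewrite /cyc2 /cyc1.
under eq_spl => P a Q ew do rewrite spl_cat scalerDr !splZ.
rewrite splD [X in _ + X](_ : _ = spl w (fun P a T => spl T (fun X c Y =>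
  sgn ((wdeg P + (a.1 - 1) + wdeg X) * (c.1 - 1 + wdeg Y)) *:
    H c (Y ++ P) a X))); last first.
  rewrite [RHS]splA; apply: eq_spl => P a Q _; apply: eq_spl => X c Y ->.
  by congr (_ *: _); word_sign.
rewrite -splD; apply: eq_spl => P a T _; rewrite -splD.
apply: eq_spl => X c Y ->; congr (_ + _).
by congr (_ *: _); word_sign.
Qed.

(** Starting the reading at c instead of a exchanges the arcs, with the Koszul sign of moving a X
    past c Y. The antisymmetries and pairwise cancellations below come from this exchange. *)
Lemma cyc2_sym w H : cyc2 w H =
  cyc2 w (fun a X c Y =>
    sgn ((a.1 - 1 + wdeg X) * (c.1 - 1 + wdeg Y)) *: H c Y a X).
Proof.
rewrite !cyc2E; apply: eq_spl => P a T _; apply: eq_spl => X c Y _.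
rewrite !sgn_scaleA addrC; congr (_ + _).
  by congr (_ *: _); word_sign.
by congr (_ *: _); word_sign.
Qed.

Lemma cyc1D w F G :
  cyc1 w (fun a A => F a A + G a A) = cyc1 w F + cyc1 w G.
Proof.
by rewrite /cyc1 -splD; apply: eq_spl => P a Q _; rewrite scalerDr.
Qed.

Lemma cyc1Z w (c : k) F : c *: cyc1 w F = cyc1 w (fun a A => c *: F a A).
Proof.
rewrite /cyc1 splZ; apply: eq_spl => P a Q _.
by rewrite !scalerA mulrC.
Qed.

Lemma cyc1N w F : - cyc1 w F = cyc1 w (fun a A => - F a A).
Proof. by rewrite /cyc1 splN; apply: eq_spl => P a Q _; rewrite scalerN. Qed.

Lemma cyc1_0 w : cyc1 w (fun _ _ => 0) = 0.
Proof.
by rewrite /cyc1 -[RHS](@spl0 _ _ w); apply: eq_spl => *; rewrite scaler0.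
Qed.

Lemma cyc2D w F G : cyc2 w (fun a X c Y => F a X c Y + G a X c Y) =
  cyc2 w F + cyc2 w G.
Proof.
by rewrite /cyc2 -cyc1D; congr cyc1; apply/funext=> a; apply/funext=> A; rewrite splD.
Qed.

Lemma cyc2Z w (e : k) F :
  e *: cyc2 w F = cyc2 w (fun a X c Y => e *: F a X c Y).
Proof.
by rewrite /cyc2 cyc1Z; congr cyc1; apply/funext=> a; apply/funext=> A; rewrite splZ.
Qed.

Lemma cyc2N w F : - cyc2 w F = cyc2 w (fun a X c Y => - F a X c Y).
Proof.
by rewrite /cyc2 cyc1N; congr cyc1; apply/funext=> a; apply/funext=> A; rewrite splN.
Qed.

Lemma cyc1_mlin F :
    (forall a, gr a.1 a.2 -> mlin gr (F a)) ->
    (forall A, homog A -> hlin gr (F^~ A)) ->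
  mlin gr (fun w => cyc1 w F).
Proof.
move=> mF hF; apply: mlin_spl.
- move=> a Q ga hQ; apply: mlin_scale => [p q n x y|]; first by rewrite !wdegE.
  have := mlin_ctx (mF a ga) hQ (homog_nil gr).
  by under eq_fun do rewrite cats0.
- move=> P Q hP hQ n c a a' ga ga' /=.
  by rewrite hF //; [rewrite scalerDr !scalerA mulrC | apply/homog_cat].
- move=> P a hP ga; apply: mlin_scale => [p q n x y|]; first by rewrite !wdegE.
  exact: (mlin_ctx (A := [::]) (mF a ga) (homog_nil gr) hP).
Qed.

End CyclicSums.

Section CyclicSumsExchange.
Variables (k : fieldType) (C Z Z' : lmodType k) (gr : int -> C -> Prop).
Local Notation letter := (int * C)%type.
Implicit Types (u v w : seq letter).

Lemma cyc1_spl_exchange u v (F : letter -> seq letter ->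
    seq letter -> letter -> seq letter -> Z) :
  cyc1 u (fun a A => spl v (F a A)) =
  spl v (fun P c Q => cyc1 u (fun a A => F a A P c Q)).
Proof.
rewrite /cyc1 -spl_exchange; apply: eq_spl => P a Q _.
by rewrite splZ.
Qed.

Lemma cyc1_exchange u v (F : letter -> seq letter -> letter -> seq letter -> Z) :
  cyc1 u (fun a A => cyc1 v (F a A)) = cyc1 v (fun c X => cyc1 u (fun a A => F a A c X)).
Proof.
rewrite [LHS]cyc1_spl_exchange; apply: eq_spl => P c Q _.
by rewrite cyc1Z.
Qed.

Lemma cyc1_linear (f : Z -> Z') w F : linear f ->
  f (cyc1 w F) = cyc1 w (fun a A => f (F a A)).
Proof.
move=> lf; rewrite /cyc1 spl_linear //; apply: eq_spl => P a Q _.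
by rewrite (linear_funZ lf).
Qed.

Lemma cyc2_linear (f : Z -> Z') w F : linear f ->
  f (cyc2 w F) = cyc2 w (fun a X c Y => f (F a X c Y)).
Proof.
move=> lf; rewrite /cyc2 cyc1_linear //; congr cyc1; apply/funext=> a.
by apply/funext=> A; rewrite spl_linear.
Qed.

End CyclicSumsExchange.

Section ConnesWords.
Variables (k : fieldType) (C : lmodType k) (gr : int -> C -> Prop).
Hypothesis char_k : [pchar k] =i pred0.
Hypothesis grC : grading gr.
Local Notation letter := (int * C)%type.
Local Notation homog := (homog gr).
Local Notation CC := (CC gr).
Local Notation ccN := (ccN gr).
Implicit Types (u v w : seq letter).

(** The number [epsilon x.2 - a.1] is the degree in C[1] of the letters after a, so each step of t
    carries the Koszul sign of a rotation and the signs of successive steps multiply to that of the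
    total rotation. *)
Lemma iter_rotate w i : (i <= size w)%N ->
  iter i (@rotate k C) (1, w) =
  (sgn (wdeg (take i w) * wdeg (drop i w)), drop i w ++ take i w).
Proof.
elim: i => [|i IH] iw; first by rewrite take0 drop0 cats0 wdeg_nil mul0r.
rewrite iterS IH 1?ltnW // (drop_nth (0, 0) iw) /=.
rewrite /rotate /= (take_nth (0, 0) iw) -!cats1 -catA.
congr (_, _); rewrite -sgnD epsilonE.
by word_sign.
Qed.

Lemma cycNE w : cycN w = cyc1 w (fun a A => hword (a :: A)).
Proof.
rewrite /cyc1 (spl_nth (0, 0)) /cycN; apply: eq_bigr => i _.
set x := iter _ _ _; have ex : x = _ := iter_rotate (ltnW (ltn_ord i)).
have [-> ->] : x.1 = sgn (wdeg (take i w) * wdeg (drop i w)) /\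
  x.2 = drop i w ++ take i w by rewrite ex.
rewrite (drop_nth (0, 0) (ltn_ord i)); congr (_ *: _).
by word_sign.
Qed.

Lemma cycN_rot u v : cycN (u ++ v) = sgn (wdeg u * wdeg v) *: cycN (v ++ u).
Proof. by rewrite !cycNE cyc1_rot. Qed.

Lemma cycN_mlin : mlin gr (@cycN k C).
Proof.
have -> : @cycN k C = fun w => cyc1 w (fun a A => hword (a :: A)).
  by apply/funext=> w; apply: cycNE.
apply: cyc1_mlin => [a ga|A hA].
  exact: (mlin_behead (@hword_mlin _ _ gr) ga).
exact: (mlin_head (@hword_mlin _ _ gr) hA).
Qed.

Lemma cc_val_inj : injective (@cc_val k C gr).
Proof. exact: val_inj. Qed.

Lemma cc_val_linear : linear (@cc_val k C gr).
Proof. by []. Qed.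

Lemma ccN_mlin : mlin gr ccN.
Proof.
move=> p q n c a a' hp hq ga ga'; apply: cc_val_inj.
have h x : gr n x -> homog (p ++ (n, x) :: q).
  by move=> gx; apply/homog_cat; split=> //; apply/homog_cons.
rewrite cc_val_linear !ccNE ?cycN_mlin //; apply: h => //.
exact: grP.
Qed.

Lemma ccN_rot u v : homog u -> homog v ->
  ccN (u ++ v) = sgn (wdeg u * wdeg v) *: ccN (v ++ u).
Proof.
move=> hu hv; apply: cc_val_inj.
have huv : homog (u ++ v) by apply/homog_cat.
have hvu : homog (v ++ u) by apply/homog_cat.
rewrite (ccNE huv) cycN_rot -(ccNE hvu).
by rewrite (linear_funZ cc_val_linear).
Qed.

Lemma ccN_nil : ccN [::] = 0.
Proof.
apply: cc_val_inj; rewrite ccNE // /cycN big_ord0.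
by rewrite (linear_fun0 cc_val_linear).
Qed.

Lemma CC_ind (S : CC -> Prop) :
    S 0 -> (forall c x y, S x -> S y -> S (c *: x + y)) ->
    (forall w, homog w -> S (ccN w)) -> forall x, S x.
Proof.
move=> S0 SP Sw x; have /asboolP[s [sS ex]] := valP x.
pose f (p : k * tensor_powers C) : CC := insubd 0 p.2.
have -> : x = \sum_(p <- s) p.1 *: f p.
  apply: cc_val_inj; rewrite (linear_fun_sum _ _ _ cc_val_linear).
  rewrite [LHS]ex [LHS]big_seq [RHS]big_seq; apply: eq_bigr => p ps.
  by rewrite /cc_val insubdK //; apply/asboolP/span_gen/sS.
rewrite big_seq; elim/big_rec: _ => // p y /sS[w hw ew] Sy.
by apply: (SP) => //; rewrite /f ew; apply: Sw.
Qed.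

Lemma eq_on_CC (Z : lmodType k) (f g : CC -> Z) : linear f -> linear g ->
  (forall w, homog w -> f (ccN w) = g (ccN w)) -> f =1 g.
Proof.
move=> lf lg fg; apply: CC_ind => [|c x y fx fy|w]; last exact: fg.
  by rewrite !linear_fun0.
by rewrite lf lg fx fy.
Qed.

Lemma L_gr_ind m n (S : CC -> Prop) :
    S 0 -> (forall c x y, S x -> S y -> S (c *: x + y)) ->
    (forall w, homog w -> ldeg m w = n -> S (ccN w)) ->
  forall x, L_gr m n x -> S x.
Proof.
move=> S0 SP Sw x [s [sS ex]].
pose f (p : k * tensor_powers C) : CC := insubd 0 p.2.
have -> : x = \sum_(p <- s) p.1 *: f p.
  apply: cc_val_inj; rewrite (linear_fun_sum _ _ _ cc_val_linear).
  rewrite [LHS]ex [LHS]big_seq [RHS]big_seq; apply: eq_bigr => p ps.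
  rewrite /cc_val insubdK //; apply/asboolP/span_gen.
  by have [w [hw _ ->]] := sS _ ps; exists w.
rewrite big_seq; elim/big_rec: _ => // p y /sS[w [hw dw ew]] Sy.
by apply: (SP) => //; rewrite /f ew; apply: Sw.
Qed.

Lemma eq_on_L_gr (Z : lmodType k) m n (f g : CC -> Z) :
    linear f -> linear g ->
    (forall w, homog w -> ldeg m w = n -> f (ccN w) = g (ccN w)) ->
  forall x, L_gr m n x -> f x = g x.
Proof.
move=> lf lg fg; apply: L_gr_ind => [|c x y fx fy|w]; last exact: fg.
  by rewrite !linear_fun0.
by rewrite lf lg fx fy.
Qed.

Lemma L_gr_ccN m w : homog w -> L_gr m (ldeg m w) (ccN w).
Proof. by move=> hw; apply: span_gen; exists w; rewrite ccNE. Qed.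

Lemma L_grP m n c (x y : CC) :
  L_gr m n x -> L_gr m n y -> L_gr m n (c *: x + y).
Proof.
rewrite /L_gr cc_val_linear => /asboolP hx /asboolP hy; apply/asboolP.
exact: ((spanb_submod_closed _).2 c _ _ hx hy).
Qed.

Lemma L_gr0 m n : L_gr m n (0 : CC).
Proof. by rewrite /L_gr (linear_fun0 cc_val_linear); exists [::]; rewrite big_nil. Qed.

Lemma L_grZ m n c (x : CC) : L_gr m n x -> L_gr m n (c *: x).
Proof. by move=> hx; have := L_grP c hx (L_gr0 m n); rewrite addr0. Qed.

(** ** Functions on cyclic words *)

Definition cyclic (Z : lmodType k) (f : seq letter -> Z) : Prop :=
  forall u v, homog u -> homog v -> f (u ++ v) = sgn (wdeg u * wdeg v) *: f (v ++ u).

(* On the image of N, dividing by the length of the words is a section of N up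
   to rotations. *)
Definition divlen : tensor_powers C -> tensor_powers C :=
  mlift grC (fun w => (size w)%:R^-1 *: hword w).

Lemma divlen_mlin : mlin gr (fun w : seq letter => (size w)%:R^-1 *: hword w).
Proof.
apply: mlin_scale; last exact: hword_mlin.
by move=> p q n a a'; rewrite !size_cat.
Qed.

Definition clift (Z : lmodType k) (f : seq letter -> Z) (x : CC) : Z :=
  mlift grC f (divlen (cc_val x)).

Section Clift.
Variables (Z : lmodType k) (f : seq letter -> Z).
Hypothesis mf : mlin gr f.

Lemma clift_linear : linear (clift f).
Proof.
move=> c x y; rewrite /clift /divlen cc_val_linear (mlift_linear grC divlen_mlin).
exact: (mlift_linear grC mf).
Qed.

(** By cyclicity each of the rotations summed in N contributes f w divided by the length of w, and
    there are as many rotations as letters; characteristic zero makes the length invertible. The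
    empty word has no rotation, whence the condition on f [::]. *)
Lemma cliftE w : cyclic f -> f [::] = 0 -> homog w -> clift f (ccN w) = f w.
Proof.
move=> cf f0 hw; rewrite /clift /divlen ccNE // cycNE.
rewrite (cyc1_linear _ _ (mlift_linear grC divlen_mlin)).
rewrite (cyc1_linear _ _ (mlift_linear grC mf)).
rewrite [LHS](eq_spl (G := fun _ _ _ => (size w)%:R^-1 *: f w)).
  case: w hw => [|x w] hw; first by rewrite /= f0.
  rewrite (spl_nth (0, 0)) sumr_const card_ord -scaler_nat scalerA.
  by rewrite divff ?scale1r // ((pcharf0P k).1 char_k).
move=> P a Q ew.
have [hP [ga hQ]] : homog P /\ gr a.1 a.2 /\ homog Q.
  by move: hw; rewrite ew => /homog_cat[? /homog_cons[? ?]].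
have haQP : homog (a :: Q ++ P) by apply/homog_cons; split=> //; apply/homog_cat.
rewrite (mliftE grC divlen_mlin) // (linear_funZ (mlift_linear grC mf)).
rewrite (mliftE grC mf) // -sgn_scaleC; congr (_ *: _); last first.
  rewrite ew (cf P) //; last exact/homog_cons.
  by congr (_ *: _); word_sign.
by rewrite ew -cat_cons !size_cat addnC.
Qed.

End Clift.

End ConnesWords.

Lemma parity_summand (i j n : int) :
  i + j = n -> parity j = parity n (+) parity i.
Proof. by move=> <-; rewrite parityD addbAC addbb. Qed.

Section CyclicSumsMlin.
Variables (k : fieldType) (C Z : lmodType k) (gr : int -> C -> Prop).
Local Notation letter := (int * C)%type.
Local Notation homog := (homog gr).

Lemma cyc1_mlinr v (F : seq letter -> letter -> seq letter -> Z) : homog v ->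
    (forall c X, gr c.1 c.2 -> homog X -> mlin gr (fun w => F w c X)) ->
  mlin gr (fun w => cyc1 v (F w)).
Proof.
move=> hv mF p q n e a a' hp hq ga ga'; rewrite cyc1Z -cyc1D.
by apply: (eq_cyc1 hv) => c X gc hX _; apply: mF.
Qed.

Lemma cyc1_hlinr v (F : letter -> letter -> seq letter -> Z) : homog v ->
    (forall c X, gr c.1 c.2 -> homog X -> hlin gr (fun a => F a c X)) ->
  hlin gr (fun a => cyc1 v (F a)).
Proof.
move=> hv hF n e a a' ga ga'; rewrite cyc1Z -cyc1D.
by apply: (eq_cyc1 hv) => c X gc hX _; apply: hF.
Qed.

Lemma hlin_linear (f : C -> Z) : linear f -> hlin gr (fun a => f a.2).
Proof. by move=> lf n c a a' _ _; apply: lf. Qed.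

Lemma hlin_scale (s : letter -> k) (f : letter -> Z) :
    (forall n a a', s (n, a) = s (n, a')) -> hlin gr f ->
  hlin gr (fun a => s a *: f a).
Proof.
move=> es hf n c a a' ga ga'; rewrite hf // (es n (c *: a + a') a) (es n a' a).
by rewrite scalerDr !scalerA mulrC.
Qed.

Lemma hlin_cst_scale (f : C -> k^o) (z : Z) : linear f ->
  hlin gr (fun a => f a.2 *: z).
Proof. by move=> lf n c a a' _ _ /=; rewrite lf scalerDl -scalerA. Qed.

End CyclicSumsMlin.

Lemma scale_interchange (k : fieldType) (Z : lmodType k) (c e : k) (x y x' y' : Z) :
  e *: (c *: x + y) + (c *: x' + y') = c *: (e *: x + x') + (e *: y + y').
Proof. by rewrite !scalerDr !scalerA [e * c]mulrC addrACA. Qed.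

(** * Bilinear maps on the Connes complex *)

Section BilinearLift.
Variables (k : fieldType) (C Z : lmodType k) (gr : int -> C -> Prop).
Hypothesis char_k : [pchar k] =i pred0.
Hypothesis grC : grading gr.
Local Notation letter := (int * C)%type.
Local Notation homog := (homog gr).
Local Notation CC := (CC gr).
Local Notation ccN := (ccN gr).
Variable f : seq letter -> seq letter -> Z.
Hypothesis f_mlinl : forall v, homog v -> mlin gr (f^~ v).
Hypothesis f_mlinr : forall u, homog u -> mlin gr (f u).
Hypothesis f_cyclicl : forall v, homog v -> cyclic gr (f^~ v).
Hypothesis f_cyclicr : forall u, homog u -> cyclic gr (f u).
Hypothesis f_nill : forall v, f [::] v = 0.
Hypothesis f_nilr : forall u, f u [::] = 0.

Definition clift2 (x y : CC) : Z := clift grC (fun u => clift grC (f u) y) x.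

Let inr_lin u : homog u -> linear (clift grC (f u)).
Proof. by move=> hu; apply/clift_linear/f_mlinr. Qed.

Let inrE u v : homog u -> homog v -> clift grC (f u) (ccN v) = f u v.
Proof.
by move=> hu hv; apply: (cliftE char_k _ (f_mlinr hu)) => //; apply: f_cyclicr.
Qed.

(** The inner lift is only known on cyclic words. Both sides are linear in y, so it is enough to
    take y of the form [ccN v], where [inrE] evaluates it. *)
Let inl_mlin y : mlin gr (fun u => clift grC (f u) y).
Proof.
move=> p q n c a a' hp hq ga ga'.
have h x : gr n x -> homog (p ++ (n, x) :: q).
  by move=> gx; apply/homog_cat; split=> //; apply/homog_cons.
have hc := h _ (grP grC c ga ga').
elim/CC_ind: y => [|e x y IHx IHy|v hv].
- by rewrite !(linear_fun0 (inr_lin _)) ?scaler0 ?addr0 //; apply: h.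
- rewrite !(inr_lin _) ?IHx ?IHy; try exact: h; try exact: hc.
  exact: scale_interchange.
- rewrite !inrE; try exact: h; try exact: hc; try by [].
  exact: (f_mlinl hv).
Qed.

Let inl_cyclic y : cyclic gr (fun u => clift grC (f u) y).
Proof.
move=> u u' hu hu'.
have hc1 : homog (u ++ u') by apply/homog_cat.
have hc2 : homog (u' ++ u) by apply/homog_cat.
elim/CC_ind: y => [|e x y IHx IHy|v hv].
- by rewrite !(linear_fun0 (inr_lin _)) ?scaler0.
- by rewrite (inr_lin hc1) (inr_lin hc2) IHx IHy scalerDr !scalerA mulrC.
- by rewrite !inrE //; apply: (f_cyclicl hv).
Qed.

Lemma clift2_bilin : bilin clift2.
Proof.
have lP y e x x' : clift2 (e *: x + x') y = e *: clift2 x y + clift2 x' y.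
  exact: (clift_linear grC (inl_mlin y)).
split=> [x|y]; last by move=> e x x'; apply: lP.
elim/CC_ind: x => [|e x x' IHx IHx'|u hu].
- have l0 y : clift2 0 y = 0.
    exact: (@linear_fun0 _ _ _ (clift2^~ y) (lP y)).
  by move=> c y y'; rewrite !l0 scaler0 addr0.
- move=> c y y'; rewrite 3!lP (IHx c y y') (IHx' c y y').
  exact: scale_interchange.
- have e y : clift2 (ccN u) y = clift grC (f u) y.
    apply: (cliftE char_k _ (inl_mlin y)) => //.
    elim/CC_ind: y => [|e x y IHx IHy|v hv].
    + by rewrite (linear_fun0 (inr_lin _)).
    + by rewrite (inr_lin _) // IHx IHy scaler0 addr0.
    + by rewrite inrE.
  by move=> c y y'; rewrite !e inr_lin.
Qed.

Lemma clift2E u v : homog u -> homog v -> clift2 (ccN u) (ccN v) = f u v.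
Proof.
move=> hu hv; rewrite -(inrE hu hv).
apply: (cliftE char_k _ (inl_mlin (ccN v))) => //.
by rewrite inrE.
Qed.

End BilinearLift.

(** * The bracket *)

Section Bracket.
Variables (k : fieldType) (C : lmodType k) (gr : int -> C -> Prop).
Variables (pr : C -> C -> k) (m : int).
Hypothesis char_k : [pchar k] =i pred0.
Hypothesis grC : grading gr.
Hypothesis pr_bilin : bilin (pr : C -> C -> k^o).
Hypothesis pr_degree : forall i j a c, gr i a -> gr j c -> i + j != m -> pr a c = 0.
Hypothesis pr_sym : forall i j a c, gr i a -> gr j c ->
  pr a c = sgn (i * j + m) * pr c a.
Local Notation letter := (int * C)%type.
Local Notation homog := (homog gr).
Local Notation CC := (CC gr).
Local Notation ccN := (ccN gr).
Local Notation ldeg := (ldeg m).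
Implicit Types (u v w : seq letter) (a c : letter).

Lemma pr_swap (Z : lmodType k) a c (x : Z) : gr a.1 a.2 -> gr c.1 c.2 ->
  pr a.2 c.2 *: x = sgn (a.1 * c.1 + m) *: (pr c.2 a.2 *: x).
Proof. by move=> ga gc; rewrite (pr_sym ga gc) scalerA. Qed.

(** If the degrees of a and c do not add up to m, both sides are 0; so the resulting relation
    between parities may be assumed while the exponents are compared. *)
Lemma sgn_pr (Z : lmodType k) a c e e' (x : Z) : gr a.1 a.2 -> gr c.1 c.2 ->
    (parity c.1 = parity m (+) parity a.1 -> parity e = parity e') ->
  sgn e *: (pr a.2 c.2 *: x) = sgn e' *: (pr a.2 c.2 *: x).
Proof.
move=> ga gc ee; case: (eqVneq (a.1 + c.1) m) => [em|ne].
  by rewrite (sgn_eq k (ee _)) // (parity_summand em).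
by rewrite (pr_degree ga gc ne) !scale0r !scaler0.
Qed.

Lemma sgn_pr2 (Z : lmodType k) a c b f e e' (x : Z) :
    gr a.1 a.2 -> gr c.1 c.2 -> gr b.1 b.2 -> gr f.1 f.2 ->
    (parity c.1 = parity m (+) parity a.1 ->
     parity f.1 = parity m (+) parity b.1 -> parity e = parity e') ->
  sgn e *: (pr a.2 c.2 *: (pr b.2 f.2 *: x)) =
  sgn e' *: (pr a.2 c.2 *: (pr b.2 f.2 *: x)).
Proof.
move=> ga gc gb gf ee; case: (eqVneq (a.1 + c.1) m) => [ec|ne]; last first.
  by rewrite (pr_degree ga gc ne) !scale0r !scaler0.
case: (eqVneq (b.1 + f.1) m) => [ef|ne]; last first.
  by rewrite (pr_degree gb gf ne) !scale0r !scaler0.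
by rewrite (sgn_eq k (ee _ _)) // ?(parity_summand ec) ?(parity_summand ef).
Qed.

(** The rotations in [cyc1] bring u to a A and v to c X. The first summand of the exponent moves a
    past A, next to c; the second is the contribution of the desuspensions in [bracket_sign]. *)
Definition brw u v : CC := cyc1 u (fun a A => cyc1 v (fun c X =>
  sgn ((a.1 - 1) * wdeg A + (m + 1) * a.1) *: (pr a.2 c.2 *: ccN (A ++ X)))).

Lemma brw_mlinl v : homog v -> mlin gr (brw^~ v).
Proof.
move=> hv; apply: cyc1_mlin => [a ga|A hA].
  apply: (cyc1_mlinr hv) => c X gc hX.
  apply: mlin_scale => [p q n x y|]; first by rewrite !wdegE.
  apply: mlin_cst.
  exact: (mlin_ctx (A := [::]) (ccN_mlin grC) (homog_nil gr) hX).
apply: (cyc1_hlinr hv) => c X gc hX.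
apply: (hlin_scale (s := fun a => sgn ((a.1 - 1) * wdeg A + (m + 1) * a.1))) => //.
exact: hlin_cst_scale (pr_bilin.2 c.2).
Qed.

Lemma brw_mlinr u : homog u -> mlin gr (brw u).
Proof.
move=> hu; apply: (cyc1_mlinr hu) => a A ga hA.
apply: cyc1_mlin => [c gc|X hX].
  apply: mlin_cst; apply: mlin_cst.
  have := mlin_ctx (ccN_mlin grC) hA (homog_nil gr).
  by under eq_fun do rewrite cats0.
apply: hlin_scale => //.
exact: hlin_cst_scale (pr_bilin.1 a.2).
Qed.

Lemma brw_cyclicl v : homog v -> cyclic gr (brw^~ v).
Proof. by move=> hv u u' hu hu'; apply: cyc1_rot. Qed.

Lemma brw_cyclicr u : homog u -> cyclic gr (brw u).
Proof.
move=> hu v v' hv hv'; rewrite /brw cyc1Z; apply: (eq_cyc1 hu) => a A _ _ _.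
exact: cyc1_rot.
Qed.

Lemma brw_nill v : brw [::] v = 0. Proof. by []. Qed.

Lemma brw_nilr u : brw u [::] = 0. Proof. exact: cyc1_0. Qed.

Definition br : CC -> CC -> CC := clift2 grC brw.

Lemma br_bilinear : bilin br.
Proof.
exact: (clift2_bilin char_k grC brw_mlinl brw_mlinr brw_cyclicl brw_cyclicr
  brw_nill brw_nilr).
Qed.

Lemma brE u v : homog u -> homog v -> br (ccN u) (ccN v) = brw u v.
Proof.
exact: (clift2E char_k grC brw_mlinl brw_mlinr brw_cyclicl brw_cyclicr
  brw_nill brw_nilr).
Qed.

Lemma br_bracket_formula : bracket_formula pr m br.
Proof.
move=> u v hu hv; rewrite brE // /brw /cyc1 (spl_nth (0, 0)).
apply: eq_bigr => i _; rewrite (spl_nth (0, 0)) scaler_sumr; apply: eq_bigr => j _.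
rewrite /bracket_sign -scalerA !sgn_scaleA; congr (_ *: _); first by word_sign.
by rewrite -catA.
Qed.

Lemma brw_skew u v : homog u -> homog v ->
  brw u v = - sgn (ldeg u * ldeg v) *: brw v u.
Proof.
move=> hu hv; rewrite /brw cyc1_exchange sgnS cyc1Z; apply: (eq_cyc1 hv) => c X gc hX ev.
rewrite cyc1Z; apply: (eq_cyc1 hu) => a A ga hA eu.
rewrite (pr_swap _ gc ga) (ccN_rot hX hA).
rewrite ![pr a.2 c.2 *: (sgn _ *: _)]sgn_scaleC !sgn_scaleA.
by apply: (sgn_pr _ ga gc) => ec; rewrite !ldegE eu ev !parityE ec; parity_cases.
Qed.

End Bracket.

Lemma sgn_cancel (k : fieldType) (Z : lmodType k) (n p : int) (z : Z) :
  parity n = ~~ parity p -> sgn n *: z + sgn p *: z = 0.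
Proof.
move=> np; rewrite -scalerDl !sgn_parity np.
by case: parity; rewrite /= ?expr0 ?expr1 ?subrr ?addNr scale0r.
Qed.

(** Here x, y and z are the parts of the Jacobi identity in which v, w and u respectively is the
    word joined to both others. The two occurrences of z cancel on the right; those of x and y match
    across the equality. *)
Lemma jacobi_signs (k : fieldType) (Z : lmodType k) (i j l : int) (x y z : Z) :
  sgn (i * l + j * l + i * j) *: x
  - sgn (j * l) *: (sgn (i * j + l * j + i * l) *: y) =
  - sgn ((i + j) * l) *: (z - sgn (i * j) *: x)
  + sgn (i * j) *: (sgn (j * l + i * l + j * i) *: z - sgn (i * l) *: y).
Proof.
rewrite sgnS !scalerBr !sgn_scaleA !sgn_scaleN addrACA.
rewrite sgn_cancel; last by parity_cases.
by rewrite add0r; congr (_ + _); congr (_ *: _); ksign.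
Qed.

Section CyclicSumsClosed.
Variables (k : fieldType) (C Z : lmodType k) (gr : int -> C -> Prop).
Variable S : Z -> Prop.
Hypothesis S0 : S 0.
Hypothesis SP : forall c x y, S x -> S y -> S (c *: x + y).
Local Notation letter := (int * C)%type.
Local Notation homog := (homog gr).

Lemma splh_closed w (F : seq letter -> letter -> seq letter -> Z) : homog w ->
    (forall P a Q, homog P -> gr a.1 a.2 -> homog Q ->
       wdeg w = wdeg P + (a.1 - 1) + wdeg Q -> S (F P a Q)) ->
  S (spl w F).
Proof.
move=> hw SF.
have: forall P a Q, w = P ++ a :: Q -> S (F P a Q).
  move=> P a Q ew; move: hw; rewrite ew => /homog_cat[hP /homog_cons[ga hQ]].
  by apply: SF; rewrite // ew !wdegE addrA.
elim: w F {hw SF} => //= a w IH F SF.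
rewrite -[F _ _ _]scale1r; apply: SP; first exact: SF.
by apply: IH => P b Q ew; apply: SF; rewrite ew.
Qed.

Lemma cyc1_closed w (F : letter -> seq letter -> Z) : homog w ->
    (forall a A, gr a.1 a.2 -> homog A -> wdeg w = a.1 - 1 + wdeg A ->
       S (F a A)) ->
  S (cyc1 w F).
Proof.
move=> hw SF; apply: splh_closed => // P a Q hP ga hQ ew.
rewrite -[_ *: _]addr0; apply: SP => //; apply: SF => //.
  exact/homog_cat.
by rewrite ew wdeg_cat; ring.
Qed.

Lemma cyc2_closed w H : homog w ->
    (forall a X c Y, gr a.1 a.2 -> homog X -> gr c.1 c.2 -> homog Y ->
       wdeg w = a.1 - 1 + wdeg X + (c.1 - 1) + wdeg Y -> S (H a X c Y)) ->
  S (cyc2 w H).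
Proof.
move=> hw SH; apply: cyc1_closed => // a A ga hA ew; apply: splh_closed => //.
by move=> X c Y hX gc hY eA; apply: SH => //; rewrite ew eA !addrA.
Qed.

End CyclicSumsClosed.

(** * The graded Lie algebra axioms *)

Section Jacobi.
Variables (k : fieldType) (C : lmodType k) (gr : int -> C -> Prop).
Variables (pr : C -> C -> k) (m : int).
Hypothesis char_k : [pchar k] =i pred0.
Hypothesis grC : grading gr.
Hypothesis pr_bilin : bilin (pr : C -> C -> k^o).
Hypothesis pr_degree : forall i j a c, gr i a -> gr j c -> i + j != m -> pr a c = 0.
Hypothesis pr_sym : forall i j a c, gr i a -> gr j c ->
  pr a c = sgn (i * j + m) * pr c a.
Local Notation letter := (int * C)%type.
Local Notation homog := (homog gr).
Local Notation CC := (CC gr).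
Local Notation ccN := (ccN gr).
Local Notation ldeg := (ldeg m).
Local Notation br := (br pr m grC).
Local Notation brw := (brw gr pr m).
Implicit Types (u v w : seq letter).
Local Notation br_lin := ((br_bilinear m char_k grC pr_bilin).1).
Local Notation brE := (brE m char_k grC pr_bilin).

(* The terms of {u, {v, w}} in which u is paired with a letter f of v. *)
Definition brmid u v w : CC :=
  cyc1 v (fun a A => cyc1 w (fun c W => cyc1 u (fun e E =>
    spl A (fun X f Y =>
      sgn ((a.1 - 1) * wdeg A + (m + 1) * a.1
           + wdeg X * (wdeg Y + wdeg W + (f.1 - 1))
           + (e.1 - 1) * wdeg E + (m + 1) * e.1) *:
      (pr a.2 c.2 *: (pr e.2 f.2 *: ccN (E ++ Y ++ W ++ X))))))).

(** The letter of A ++ W that is paired with u lies either in A or in W. The second case is the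
    first with v and w exchanged, which explains the sign of skew symmetry. *)
Lemma br_brw u v w : homog u -> homog v -> homog w ->
  br (ccN u) (brw v w) =
  brmid u v w - sgn (ldeg v * ldeg w) *: brmid u w v.
Proof.
move=> hu hv hw; rewrite sgn_scaleN /brmid.
rewrite [X in _ + _ *: X]cyc1_exchange !cyc1Z -cyc1D (cyc1_linear _ _ (br_lin _)).
apply: (eq_cyc1 hv) => a A ga hA ev.
rewrite cyc1Z -cyc1D (cyc1_linear _ _ (br_lin _)).
apply: (eq_cyc1 hw) => c W gc hW ew.
have hAW : homog (A ++ W) by apply/homog_cat.
rewrite !(linear_funZ (br_lin _)) (brE hu hAW) /brw.
rewrite !cyc1Z -cyc1D.
apply: (eq_cyc1 hu) => e E ge hE eu.
rewrite cyc1_cat !scalerDr !splZ; congr (_ + _).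
  apply: (eq_splh hA) => X f Y hX gf hY eA.
  rewrite ![pr _ _ *: (sgn _ *: _)]sgn_scaleC !sgn_scaleA.
  apply: (sgn_pr2 pr_degree _ ga gc ge gf) => ec ef.
  by rewrite !parityE; parity_cases.
apply: (eq_splh hW) => X f Y hX gf hY eW.
rewrite (pr_swap pr_sym _ gc ga).
rewrite ![pr _ _ *: (sgn _ *: _)]sgn_scaleC !sgn_scaleA.
apply: (sgn_pr2 pr_degree _ ga gc ge gf) => ec ef.
rewrite !ldegE ev ew eW !parityE ec ef; parity_cases.
Qed.

Lemma brmidE u v w : homog u -> homog v -> homog w ->
  brmid u v w = cyc2 v (fun a X f Y => cyc1 w (fun c W => cyc1 u (fun e E =>
      sgn ((a.1 - 1) * (wdeg X + (f.1 - 1) + wdeg Y) + (m + 1) * a.1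
           + wdeg X * (wdeg Y + wdeg W + (f.1 - 1))
           + (e.1 - 1) * wdeg E + (m + 1) * e.1) *:
      (pr a.2 c.2 *: (pr e.2 f.2 *: ccN (E ++ Y ++ W ++ X)))))).
Proof.
move=> hu hv hw; apply: (eq_cyc1 hv) => a A ga hA _.
rewrite -cyc1_spl_exchange; apply: (eq_cyc1 hw) => c W gc hW _.
rewrite -cyc1_spl_exchange; apply: (eq_cyc1 hu) => e E ge hE _.
by apply: (eq_splh hA) => X f Y hX gf hY ->.
Qed.

(** The middle word v has two marked letters, one paired with w and one with u. Reading v from the
    other marked letter exchanges the roles of u and w, and the resulting words differ by a
    rotation. *)
Lemma brmid_sym u v w : homog u -> homog v -> homog w ->
  brmid u v w =
  sgn (ldeg u * ldeg w + ldeg v * ldeg w + ldeg u * ldeg v) *: brmid w v u.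
Proof.
move=> hu hv hw; rewrite !brmidE // cyc2_sym cyc2Z.
apply: (eq_cyc2 hv) => a X f Y ga hX gf hY ev.
rewrite cyc1_exchange !cyc1Z; apply: (eq_cyc1 hu) => e E ge hE eu.
rewrite !cyc1Z; apply: (eq_cyc1 hw) => c W gc hW ew.
have hl : homog (E ++ X) by apply/homog_cat.
have hr : homog (W ++ Y) by apply/homog_cat.
rewrite (catA E X (W ++ Y)) (catA W Y (E ++ X)) (ccN_rot hl hr) (scaleCA (pr f.2 c.2)).
rewrite (pr_swap pr_sym _ ge ga) (pr_swap pr_sym _ gf gc).
rewrite ![pr _ _ *: (sgn _ *: _)]sgn_scaleC !sgn_scaleA.
apply: (sgn_pr2 pr_degree _ ga ge gc gf) => ee ef.
by rewrite !ldegE ev eu ew !wdegE !parityE ee ef; parity_cases.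
Qed.

Lemma brw_degree u v : homog u -> homog v ->
  L_gr m (ldeg u + ldeg v) (brw u v).
Proof.
move=> hu hv; pose S := @L_gr k C gr m (ldeg u + ldeg v).
have S0 : S 0 by exact: L_gr0.
have SP : forall c x y, S x -> S y -> S (c *: x + y) by move=> c x y; apply: L_grP.
apply: (cyc1_closed S0 SP hu) => a A ga hA eu.
apply: (cyc1_closed S0 SP hv) => c X gc hX ev.
case: (eqVneq (a.1 + c.1) m) => [em|ne]; last first.
  by rewrite (pr_degree ga gc ne) scale0r scaler0.
rewrite scalerA -[_ *: _]addr0; apply: SP => //.
rewrite /S (_ : _ + _ = ldeg (A ++ X)); first exact/L_gr_ccN/homog_cat.
by rewrite !ldegE eu ev wdeg_cat -em; ring.
Qed.

Lemma br_degree_L i j x y :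
  L_gr m i x -> L_gr m j y -> L_gr m (i + j) (br x y).
Proof.
have [l1 l2] := br_bilinear m char_k grC pr_bilin.
move=> hx hy; elim/L_gr_ind: hx => [|c x1 x2 IH1 IH2|u hu du].
- by rewrite (linear_fun0 (l2 y)); apply: L_gr0.
- by rewrite (l2 y c x1 x2); apply: L_grP.
elim/L_gr_ind: hy => [|c x1 x2 IH1 IH2|v hv dv].
- by rewrite (linear_fun0 (l1 _)); apply: L_gr0.
- by rewrite (l1 (ccN u) c x1 x2); apply: L_grP.
by rewrite (brE hu hv) -du -dv; apply: brw_degree.
Qed.

Lemma br_skew_L i j x y :
  L_gr m i x -> L_gr m j y -> br x y = - sgn (i * j) *: br y x.
Proof.
have [l1 l2] := br_bilinear m char_k grC pr_bilin.
move=> hx hy; move: x hx.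
apply: (eq_on_L_gr (l2 y) (lin_scale _ (l1 y))) => u hu du.
move: y hy; apply: (eq_on_L_gr (l1 _) (lin_scale _ (l2 _))) => v hv dv.
by rewrite (brE hu hv) (brE hv hu) -du -dv; apply: brw_skew.
Qed.

Lemma br_jacobi_words u v w : homog u -> homog v -> homog w ->
  br (ccN u) (br (ccN v) (ccN w)) =
  br (br (ccN u) (ccN v)) (ccN w)
  + sgn (ldeg u * ldeg v) *: br (ccN v) (br (ccN u) (ccN w)).
Proof.
move=> hu hv hw.
have du := L_gr_ccN m hu; have dv := L_gr_ccN m hv; have dw := L_gr_ccN m hw.
rewrite [X in _ = X + _](br_skew_L (br_degree_L du dv) dw).
rewrite (brE hv hw) (brE hu hv) (brE hu hw) !br_brw //.
rewrite (brmid_sym hu hv hw) (brmid_sym hu hw hv) (brmid_sym hv hu hw).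
exact: jacobi_signs.
Qed.

Lemma br_jacobi_L i j l x y z :
  L_gr m i x -> L_gr m j y -> L_gr m l z ->
  br x (br y z) = br (br x y) z + sgn (i * j) *: br y (br x z).
Proof.
have [l1 l2] := br_bilinear m char_k grC pr_bilin.
move=> hx hy hz; move: x hx; apply: eq_on_L_gr => [||u hu du].
- exact: l2.
- exact: (lin_add (lin_comp (l2 z) (l2 y)) (lin_scale _ (lin_comp (l1 _) (l2 z)))).
move: y hy; apply: eq_on_L_gr => [||v hv dv].
- exact: (lin_comp (l1 _) (l2 _)).
- exact: (lin_add (lin_comp (l2 _) (l1 _)) (lin_scale _ (l2 _))).
move: z hz; apply: eq_on_L_gr => [||w hw dw].
- exact: (lin_comp (l1 _) (l1 _)).
- exact: (lin_add (l1 _) (lin_scale _ (lin_comp (l1 _) (l1 _)))).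
by rewrite -du -dv; apply: br_jacobi_words.
Qed.

End Jacobi.

Section CyclicFour.
Variables (k : fieldType) (C Z : lmodType k) (gr : int -> C -> Prop).
Local Notation letter := (int * C)%type.
Local Notation homog := (homog gr).

Lemma cyc2_mlin (H : letter -> seq letter -> letter -> seq letter -> Z) :
    (forall a c Y, gr a.1 a.2 -> gr c.1 c.2 -> homog Y ->
       mlin gr (fun X => H a X c Y)) ->
    (forall a X c, gr a.1 a.2 -> homog X -> gr c.1 c.2 -> mlin gr (H a X c)) ->
    (forall X c Y, homog X -> gr c.1 c.2 -> homog Y ->
       hlin gr (fun a => H a X c Y)) ->
    (forall a X Y, gr a.1 a.2 -> homog X -> homog Y ->
       hlin gr (fun c => H a X c Y)) ->
  mlin gr (fun w => cyc2 w H).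
Proof.
move=> mX mY ha hc; apply: cyc1_mlin => [a ga|A hA n e a a' ga ga' /=].
  by apply: mlin_spl => *; [apply: mX | apply: hc | apply: mY].
by rewrite splZ -splD; apply: (eq_splh hA) => X c Y hX gc hY _; apply: ha.
Qed.

Definition cyc4 w (K : letter -> seq letter -> letter -> seq letter ->
    letter -> seq letter -> letter -> seq letter -> Z) : Z :=
  cyc1 w (fun a A => spl A (fun P e B => spl B (fun Q f D =>
    spl D (fun R c Y => K a P e Q f R c Y)))).

(** Both further letters lie on the same arc, as when the cobracket is applied to one component of a
    cobracket. *)
Lemma cyc4_sub w K :
  cyc2 w (fun a X c Y => spl X (fun P e T => spl T (fun Q f R =>
    K a P e Q f R c Y))) = cyc4 w K.
Proof.
congr cyc1; apply/funext=> a; apply/funext=> A; rewrite -splA.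
by apply: eq_spl => P e B _; rewrite -splA.
Qed.

(** One further letter lies on each arc, as when the two components of a cobracket are joined by the
    bracket. *)
Lemma cyc4_halves w K :
  cyc2 w (fun a X f Y => spl X (fun P e Q => spl Y (fun R c S =>
    K a P e Q f R c S))) = cyc4 w K.
Proof. by congr cyc1; apply/funext=> a; apply/funext=> A; rewrite -splA. Qed.

Lemma eq_cyc4 w K K' : homog w ->
    (forall a P e Q f R c Y, gr a.1 a.2 -> homog P -> gr e.1 e.2 -> homog Q ->
       gr f.1 f.2 -> homog R -> gr c.1 c.2 -> homog Y ->
       wdeg w = a.1 - 1 + wdeg P + (e.1 - 1) + wdeg Q + (f.1 - 1) + wdeg R
                + (c.1 - 1) + wdeg Y ->
       K a P e Q f R c Y = K' a P e Q f R c Y) ->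
  cyc4 w K = cyc4 w K'.
Proof.
move=> hw KK; apply: (eq_cyc1 hw) => a A ga hA ew.
apply: (eq_splh hA) => P e B hP ge hB eA; apply: (eq_splh hB) => Q f D hQ gf hD eB.
apply: (eq_splh hD) => R c Y hR gc hY eD; apply: KK => //.
by rewrite ew eA eB eD; ring.
Qed.

Lemma cyc4_rot w K : homog w -> cyc4 w K =
  cyc4 w (fun a P e Q f R c Y =>
    sgn ((a.1 - 1 + wdeg P + (e.1 - 1) + wdeg Q + (f.1 - 1) + wdeg R)
         * (c.1 - 1 + wdeg Y)) *: K c Y a P e Q f R).
Proof.
move=> hw; rewrite -[LHS]/(cyc2 w (fun a P e B => _)) cyc2_sym -cyc4_sub.
apply: (eq_cyc2 hw) => a X c Y ga hX gc hY ew; rewrite splZ.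
apply: (eq_splh hX) => P e T hP ge hT eX; rewrite splZ.
apply: (eq_splh hT) => Q f R hQ gf hR eT.
by rewrite eX eT; congr (_ *: _); ksign.
Qed.

Lemma cyc4Z w (s : k) K :
  s *: cyc4 w K = cyc4 w (fun a P e Q f R c Y => s *: K a P e Q f R c Y).
Proof.
rewrite /cyc4 cyc1Z; congr cyc1; apply/funext=> a; apply/funext=> A.
rewrite splZ; apply: eq_spl => P e B _; rewrite splZ.
by apply: eq_spl => Q f D _; rewrite splZ.
Qed.

Lemma cyc4D w K K' :
  cyc4 w (fun a P e Q f R c Y => K a P e Q f R c Y + K' a P e Q f R c Y) =
  cyc4 w K + cyc4 w K'.
Proof.
rewrite /cyc4 -cyc1D; congr cyc1; apply/funext=> a; apply/funext=> A.
rewrite -splD; apply: eq_spl => P e B _; rewrite -splD.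
by apply: eq_spl => Q f D _; rewrite -splD.
Qed.

End CyclicFour.

(** * The grading of L *)

Section LGrading.
Variables (k : fieldType) (C : lmodType k) (gr : int -> C -> Prop) (m : int).
Hypothesis char_k : [pchar k] =i pred0.
Hypothesis grC : grading gr.
Local Notation homog := (homog gr).
Local Notation CC := (CC gr).
Local Notation ccN := (ccN gr).
Local Notation ldeg := (ldeg m).

(** The degree of a word is invariant under rotation, so keeping only the words of degree n descends
    to cyclic words; the lift of [part n] is the projection of L onto its degree n part. *)
Let part n (w : seq (int * C)) : CC := (ldeg w == n)%:R *: ccN w.

Let part_mlin n : mlin gr (part n).
Proof.
apply: mlin_scale; last exact: ccN_mlin.
by move=> p q i a a'; rewrite !ldegE !wdegE.
Qed.

Let part_cyclic n : cyclic gr (part n).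
Proof.
move=> u v hu hv; rewrite /part (ccN_rot hu hv) scaleCA; congr (_ *: (_ *: _)).
by rewrite !ldegE !wdeg_cat [wdeg u + _]addrC.
Qed.

Let partE n w : homog w -> clift grC (part n) (ccN w) = part n w.
Proof.
apply: (cliftE char_k _ (part_mlin n) (part_cyclic n)).
by rewrite /part ccN_nil scaler0.
Qed.

Let part_id n x : L_gr m n x -> clift grC (part n) x = x.
Proof.
move: x; apply: eq_on_L_gr => [||w hw dw]; first exact: clift_linear.
  by [].
by rewrite partE // /part dw eqxx scale1r.
Qed.

Let part_0 n i x : L_gr m n x -> i != n -> clift grC (part i) x = 0.
Proof.
move=> hx ne; move: x hx; apply: eq_on_L_gr => [||w hw dw].
- exact: clift_linear.
- exact: lin_zero.
- by rewrite partE // /part dw eq_sym (negbTE ne) scale0r.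
Qed.

Lemma L_grading : grading (@L_gr k C gr m).
Proof.
split=> [n|x|s hs us s0 p ps].
- by split=> [|c x y]; [apply: L_gr0 | apply: L_grP].
- elim/CC_ind: x => [|c x y [s [hs es]] [t [ht et]]|w hw].
  + by exists [::]; rewrite big_nil.
  + exists ([seq (p.1, c *: p.2) | p <- s] ++ t); split.
      move=> p; rewrite mem_cat => /orP[/mapP[q /hs gq ->]|/ht //].
      exact: L_grZ.
    by rewrite big_cat big_map /= -scaler_sumr -es -et.
  + exists [:: (ldeg w, ccN w)]; split; last by rewrite big_seq1.
    by move=> p; rewrite inE => /eqP ->; apply: L_gr_ccN.
- have lp := clift_linear grC (part_mlin p.1).
  (* The projection onto the degree of p is applied to the vanishing sum: it fixes p.2 and kills the
     other entries, whose degrees are different. *)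
  rewrite -(part_id (hs p ps)) -(linear_fun0 lp) -s0 (linear_fun_bigop lp).
  rewrite (bigD1_seq p) //=; last by apply: map_uniq us.
  rewrite big1_seq ?addr0 // => q /andP[qp qs]; apply: part_0 (hs q qs) _.
  apply: contra_neq qp => e; apply/esym.
  move/(map_uniq): (us) => _; move: us ps qs e; elim: (s) => //= x r IH.
  move=> /andP[xr ur]; rewrite !inE => /orP[/eqP->|pr] /orP[/eqP->|qr] // e.
  + by move: xr; rewrite e map_f.
  + by move: xr; rewrite -e map_f.
  + exact: IH.
Qed.

End LGrading.

Section HbilinOps.
Variables (k : fieldType) (U W Z : lmodType k).
Variables (grU : int -> U -> Prop) (grW : int -> W -> Prop).

Lemma hbilin_scale (s : int -> int -> k) (f : U -> W -> Z) : bilin f ->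
  hbilin grU grW (fun p q => s p.1 q.1 *: f p.2 q.2).
Proof.
move=> [f1 f2]; split=> [n u gu i c w w' _ _|n w gw i c u u' _ _] /=.
  by rewrite (f1 u c w w') scalerDr scaleCA.
by rewrite (f2 w c u u') scalerDr scaleCA.
Qed.

Lemma hbilin_add (F G : int * U -> int * W -> Z) :
  hbilin grU grW F -> hbilin grU grW G -> hbilin grU grW (fun p q => F p q + G p q).
Proof.
move=> [F1 F2] [G1 G2]; split=> [n u gu i c w w' gw gw'|n w gw i c u u' gu gu'].
  by rewrite (F1 n u) // (G1 n u) // scalerDr addrACA.
by rewrite (F2 n w) // (G2 n w) // scalerDr addrACA.
Qed.

End HbilinOps.

Lemma bilin_swap (k : fieldType) (U W Z : lmodType k) (f : U -> W -> Z) :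
  bilin f -> bilin (fun w u => f u w).
Proof. by case. Qed.

Lemma sum_ltn_spl2 (T : Type) (Z : zmodType) (x0 : T) (w : seq T)
    (F : seq T -> T -> seq T -> T -> seq T -> Z) :
  \sum_(j < size w) \sum_(i < j)
    F (take i w) (nth x0 w i) (drop i.+1 (take j w)) (nth x0 w j) (drop j.+1 w) =
  spl w (fun P a T => spl T (fun Q c R => F P a Q c R)).
Proof.
rewrite splA (spl_nth x0); apply: eq_bigr => j _.
have jw : (j <= size w)%N by rewrite ltnW.
rewrite (spl_nth x0) size_takel //; apply: eq_bigr => i _.
by rewrite take_takel 1?ltnW // nth_take.
Qed.

(** * The cobracket *)

Section Cobracket.
Variables (k : fieldType) (C : lmodType k) (gr : int -> C -> Prop).
Variables (pr : C -> C -> k) (m : int).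
Hypothesis char_k : [pchar k] =i pred0.
Hypothesis grC : grading gr.
Hypothesis pr_bilin : bilin (pr : C -> C -> k^o).
Hypothesis pr_degree : forall i j a c, gr i a -> gr j c -> i + j != m -> pr a c = 0.
Hypothesis pr_sym : forall i j a c, gr i a -> gr j c ->
  pr a c = sgn (i * j + m) * pr c a.
Local Notation letter := (int * C)%type.
Local Notation homog := (homog gr).
Local Notation CC := (CC gr).
Local Notation ccN := (ccN gr).
Local Notation ldeg := (ldeg m).
Local Notation LL := (tensor CC CC).
Local Notation L_grading := (@L_grading k C gr m char_k grC).
Local Notation hlift2 := (hlift2 L_grading L_grading).
Implicit Types (u v w : seq letter).

Section Generic.
Variables (Z : lmodType k) (T : CC -> CC -> Z).
Hypothesis T_bilin : bilin T.

(** With T = ⊗ this is the cobracket, and with T = [br] it is the composite whose vanishing is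
    involutivity. The sum runs over ordered pairs, so the two terms of a wedge are the two readings
    of one pair of letters. *)
Definition cobw w : Z := cyc2 w (fun a X c Y =>
  sgn ((a.1 - 1) * wdeg X + a.1 + m + 1) *: (pr a.2 c.2 *: T (ccN X) (ccN Y))).

Lemma cobw_mlin : mlin gr cobw.
Proof.
have [t1 t2] := T_bilin.
apply: cyc2_mlin => [a c Y ga gc hY|a X c ga hX gc|X c Y hX gc hY|a X Y ga hX hY].
- apply: mlin_scale => [p q n x y|]; first by rewrite !wdegE.
  apply: mlin_cst; exact: (mlin_lin (t2 (ccN Y)) (ccN_mlin grC)).
- apply: mlin_cst; apply: mlin_cst; exact: (mlin_lin (t1 (ccN X)) (ccN_mlin grC)).
- apply: (hlin_scale (s := fun a => sgn ((a.1 - 1) * wdeg X + a.1 + m + 1))) => //.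
  exact: hlin_cst_scale (pr_bilin.2 c.2).
- apply: (hlin_scale (s := fun c => sgn ((a.1 - 1) * wdeg X + a.1 + m + 1))) => //.
  exact: hlin_cst_scale (pr_bilin.1 a.2).
Qed.

Lemma cobw_cyclic : cyclic gr cobw.
Proof. by move=> u v _ _; apply: cyc1_rot. Qed.

(** For a pair P a Q c R, the reading from c gives the first term of the wedge and the reading from
    a the second; in both the arc R P is rotated to P R. *)
Lemma cobw_sumE w : homog w -> cobw w =
  \sum_(j < size w) \sum_(i < j)
    let x := take i w ++ drop j.+1 w in let y := drop i.+1 (take j w) in
    (cobracket_sign m w i j * pr (nth (0, 0) w i).2 (nth (0, 0) w j).2) *:
    (T (ccN x) (ccN y) - sgn (ldeg x * ldeg y) *: T (ccN y) (ccN x)).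
Proof.
move=> hw; rewrite /cobw cyc2E.
pose F P (a : letter) Q (c : letter) R : Z :=
  (sgn ((a.1 - 1) * wdeg P + (c.1 - 1) * (wdeg P + wdeg Q) + wdeg Q * wdeg R
        + m * (wdeg P + wdeg R) + a.1) * pr a.2 c.2) *:
  (T (ccN (P ++ R)) (ccN Q)
   - sgn (ldeg (P ++ R) * ldeg Q) *: T (ccN Q) (ccN (P ++ R))).
transitivity (spl w (fun P a S => spl S (fun Q c R => F P a Q c R))); last first.
  by rewrite -(sum_ltn_spl2 (0, 0)).
apply: (eq_splh hw) => P a S hP ga hS ew.
apply: (eq_splh hS) => X c Y hX gc hY eS.
have [t1 t2] := T_bilin.
rewrite /F (ccN_rot hP hY) (linear_funZ (t1 _)) (linear_funZ (t2 _)).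
rewrite (pr_swap pr_sym _ gc ga) -scalerA sgn_scaleN scalerDr.
rewrite ![pr _ _ *: (sgn _ *: _)]sgn_scaleC !scalerDr !sgn_scaleA addrC.
congr (_ + _); apply: (sgn_pr pr_degree _ ga gc) => ec.
  by rewrite !wdegE !parityE ec; parity_cases.
by rewrite !ldegE !wdegE !parityE ec; parity_cases.
Qed.

Lemma cobw_skew w : homog w -> cobw w =
  - cyc2 w (fun a X c Y => sgn ((a.1 - 1) * wdeg X + a.1 + m + 1) *:
      (pr a.2 c.2 *: (sgn (ldeg X * ldeg Y) *: T (ccN Y) (ccN X)))).
Proof.
move=> hw; rewrite /cobw cyc2_sym cyc2N; apply: (eq_cyc2 hw) => a X c Y ga hX gc hY ew.
rewrite (pr_swap pr_sym _ gc ga) sgn_scaleN.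
rewrite ![pr _ _ *: (sgn _ *: _)]sgn_scaleC !sgn_scaleA.
by apply: (sgn_pr pr_degree _ ga gc) => ec; rewrite !ldegE !parityE ec; parity_cases.
Qed.

End Generic.

Definition cobr : CC -> LL := clift grC (cobw (@tens k CC CC)).

Let cobw_tens_mlin := cobw_mlin (tens_bilin CC CC).

Lemma cobr_lin : linear cobr.
Proof. exact: (clift_linear grC cobw_tens_mlin). Qed.

Lemma cobrE w : homog w -> cobr (ccN w) = cobw (@tens k CC CC) w.
Proof. exact: (cliftE char_k grC cobw_tens_mlin (cobw_cyclic _)). Qed.

Lemma cobr_cobracket_formula : cobracket_formula pr m cobr.
Proof. by move=> w hw; rewrite cobrE // (cobw_sumE (tens_bilin CC CC)). Qed.

(* The axioms of a Lie coalgebra are tested against bilinear maps out of L ⊗ L. *)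
Lemma hlift2_cobr (Z : lmodType k) (F : int * CC -> int * CC -> Z) w :
    hbilin (@L_gr k C gr m) (@L_gr k C gr m) F -> homog w ->
  hlift2 F (cobr (ccN w)) = cyc2 w (fun a X c Y =>
    sgn ((a.1 - 1) * wdeg X + a.1 + m + 1) *:
    (pr a.2 c.2 *: F (ldeg X, ccN X) (ldeg Y, ccN Y))).
Proof.
move=> hF hw; have lF := hlift2_linear L_grading L_grading hF.
rewrite cobrE // /cobw (cyc2_linear _ _ lF).
apply: (eq_cyc2 hw) => a X c Y ga hX gc hY ew.
rewrite !(linear_funZ lF); congr (_ *: (_ *: _)).
exact: (hlift2E L_grading L_grading hF (L_gr_ccN m hX) (L_gr_ccN m hY)).
Qed.

Lemma cobr_degree n x :
  L_gr m n x -> exists s, sweedler (@L_gr k C gr m) (n + 2 * (2 - m)) (cobr x) s.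
Proof.
pose S t := exists s, sweedler (@L_gr k C gr m) (n + 2 * (2 - m)) t s.
have S0 : S 0 by exists [::]; split=> //; rewrite big_nil.
have SP : forall (c : k) (x y : LL), S x -> S y -> S (c *: x + y).
  move=> c {}x y [s [hs es]] [t [ht et]].
  exists ([seq ((p.1.1, c *: p.1.2), p.2) | p <- s] ++ t); split.
    move=> p; rewrite mem_cat => /orP[/mapP[q /hs[g1 g2 e] ->]|/ht //].
    by split=> //; apply: L_grZ.
  rewrite big_cat big_map /= es et scaler_sumr; congr (_ + _).
  apply: eq_bigr => p _; exact/esym/(linear_funZ ((tens_bilin CC CC).2 _)).
elim/L_gr_ind=> [|c x1 x2 IH1 IH2|w hw dw].
- by rewrite (linear_fun0 cobr_lin) -/(S _).
- by rewrite (cobr_lin c x1 x2); exact: (SP c _ _ IH1 IH2).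
rewrite cobrE // -/(S _); apply: (cyc2_closed S0 SP hw) => a X c Y ga hX gc hY ew.
case: (eqVneq (a.1 + c.1) m) => [em|ne]; last first.
  by rewrite (pr_degree ga gc ne) scale0r scaler0.
rewrite scalerA -[_ *: _]addr0; apply: SP => //.
exists [:: ((ldeg X, ccN X), (ldeg Y, ccN Y))]; split; last by rewrite big_seq1.
move=> p; rewrite inE => /eqP -> /=; split; [exact: L_gr_ccN..|].
by rewrite -dw !ldegE ew -em; ring.
Qed.

End Cobracket.

Section TliftOps.
Variables (k : fieldType) (U W Z : lmodType k).

Lemma tliftP c (f f' : U -> W -> Z) t :
  tlift (fun u w => c *: f u w + f' u w) t = c *: tlift f t + tlift f' t.
Proof.
rewrite /tlift scaler_sumr -big_split; apply: eq_bigr => p _ /=.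
by rewrite scalerDr scaleCA.
Qed.

Lemma eq_tlift (f f' : U -> W -> Z) t :
  (forall u w, f u w = f' u w) -> tlift f t = tlift f' t.
Proof. by move=> ff; apply: eq_bigr => p _; rewrite ff. Qed.

Variables (Y : lmodType k) (grU : int -> U -> Prop) (grW : int -> W -> Prop).
Variables (grY : int -> Y -> Prop) (gU : grading grU) (gW : grading grW).

Lemma hlift2_hlin (G : int * U -> int * W -> int * Y -> Z) t :
    (forall i j u w, grU i u -> grW j w -> hlin grY (G (i, u) (j, w))) ->
  hlin grY (fun z => hlift2 gU gW (fun x y => G x y z) t).
Proof.
move=> hG n c z z' gz gz'; rewrite /hlift2 -tliftP; apply: eq_tlift => u w.
rewrite -hliftP; apply: eq_hlift => i x gx; rewrite -hliftP.
by apply: eq_hlift => j y gy; apply: hG.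
Qed.

End TliftOps.

Section TensorThree.
Variables (k : fieldType) (A B D : lmodType k).

Lemma tens3_linear1 (y : B) (z : D) : linear (fun x : A => x ⊗ y ⊗ z).
Proof. exact: (lin_comp ((tens_bilin _ D).2 z) ((tens_bilin A B).2 y)). Qed.

Lemma tens3_linear2 (x : A) (z : D) : linear (fun y : B => x ⊗ y ⊗ z).
Proof. exact: (lin_comp ((tens_bilin _ D).2 z) ((tens_bilin A B).1 x)). Qed.

Lemma tens3_linear3 (x : A) (y : B) : linear (fun z : D => x ⊗ y ⊗ z).
Proof. exact: (tens_bilin _ D).1. Qed.

End TensorThree.

Section HlinOps.
Variables (k : fieldType) (C U Z : lmodType k).
Variables (gr : int -> C -> Prop) (grU : int -> U -> Prop).

Lemma hlin_add (f g : int * C -> Z) :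
  hlin gr f -> hlin gr g -> hlin gr (fun a => f a + g a).
Proof.
by move=> hf hg n c a a' ga ga'; rewrite hf // hg // scalerDr addrACA.
Qed.

Lemma hbilin_bilin (f : C -> U -> Z) :
  bilin f -> hbilin gr grU (fun p q => f p.2 q.2).
Proof.
move=> [f1 f2].
by split=> [n u _ i c w w' _ _|n w _ i c u u' _ _]; [apply: f1 | apply: f2].
Qed.

End HlinOps.

Section CyclicThree.
Variables (k : fieldType) (C Z : lmodType k) (gr : int -> C -> Prop).
Local Notation letter := (int * C)%type.
Local Notation homog := (homog gr).

Definition cyc3 w (K : letter -> seq letter -> letter -> seq letter ->
    letter -> seq letter -> Z) : Z :=
  cyc1 w (fun a A => spl A (fun P e B => spl B (fun X f Y => K a P e X f Y))).

Lemma cyc3_sub w K :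
  cyc2 w (fun a A f Y => spl A (fun P e X => K a P e X f Y)) = cyc3 w K.
Proof. by congr cyc1; apply/funext=> a; apply/funext=> A; rewrite -splA. Qed.

Lemma eq_cyc3 w K K' : homog w ->
    (forall a P e X f Y, gr a.1 a.2 -> homog P -> gr e.1 e.2 -> homog X ->
       gr f.1 f.2 -> homog Y ->
       wdeg w = a.1 - 1 + wdeg P + (e.1 - 1) + wdeg X + (f.1 - 1) + wdeg Y ->
       K a P e X f Y = K' a P e X f Y) ->
  cyc3 w K = cyc3 w K'.
Proof.
move=> hw KK; apply: (eq_cyc1 hw) => a A ga hA ew.
apply: (eq_splh hA) => P e B hP ge hB eA; apply: (eq_splh hB) => X f Y hX gf hY eB.
by apply: KK => //; rewrite ew eA eB; ring.
Qed.

Lemma cyc3_rot w K : homog w -> cyc3 w K =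
  cyc3 w (fun a P e X f Y =>
    sgn ((a.1 - 1 + wdeg P + (e.1 - 1) + wdeg X) * (f.1 - 1 + wdeg Y)) *:
    K f Y a P e X).
Proof.
move=> hw; rewrite -[LHS]/(cyc2 w (fun a P e B => _)) cyc2_sym -cyc3_sub.
apply: (eq_cyc2 hw) => a A c Y ga hA gc hY ew; rewrite splZ.
apply: (eq_splh hA) => P e X hP ge hX eA.
by rewrite eA; congr (_ *: _); ksign.
Qed.

Lemma cyc3D w K K' :
  cyc3 w (fun a P e X f Y => K a P e X f Y + K' a P e X f Y) =
  cyc3 w K + cyc3 w K'.
Proof.
rewrite /cyc3 -cyc1D; congr cyc1; apply/funext=> a; apply/funext=> A.
by rewrite -splD; apply: eq_spl => P e B _; rewrite -splD.
Qed.

(* The contribution to [cyc2 (P e X f Y) H] of the letters e and f. *)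
Definition cut (H : letter -> seq letter -> letter -> seq letter -> Z) P e X f Y : Z :=
  sgn (wdeg P * (e.1 - 1 + wdeg X + (f.1 - 1) + wdeg Y)) *: H e X f (Y ++ P)
  + sgn ((wdeg P + (e.1 - 1) + wdeg X) * (f.1 - 1 + wdeg Y)) *: H f (Y ++ P) e X.

Lemma cyc2_cat u v H : cyc2 (u ++ v) H =
  spl u (fun P e B => spl B (fun X f Y => cut H P e X f (Y ++ v)))
  + spl u (fun P e B => spl v (fun X f Y => cut H P e (B ++ X) f Y))
  + spl v (fun P e B => spl B (fun X f Y => cut H (u ++ P) e X f Y)).
Proof.
rewrite cyc2E spl_cat -splD; congr (_ + _); apply: eq_spl => P e B _.
by rewrite spl_cat.
Qed.

End CyclicThree.

(** * Lie coalgebra axioms, involutivity and the compatibility of bracket and cobracket *)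

Section CobracketAxioms.
Variables (k : fieldType) (C : lmodType k) (gr : int -> C -> Prop).
Variables (pr : C -> C -> k) (m : int).
Hypothesis char_k : [pchar k] =i pred0.
Hypothesis grC : grading gr.
Hypothesis pr_bilin : bilin (pr : C -> C -> k^o).
Hypothesis pr_degree : forall i j a c, gr i a -> gr j c -> i + j != m -> pr a c = 0.
Hypothesis pr_sym : forall i j a c, gr i a -> gr j c ->
  pr a c = sgn (i * j + m) * pr c a.
Local Notation letter := (int * C)%type.
Local Notation homog := (homog gr).
Local Notation CC := (CC gr).
Local Notation ccN := (ccN gr).
Local Notation ldeg := (ldeg m).
Local Notation Lgr := (@L_gr k C gr m).
Local Notation LL := (tensor CC CC).
Local Notation br := (br pr m grC).
Local Notation brw := (brw gr pr m).
Local Notation br_bilin := (br_bilinear m char_k grC pr_bilin).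
Local Notation brE := (brE m char_k grC pr_bilin).
Local Notation cobr := (cobr pr m grC).
Local Notation cobr_lin := (cobr_lin m grC pr_bilin).
Local Notation cobrE := (cobrE m char_k grC pr_bilin).
Local Notation L_grading := (@L_grading k C gr m char_k grC).
Local Notation hlift2 := (hlift2 L_grading L_grading).
Local Notation hlift2_cobr := (hlift2_cobr char_k grC pr_bilin).
Implicit Types (u v w : seq letter).

Lemma cobr_skew_L n x s e : Lgr n x -> sweedler Lgr (n + e) (cobr x) s ->
  cobr x = - \sum_(p <- s) sgn (p.1.1 * p.2.1) *: (p.2.2 ⊗ p.1.2).
Proof.
move=> hx ss; pose F (p q : int * CC) : LL := sgn (p.1 * q.1) *: (q.2 ⊗ p.2).
have hF : hbilin Lgr Lgr F.
  exact: (hbilin_scale _ _ (fun i j => sgn (i * j)) (bilin_swap (tens_bilin CC CC))).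
rewrite [X in - X](sweedler_hlift2 L_grading hF ss).
have lF := hlift2_linear L_grading L_grading hF.
move: x hx {ss}; apply: eq_on_L_gr => [||w hw dw].
- exact: cobr_lin.
- exact: (lin_opp (lin_comp lF cobr_lin)).
rewrite (hlift2_cobr hF hw) cobrE //.
exact: (cobw_skew pr_degree pr_sym _ hw).
Qed.

Lemma eq_oppr0 (Z : lmodType k) (x : Z) : x = - x -> x = 0.
Proof.
move/eqP; rewrite -subr_eq0 opprK -mulr2n -scaler_nat scaler_eq0.
by rewrite ((pcharf0P k).1 char_k) => /eqP.
Qed.

(** The cobracket cuts at a pair a, c, and the bracket then pairs letters e and f of the two
    components, so the two pairs cross on the cyclic word. Either pair may be cut first, the final
    cyclic word is the same, and the signs of the two orders are opposite; hence the sum equals its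
    own negative. *)
Lemma br_cobw w : homog w -> cobw pr m br w = 0.
Proof.
move=> hw; pose K (a : letter) P (e : letter) Q (c : letter) R (f : letter) S : CC :=
  sgn ((a.1 - 1) * (wdeg P + (e.1 - 1) + wdeg Q) + a.1 + m + 1
       + wdeg P * (wdeg Q + (e.1 - 1)) + wdeg R * (wdeg S + (f.1 - 1))
       + (e.1 - 1) * (wdeg Q + wdeg P) + (m + 1) * e.1) *:
  (pr a.2 c.2 *: (pr e.2 f.2 *: ccN ((Q ++ P) ++ (S ++ R)))).
have e1 : cobw pr m br w = cyc4 w K.
  rewrite -cyc4_halves; apply: (eq_cyc2 hw) => a X c Y ga hX gc hY ew.
  rewrite (brE hX hY) /brw /cyc1 !splZ.
  apply: (eq_splh hX) => P e Q hP ge hQ eX; rewrite !splZ.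
  apply: (eq_splh hY) => R f S hR gf hS eY.
  rewrite ![pr _ _ *: (sgn _ *: _)]sgn_scaleC !sgn_scaleA; congr (_ *: _).
  by rewrite eX; word_sign.
rewrite e1; apply: eq_oppr0; rewrite {1}(cyc4_rot _ hw) -scaleN1r cyc4Z.
apply: (eq_cyc4 hw) => a P e Q c R f S ga hP ge hQ gc hR gf hS ew.
rewrite /K scaleN1r sgn_scaleN sgn_scaleA (pr_swap pr_sym _ gf ge).
have hPSR : homog (P ++ S ++ R) by do 2?[apply/homog_cat; split=> //].
have -> : (P ++ S) ++ (R ++ Q) = (P ++ S ++ R) ++ Q by rewrite !catA.
have -> : (Q ++ P) ++ (S ++ R) = Q ++ (P ++ S ++ R) by rewrite !catA.
rewrite (ccN_rot hPSR hQ) (scaleCA (pr e.2 f.2) (pr a.2 c.2)).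
rewrite ![pr _ _ *: (sgn _ *: _)]sgn_scaleC !sgn_scaleA.
apply: (sgn_pr2 pr_degree _ ga gc ge gf) => ec ef.
by rewrite !wdegE !parityE ec ef; parity_cases.
Qed.

Lemma br_cobr x : tlift br (cobr x) = 0.
Proof.
have lt := tlift_linear br_bilin.
move: x; apply: eq_on_CC => [||w hw].
- exact: (lin_comp lt cobr_lin).
- exact: lin_zero.
rewrite cobrE // /cobw (cyc2_linear _ _ lt) -[RHS](br_cobw hw).
apply: (eq_cyc2 hw) => a X c Y ga hX gc hY ew.
by rewrite !(linear_funZ lt) (tliftE br_bilin).
Qed.

Section Trilinear.
Variables (Z : lmodType k) (T : CC -> CC -> CC -> Z).
Hypothesis T1 : forall y z, linear (fun x => T x y z).
Hypothesis T2 : forall x z, linear (fun y => T x y z).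
Hypothesis T3 : forall x y, linear (T x y).

Definition cojac (x y z : int * CC) : Z :=
  sgn (x.1 * (y.1 + z.1)) *: T y.2 z.2 x.2
  + sgn (z.1 * (x.1 + y.1)) *: T z.2 x.2 y.2 + T x.2 y.2 z.2.

Local Notation cl w := (ldeg w, ccN w).

(** Two pairs that do not cross cut the cyclic word a P e Q f R c Y into the three cyclic words Q, R
    P and Y. Cutting the pairs in the other order permutes these three cyclically, which the cyclic
    sum [cojac] absorbs, and reverses the sign. *)
Lemma cojac_words w : homog w ->
  cyc2 w (fun a X c Y => sgn ((a.1 - 1) * wdeg X + a.1 + m + 1) *:
    (pr a.2 c.2 *: cyc2 X (fun e U f W =>
      sgn ((e.1 - 1) * wdeg U + e.1 + m + 1) *:
      (pr e.2 f.2 *: cojac (cl U) (cl W) (cl Y))))) = 0.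
Proof.
move=> hw.
pose K1 (a : letter) P (e : letter) Q (f : letter) R (c : letter) Y : Z :=
  sgn ((a.1 - 1) * (wdeg P + (e.1 - 1) + wdeg Q + (f.1 - 1) + wdeg R) + a.1 + m + 1
       + wdeg P * (e.1 - 1 + wdeg Q + (f.1 - 1) + wdeg R)
       + (e.1 - 1) * wdeg Q + e.1 + m + 1) *:
  (pr a.2 c.2 *: (pr e.2 f.2 *: cojac (cl Q) (cl (R ++ P)) (cl Y))).
pose K2 (a : letter) P (e : letter) Q (f : letter) R (c : letter) Y : Z :=
  sgn ((a.1 - 1) * (wdeg P + (e.1 - 1) + wdeg Q + (f.1 - 1) + wdeg R) + a.1 + m + 1
       + (wdeg P + (e.1 - 1) + wdeg Q) * (f.1 - 1 + wdeg R)
       + (f.1 - 1) * (wdeg R + wdeg P) + f.1 + m + 1) *: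
  (pr a.2 c.2 *: (pr f.2 e.2 *: cojac (cl (R ++ P)) (cl Q) (cl Y))).
transitivity (cyc4 w K1 + cyc4 w K2).
  rewrite -cyc4D -cyc4_sub; apply: (eq_cyc2 hw) => a X c Y ga hX gc hY ew.
  rewrite cyc2E !splZ; apply: (eq_splh hX) => P e S hP ge hS eX.
  rewrite !splZ; apply: (eq_splh hS) => Q f R hQ gf hR eS.
  rewrite [pr a.2 c.2 *: _]scalerDr scalerDr ![pr _ _ *: (sgn _ *: _)]sgn_scaleC.
  by rewrite !sgn_scaleA eX eS; congr (_ + _); congr (_ *: _); word_sign.
(* After two rotations the outer pair of [K1] is f, e and its inner pair is c, a: the order of the
   two cuts is reversed with respect to [K2]. *)
rewrite [X in X + _](cyc4_rot _ hw) [X in X + _](cyc4_rot _ hw) -cyc4D.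
rewrite -[RHS](scale0r (cyc4 w K1)) cyc4Z.
apply: (eq_cyc4 hw) => a P e Q f R c Y ga hP ge hQ gf hR gc hY ew.
rewrite scale0r; apply/eqP; rewrite addr_eq0; apply/eqP.
rewrite /K1 /K2 /cojac (ccN_rot hP hR) /=.
rewrite !(linear_funZ (T1 _ _)) !(linear_funZ (T2 _ _)) !(linear_funZ (T3 _ _)).
rewrite (pr_swap pr_sym _ gc ga) ![pr _ _ *: (sgn _ *: _)]sgn_scaleC.
rewrite (scaleCA (pr f.2 e.2) (pr a.2 c.2)) sgn_scaleN !scalerDr !sgn_scaleA.
rewrite ![pr _ _ *: (sgn _ *: _)]sgn_scaleC !sgn_scaleA.
rewrite [RHS]addrC [RHS]addrA; congr (_ + _ + _);
  apply: (sgn_pr2 pr_degree _ ga gc gf ge) => ec ef.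
- by rewrite !ldegE !wdegE !parityE ec ef; parity_cases.
- by rewrite !ldegE !wdegE !parityE ec ef; parity_cases.
- by rewrite !ldegE !wdegE !parityE ec ef; parity_cases.
Qed.

Let hlin_cojac x y : hlin Lgr (cojac x y).
Proof.
apply: hlin_add; first apply: hlin_add.
- apply: (hlin_scale (s := fun z => sgn (x.1 * (y.1 + z.1)))) => //.
  exact: (hlin_linear (T2 y.2 x.2)).
- apply: (hlin_scale (s := fun z => sgn (z.1 * (x.1 + y.1)))) => //.
  exact: (hlin_linear (T1 x.2 y.2)).
- exact: (hlin_linear (T3 x.2 y.2)).
Qed.

Let hbilin_cojac z : hbilin Lgr Lgr (fun x y => cojac x y z).
Proof.
apply: hbilin_add; first apply: hbilin_add.
- exact: (hbilin_scale _ _ (fun i j => sgn (i * (j + z.1)))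
    (conj (fun x => T1 z.2 x) (fun y => T3 y z.2))).
- exact: (hbilin_scale _ _ (fun i j => sgn (z.1 * (i + j)))
    (conj (fun x => T3 z.2 x) (fun y => T2 z.2 y))).
- exact: (hbilin_bilin _ _ (conj (fun x => T2 x z.2) (fun y => T1 y z.2))).
Qed.

Lemma cobr_cojac n x s r e : Lgr n x -> sweedler Lgr (n + e) (cobr x) s ->
    (forall p, p \in s -> sweedler Lgr (p.1.1 + e) (cobr p.1.2) (r p.1)) ->
  \sum_(p <- s) \sum_(q <- r p.1) cojac q.1 q.2 p.2 = 0.
Proof.
move=> hx ss rr.
(* The inner Sweedler sums do not depend on the choice of r; as the function H of the outer factors
   they can be summed over s. *)
pose H (p q : int * CC) := hlift2 (fun x y => cojac x y q) (cobr p.2).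
have hH : hbilin Lgr Lgr H.
  split=> [i u gu|j w gw].
    by apply: hlift2_hlin => *; apply: hlin_cojac.
  move=> i c u u' _ _.
  exact: (lin_comp (hlift2_linear L_grading L_grading (hbilin_cojac (j, w))) cobr_lin).
transitivity (hlift2 H (cobr x)).
  rewrite -(sweedler_hlift2 L_grading hH ss) [LHS]big_seq [RHS]big_seq.
  apply: eq_bigr => p ps.
  exact: (sweedler_hlift2 L_grading (hbilin_cojac p.2) (rr p ps)).
move: x hx {ss}; apply: eq_on_L_gr => [||w hw dw].
- exact: (lin_comp (hlift2_linear L_grading L_grading hH) cobr_lin).
- exact: lin_zero.
rewrite (hlift2_cobr hH hw) -[RHS](cojac_words hw).
apply: (eq_cyc2 hw) => a X c Y ga hX gc hY ew; congr (_ *: (_ *: _)).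
exact: (hlift2_cobr (hbilin_cojac _) hX).
Qed.

End Trilinear.

Lemma cobr_jacobi_L n x s r e : Lgr n x -> sweedler Lgr (n + e) (cobr x) s ->
    (forall p, p \in s -> sweedler Lgr (p.1.1 + e) (cobr p.1.2) (r p.1)) ->
  \sum_(p <- s) \sum_(q <- r p.1)
    (sgn (q.1.1 * (q.2.1 + p.2.1)) *: (q.2.2 ⊗ p.2.2 ⊗ q.1.2)
     + sgn (p.2.1 * (q.1.1 + q.2.1)) *: (p.2.2 ⊗ q.1.2 ⊗ q.2.2)
     + q.1.2 ⊗ q.2.2 ⊗ p.2.2) = 0.
Proof.
exact: (cobr_cojac (@tens3_linear1 _ CC CC CC) (@tens3_linear2 _ CC CC CC)
  (@tens3_linear3 _ CC CC CC)).
Qed.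

(** * The cobracket of a bracket *)

Section CompatibilityWords.
Variables (Z : lmodType k) (T : CC -> CC -> Z).
Hypothesis T_bilin : bilin T.
Local Notation H := (fun a X c Y =>
  sgn ((a.1 - 1) * wdeg X + a.1 + m + 1) *: (pr a.2 c.2 *: T (ccN X) (ccN Y))).

Definition brcob u v : Z := cyc1 u (fun a A => cyc1 v (fun c W =>
  sgn ((a.1 - 1) * wdeg A + (m + 1) * a.1) *: (pr a.2 c.2 *: cobw pr m T (A ++ W)))).

(* The terms in which both letters cut by the cobracket come from u. *)
Definition brcob_in u v : Z := cyc1 u (fun a A => cyc1 v (fun c W =>
  sgn ((a.1 - 1) * wdeg A + (m + 1) * a.1) *: (pr a.2 c.2 *:
  spl A (fun P e B => spl B (fun X f Y => cut H P e X f (Y ++ W)))))).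

(** Both pairs, a with c and e with f, join u to v. Either of them can serve for the bracket and the
    other for the cobracket, and the two choices produce the same pair of cyclic words with opposite
    signs. *)
Lemma brcob_mixed u v : homog u -> homog v ->
  cyc1 u (fun a A => cyc1 v (fun c W =>
  sgn ((a.1 - 1) * wdeg A + (m + 1) * a.1) *: (pr a.2 c.2 *:
  spl A (fun P e B => spl W (fun X f Y => cut H P e (B ++ X) f Y))))) = 0.
Proof.
move=> hu hv; have [t1 t2] := T_bilin.
pose F1 (a : letter) P (e : letter) B (c : letter) X (f : letter) Y : Z :=
  sgn ((a.1 - 1) * (wdeg P + (e.1 - 1) + wdeg B) + (m + 1) * a.1
       + wdeg P * (e.1 - 1 + (wdeg B + wdeg X) + (f.1 - 1) + wdeg Y)
       + (e.1 - 1) * (wdeg B + wdeg X) + e.1 + m + 1) *: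
  (pr a.2 c.2 *: (pr e.2 f.2 *: T (ccN (B ++ X)) (ccN (Y ++ P)))).
pose F2 (a : letter) P (e : letter) B (c : letter) X (f : letter) Y : Z :=
  sgn ((a.1 - 1) * (wdeg P + (e.1 - 1) + wdeg B) + (m + 1) * a.1
       + (wdeg P + (e.1 - 1) + (wdeg B + wdeg X)) * (f.1 - 1 + wdeg Y)
       + (f.1 - 1) * (wdeg Y + wdeg P) + f.1 + m + 1) *:
  (pr a.2 c.2 *: (pr f.2 e.2 *: T (ccN (Y ++ P)) (ccN (B ++ X)))).
have spread (F G : letter -> seq letter -> letter -> seq letter ->
    letter -> seq letter -> letter -> seq letter -> Z) :
    cyc2 u (fun a P e B => cyc2 v (fun c X f Y => F a P e B c X f Y + G a P e B c X f Y))
    = cyc2 u (fun a P e B => cyc2 v (F a P e B)) + cyc2 u (fun a P e B => cyc2 v (G a P e B)).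
  rewrite -cyc2D; apply: (eq_cyc2 hu) => a P e B *; exact: cyc2D.
transitivity (cyc2 u (fun a P e B => cyc2 v (F1 a P e B)) +
              cyc2 u (fun a P e B => cyc2 v (F2 a P e B))).
  rewrite -spread; apply: (eq_cyc1 hu) => a A ga hA eu.
  rewrite -cyc1_spl_exchange; apply: (eq_cyc1 hv) => c W gc hW ev.
  rewrite !splZ; apply: (eq_splh hA) => P e B hP ge hB eA.
  rewrite !splZ; apply: (eq_splh hW) => X f Y hX gf hY eW.
  rewrite /cut [pr a.2 c.2 *: _]scalerDr scalerDr.
  rewrite ![pr _ _ *: (sgn _ *: _)]sgn_scaleC !sgn_scaleA /F1 /F2 eA.
  by congr (_ + _); congr (_ *: _); word_sign.
apply/eqP; rewrite addr_eq0; apply/eqP.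
rewrite [LHS]cyc2_sym cyc2N; apply: (eq_cyc2 hu) => a P e B ga hP ge hB eu.
rewrite [X in _ *: X]cyc2_sym cyc2Z cyc2N.
apply: (eq_cyc2 hv) => c X f Y gc hX gf hY ev.
rewrite /F1 /F2 (ccN_rot hP hY) (ccN_rot hX hB).
rewrite (linear_funZ (t1 _)) (linear_funZ (t2 _)) (pr_swap pr_sym _ ge gf) sgn_scaleN.
rewrite ![pr _ _ *: (sgn _ *: _)]sgn_scaleC !sgn_scaleA (scaleCA (pr f.2 e.2)).
apply: (sgn_pr2 pr_degree _ ga gc gf ge) => ec ef.
by rewrite !parityE ?ec ?ef; parity_cases.
Qed.

Lemma brcob_outE u v : homog u -> homog v ->
  cyc1 u (fun a A => cyc1 v (fun c W =>
  sgn ((a.1 - 1) * wdeg A + (m + 1) * a.1) *: (pr a.2 c.2 *: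
  spl W (fun P e B => spl B (fun X f Y => cut H (A ++ P) e X f Y))))) =
  - sgn (ldeg u * ldeg v) *: brcob_in v u.
Proof.
move=> hu hv; have [t1 t2] := T_bilin.
rewrite cyc1_exchange sgnS cyc1Z; apply: (eq_cyc1 hv) => c W gc hW ev.
rewrite cyc1Z; apply: (eq_cyc1 hu) => a A ga hA eu.
rewrite (pr_swap pr_sym _ gc ga) !sgn_scaleA !splZ.
apply: (eq_splh hW) => P e B hP ge hB eW; rewrite !splZ.
apply: (eq_splh hB) => X f Y hX gf hY eB.
rewrite /cut ![pr a.2 c.2 *: _]scalerDr !scalerDr.
rewrite ![pr _ _ *: (sgn _ *: _)]sgn_scaleC !sgn_scaleA (catA Y A P).
congr (_ + _).
  apply: (sgn_pr2 pr_degree _ ga gc ge gf) => ec ef.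
  by rewrite !ldegE !wdegE eu ev eW eB !parityE ?ec ?ef; parity_cases.
apply: (sgn_pr2 pr_degree _ ga gc gf ge) => ec ef.
by rewrite !ldegE !wdegE eu ev eW eB !parityE ?ec ?ef; parity_cases.
Qed.

Lemma brcobE u v : homog u -> homog v ->
  brcob u v = brcob_in u v - sgn (ldeg u * ldeg v) *: brcob_in v u.
Proof.
move=> hu hv; rewrite -scaleNr -(brcob_outE hu hv).
rewrite -[brcob_in u v]addr0 -(brcob_mixed hu hv) -!cyc1D.
apply: (eq_cyc1 hu) => a A ga hA eu; rewrite -!cyc1D.
apply: (eq_cyc1 hv) => c W gc hW ev.
by rewrite -!scalerDr -cyc2_cat.
Qed.

(** The word u is read from a cut letter rather than from the letter a paired with v. Then a lies on
    one of the two arcs between the cut letters, and the sum over its positions there is the bracket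
    of that arc with v. *)
Lemma brcob_inE u v : homog u -> homog v ->
  brcob_in u v = cyc2 u (fun e X f Y =>
    sgn ((e.1 - 1) * wdeg X + e.1 + m + 1) *: (pr e.2 f.2 *:
      (T (ccN X) (brw Y v) + sgn (ldeg Y * ldeg v) *: T (brw X v) (ccN Y)))).
Proof.
move=> hu hv; have [t1 t2] := T_bilin.
pose K1 (a : letter) P (e : letter) X (f : letter) Y : Z := cyc1 v (fun c W =>
  sgn ((a.1 - 1) * (wdeg P + (e.1 - 1) + wdeg X + (f.1 - 1) + wdeg Y)
       + (m + 1) * a.1
       + wdeg P * (e.1 - 1 + wdeg X + (f.1 - 1) + (wdeg Y + wdeg W))
       + (e.1 - 1) * wdeg X + e.1 + m + 1) *:
  (pr a.2 c.2 *: (pr e.2 f.2 *: T (ccN X) (ccN ((Y ++ W) ++ P))))).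
pose K2 (a : letter) P (e : letter) X (f : letter) Y : Z := cyc1 v (fun c W =>
  sgn ((a.1 - 1) * (wdeg P + (e.1 - 1) + wdeg X + (f.1 - 1) + wdeg Y)
       + (m + 1) * a.1
       + (wdeg P + (e.1 - 1) + wdeg X) * (f.1 - 1 + (wdeg Y + wdeg W))
       + (f.1 - 1) * (wdeg Y + wdeg W + wdeg P) + f.1 + m + 1) *:
  (pr a.2 c.2 *: (pr f.2 e.2 *: T (ccN ((Y ++ W) ++ P)) (ccN X)))).
transitivity (cyc3 u K1 + cyc3 u K2).
  rewrite -cyc3D; apply: (eq_cyc1 hu) => a A ga hA eu.
  transitivity (spl A (fun P e B => cyc1 v (fun c W =>
    sgn ((a.1 - 1) * wdeg A + (m + 1) * a.1) *: (pr a.2 c.2 *: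
    spl B (fun X f Y => cut H P e X f (Y ++ W)))))).
    rewrite -cyc1_spl_exchange; apply: (eq_cyc1 hv) => c W gc hW ev.
    by rewrite !splZ.
  apply: (eq_splh hA) => P e B hP ge hB eA.
  transitivity (spl B (fun X f Y => cyc1 v (fun c W =>
    sgn ((a.1 - 1) * wdeg A + (m + 1) * a.1) *: (pr a.2 c.2 *:
    cut H P e X f (Y ++ W))))).
    rewrite -cyc1_spl_exchange; apply: (eq_cyc1 hv) => c W gc hW ev.
    by rewrite !splZ.
  apply: (eq_splh hB) => X f Y hX gf hY eB; rewrite -cyc1D.
  apply: (eq_cyc1 hv) => c W gc hW ev.
  rewrite /cut [pr a.2 c.2 *: _]scalerDr scalerDr.
  rewrite ![pr _ _ *: (sgn _ *: _)]sgn_scaleC !sgn_scaleA eA eB.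
  by congr (_ + _); congr (_ *: _); word_sign.
pose L1 (e : letter) X (f : letter) Y (a : letter) P : Z := cyc1 v (fun c W =>
  sgn ((e.1 - 1) * wdeg X + e.1 + m + 1 + wdeg Y * (wdeg P + (a.1 - 1))
       + (a.1 - 1) * (wdeg P + wdeg Y) + (m + 1) * a.1) *:
  (pr e.2 f.2 *: (pr a.2 c.2 *: T (ccN X) (ccN ((P ++ Y) ++ W))))).
pose L2 (e : letter) P (a : letter) Q (f : letter) Y : Z := cyc1 v (fun c W =>
  sgn ((e.1 - 1) * (wdeg P + (a.1 - 1) + wdeg Q) + e.1 + m + 1 + ldeg Y * ldeg v
       + wdeg P * (wdeg Q + (a.1 - 1))
       + (a.1 - 1) * (wdeg Q + wdeg P) + (m + 1) * a.1) *:
  (pr e.2 f.2 *: (pr a.2 c.2 *: T (ccN ((Q ++ P) ++ W)) (ccN Y)))).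
(* Three letters of u are marked, and changing the letter at which the reading starts takes two
   rotation steps between [K1] and [L1] and one between [K2] and [L2]. *)
transitivity (cyc3 u L1 + cyc3 u L2).
  congr (_ + _).
    rewrite [RHS](cyc3_rot _ hu) [RHS](cyc3_rot _ hu).
    apply: (eq_cyc3 hu) => a P e X f Y ga hP ge hX gf hY eu.
    rewrite sgn_scaleA cyc1Z; apply: (eq_cyc1 hv) => c W gc hW ev.
    have hYW : homog (Y ++ W) by apply/homog_cat.
    have hPY : homog (P ++ Y) by apply/homog_cat.
    rewrite -(catA P Y W) (ccN_rot hYW hP) (linear_funZ (t1 _)).
    rewrite (scaleCA (pr e.2 f.2)) ![pr _ _ *: (sgn _ *: _)]sgn_scaleC !sgn_scaleA.
    apply: (sgn_pr2 pr_degree _ ga gc ge gf) => ec ef.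
    by rewrite !wdegE !parityE ?ec ?ef; parity_cases.
  rewrite [RHS](cyc3_rot _ hu).
  apply: (eq_cyc3 hu) => a P e X f Y ga hP ge hX gf hY eu.
  rewrite cyc1Z; apply: (eq_cyc1 hv) => c W gc hW ev.
  have hYW : homog (Y ++ W) by apply/homog_cat.
  rewrite -(catA P Y W) (ccN_rot hYW hP) (linear_funZ (t2 _)).
  rewrite (scaleCA (pr f.2 e.2)) ![pr _ _ *: (sgn _ *: _)]sgn_scaleC !sgn_scaleA.
  apply: (sgn_pr2 pr_degree _ ga gc gf ge) => ec ef.
  by rewrite !ldegE ev !wdegE !parityE ?ec ?ef; parity_cases.
rewrite -[X in _ + X]cyc3_sub.
rewrite -[cyc3 u L1]/(cyc2 u (fun e X f B => spl B (fun Y a P => L1 e X f Y a P))).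
rewrite -cyc2D; apply: (eq_cyc2 hu) => e A f B ge hA gf hB eu.
rewrite [pr e.2 f.2 *: _]scalerDr scalerDr; congr (_ + _).
  rewrite /brw (cyc1_linear _ _ (t1 _)) [cyc1 B _]/cyc1 !splZ.
  apply: (eq_splh hB) => Y a P hY ga hP eB.
  rewrite (cyc1_linear _ _ (t1 _)) !cyc1Z; apply: (eq_cyc1 hv) => c W gc hW ev.
  rewrite !(linear_funZ (t1 _)) ![pr _ _ *: (sgn _ *: _)]sgn_scaleC !sgn_scaleA.
  by congr (_ *: _); word_sign.
rewrite /brw (cyc1_linear _ _ (t2 _)) [cyc1 A _]/cyc1 !splZ.
apply: (eq_splh hA) => P a Q hP ga hQ eA.
rewrite (cyc1_linear _ _ (t2 _)) !cyc1Z; apply: (eq_cyc1 hv) => c W gc hW ev.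
rewrite !(linear_funZ (t2 _)) ![pr _ _ *: (sgn _ *: _)]sgn_scaleC !sgn_scaleA.
by rewrite eA; congr (_ *: _); word_sign.
Qed.

Lemma hlift2_lin (X : lmodType k) (F : X -> int * CC -> int * CC -> Z) t :
    (forall p q, linear (fun x => F x p q)) ->
  linear (fun x => hlift2 (F x) t).
Proof.
move=> lF c x x'; rewrite /hlift2 -tliftP; apply: eq_tlift => u w.
rewrite -hliftP; apply: eq_hlift => i y gy; rewrite -hliftP.
by apply: eq_hlift => j z gz; apply: lF.
Qed.

Lemma cobT_br i j x y s t e :
    Lgr i x -> Lgr j y -> sweedler Lgr (i + e) (cobr x) s ->
    sweedler Lgr (j + e) (cobr y) t ->
  clift grC (cobw pr m T) (br x y) =
  \sum_(p <- t) (sgn (i * p.1.1) *: T p.1.2 (br x p.2.2) + T (br x p.1.2) p.2.2)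
  + \sum_(p <- s) (T p.1.2 (br p.2.2 y) + sgn (p.2.1 * j) *: T (br p.1.2 y) p.2.2).
Proof.
move=> hx hy ss tt; have [t1 t2] := T_bilin.
have [l1 l2] := br_bilin.
pose F x (p q : int * CC) : Z :=
  sgn (i * p.1) *: T p.2 (br x q.2) + T (br x p.2) q.2.
pose G y (p q : int * CC) : Z :=
  T p.2 (br q.2 y) + sgn (q.1 * j) *: T (br p.2 y) q.2.
have hF z : hbilin Lgr Lgr (F z).
  apply: hbilin_add.
    apply: (hbilin_scale _ _ (fun a _ => sgn (i * a)) (f := fun p q => T p (br z q))).
    by split=> [p|q]; [exact: (lin_comp (t1 p) (l1 z)) | exact: t2].
  apply: (hbilin_bilin _ _ (f := fun p q => T (br z p) q)).
  by split=> [p|q]; [exact: t1 | exact: (lin_comp (t2 q) (l1 z))].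
have hG z : hbilin Lgr Lgr (G z).
  apply: hbilin_add.
    apply: (hbilin_bilin _ _ (f := fun p q => T p (br q z))).
    by split=> [p|q]; [exact: (lin_comp (t1 p) (l2 z)) | exact: t2].
  apply: (hbilin_scale _ _ (fun _ a => sgn (a * j)) (f := fun p q => T (br p z) q)).
  by split=> [p|q]; [exact: t1 | exact: (lin_comp (t2 q) (l2 z))].
rewrite (sweedler_hlift2 L_grading (hF x) tt) (sweedler_hlift2 L_grading (hG y) ss).
have lc := clift_linear grC (cobw_mlin m grC pr_bilin T_bilin).
have lh z := hlift2_linear L_grading L_grading (hF z).
have lg z := hlift2_linear L_grading L_grading (hG z).
have lF z : linear (fun x => hlift2 (F x) z).
  apply: hlift2_lin => p q; rewrite /F.
  exact: (lin_add (lin_scale _ (lin_comp (t1 p.2) (l2 q.2))) (lin_comp (t2 q.2) (l2 p.2))).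
have lG z : linear (fun y => hlift2 (G y) z).
  apply: hlift2_lin => p q; rewrite /G.
  exact: (lin_add (lin_comp (t1 p.2) (l1 q.2)) (lin_scale _ (lin_comp (t2 q.2) (l1 p.2)))).
move: x hx {ss}; apply: eq_on_L_gr => [||u hu du].
- exact: (lin_comp lc (l2 y)).
- exact: (lin_add (lF _) (lin_comp (lg y) cobr_lin)).
move: y hy {tt}; apply: eq_on_L_gr => [||v hv dv].
- exact: (lin_comp lc (l1 _)).
- exact: (lin_add (lin_comp (lh _) cobr_lin) (lG _)).
rewrite (brE hu hv) (hlift2_cobr (hF _) hv) (hlift2_cobr (hG _) hu).
transitivity (brcob u v).
  rewrite /brw (cyc1_linear _ _ lc); apply: (eq_cyc1 hu) => a A ga hA eu.
  rewrite (cyc1_linear _ _ lc); apply: (eq_cyc1 hv) => c W gc hW ev.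
  rewrite !(linear_funZ lc); congr (_ *: (_ *: _)).
  apply: (cliftE char_k grC (cobw_mlin m grC pr_bilin T_bilin) (cobw_cyclic _ _ _)) => //.
  exact/homog_cat.
rewrite (brcobE hu hv) addrC (brcob_inE hu hv) (brcob_inE hv hu); congr (_ + _).
  rewrite sgn_scaleN cyc2Z; apply: (eq_cyc2 hv) => a X c Y ga hX gc hY ev.
  rewrite /F (brE hu hX) (brE hu hY) (brw_skew pr_degree pr_sym hu hX).
  rewrite (brw_skew pr_degree pr_sym hu hY) !sgnS.
  rewrite (linear_funZ (t1 _)) (linear_funZ (t2 _)) !scalerDr.
  rewrite ![pr _ _ *: (sgn _ *: _)]sgn_scaleC !sgn_scaleA.
  congr (_ + _); apply: (sgn_pr pr_degree _ ga gc) => ec.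
    by rewrite -du !ldegE ev !parityE ec; parity_cases.
  by rewrite !ldegE ev !parityE ec; parity_cases.
apply: (eq_cyc2 hu) => a X c Y ga hX gc hY eu.
by rewrite /G (brE hX hv) (brE hY hv) -dv.
Qed.

End CompatibilityWords.

Lemma cobr_br i j x y s t e :
    Lgr i x -> Lgr j y -> sweedler Lgr (i + e) (cobr x) s ->
    sweedler Lgr (j + e) (cobr y) t ->
  cobr (br x y) =
  \sum_(p <- t) (sgn (i * p.1.1) *: (p.1.2 ⊗ br x p.2.2) + br x p.1.2 ⊗ p.2.2)
  + \sum_(p <- s) (p.1.2 ⊗ br p.2.2 y + sgn (p.2.1 * j) *: (br p.1.2 y ⊗ p.2.2)).
Proof. exact: (cobT_br (tens_bilin CC CC)). Qed.

End CobracketAxioms.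

(** * The differential *)

Section Coproduct.
Variables (k : fieldType) (C : lmodType k) (gr : int -> C -> Prop).
Variables (Delta : C -> tensor C C).
Hypothesis grC : grading gr.
Hypothesis Delta_linear : linear Delta.
Hypothesis Delta_degree :
  forall n a, gr n a -> exists s, sweedler gr n (Delta a) s.
Local Notation letter := (int * C)%type.
Local Notation homog := (homog gr).
Implicit Types (w : seq letter).

(** A chosen Sweedler decomposition of the coproduct of a. The default [::] is not reached on
    homogeneous letters, by [swP], and [copE] removes the dependence on the choice. *)
Definition sw (a : letter) : seq (letter * letter) :=
  if pselect (exists s, sweedler gr a.1 (Delta a.2) s) is left e
  then projT1 (cid e) else [::].

Lemma swP a : gr a.1 a.2 -> sweedler gr a.1 (Delta a.2) (sw a).
Proof.
by move=> /Delta_degree es; rewrite /sw; case: pselect => // e; case: cid.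
Qed.

Section Cop.
Variable Z : lmodType k.
Implicit Types F G : letter -> letter -> Z.

Definition cop F (a : letter) : Z := \sum_(p <- sw a) F p.1 p.2.

Lemma copE F a s : gr a.1 a.2 -> hbilin gr gr F ->
  sweedler gr a.1 (Delta a.2) s -> \sum_(p <- s) F p.1 p.2 = cop F a.
Proof.
move=> ga hF ss; rewrite /cop (sweedler_hlift2 grC hF ss).
by rewrite (sweedler_hlift2 grC hF (swP ga)).
Qed.

Lemma cop_hlin F : hbilin gr gr F -> hlin gr (cop F).
Proof.
move=> hF n c a a' ga ga'.
have e x : gr n x -> cop F (n, x) = hlift2 grC grC F (Delta x).
  by move=> gx; rewrite /cop (sweedler_hlift2 grC hF (swP (a := (n, x)) gx)).
rewrite !e //; last exact: grP.
by rewrite Delta_linear (hlift2_linear grC grC hF).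
Qed.

Lemma eq_cop F G a : gr a.1 a.2 ->
    (forall p q, gr p.1 p.2 -> gr q.1 q.2 -> p.1 + q.1 = a.1 -> F p q = G p q) ->
  cop F a = cop G a.
Proof.
move=> /swP[hs _] FG; rewrite /cop [LHS]big_seq [RHS]big_seq.
by apply: eq_bigr => p /hs[gp gq e]; apply: FG.
Qed.

Lemma copD F G a : cop (fun p q => F p q + G p q) a = cop F a + cop G a.
Proof. exact: big_split. Qed.

Lemma copN F a : cop (fun p q => - F p q) a = - cop F a.
Proof. exact: sumrN. Qed.

Lemma copZ c F a : c *: cop F a = cop (fun p q => c *: F p q) a.
Proof. exact: scaler_sumr. Qed.

Lemma cop_spl w (F : letter -> letter -> seq letter -> letter -> seq letter -> Z) a :
  cop (fun p q => spl w (F p q)) a = spl w (fun P x Q => cop (fun p q => F p q P x Q) a).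
Proof. by rewrite /cop -spl_sum. Qed.

Lemma cop_mlin (F : letter -> letter -> seq letter -> Z) a : gr a.1 a.2 ->
    (forall p q, gr p.1 p.2 -> gr q.1 q.2 -> mlin gr (F p q)) ->
  mlin gr (fun w => cop (fun p q => F p q w) a).
Proof.
move=> ga mF p q n c x x' hp hq gx gx'; rewrite copZ -copD.
by apply: eq_cop => // y z gy gz _; apply: mF.
Qed.

Lemma cop_hlinr (F : letter -> letter -> letter -> Z) a : gr a.1 a.2 ->
    (forall p q, gr p.1 p.2 -> gr q.1 q.2 -> hlin gr (F p q)) ->
  hlin gr (fun x => cop (fun p q => F p q x) a).
Proof.
move=> ga hF n c x x' gx gx'; rewrite copZ -copD.
by apply: eq_cop => // y z gy gz _; apply: hF.
Qed.

End Cop.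

Lemma cop_linear (Z Z' : lmodType k) (f : Z -> Z') F a : linear f ->
  f (cop F a) = cop (fun p q => f (F p q)) a.
Proof. by move=> lf; rewrite /cop (linear_fun_bigop lf). Qed.

Lemma cop_exchange (Z : lmodType k) (F : letter -> letter -> letter -> letter -> Z) a c :
  cop (fun p q => cop (F p q) c) a = cop (fun x y => cop (fun p q => F p q x y) a) c.
Proof. exact: exchange_big. Qed.

Lemma mlin_hbilin (Z : lmodType k) (G : seq letter -> Z) : mlin gr G ->
  hbilin gr gr (fun p q => G [:: p; q]).
Proof.
move=> mG; split=> [n u gu i c w w' gw gw'|n w gw i c u u' gu gu'].
  by apply: (mG [:: (n, u)] [::]) => //; apply/homog_cons.
by apply: (mG [::] [:: (n, w)]) => //; apply/homog_cons.
Qed.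

Lemma hbilin_mulr (Z : lmodType k) (s : int -> int -> k) (F : letter -> letter -> Z) :
  hbilin gr gr F -> hbilin gr gr (fun p q => s p.1 q.1 *: F p q).
Proof.
move=> [F1 F2]; split=> [n u gu i c w w' gw gw'|n w gw i c u u' gu gu'] /=.
  by rewrite (F1 n u gu i c w w') // scalerDr scaleCA.
by rewrite (F2 n w gw i c u u') // scalerDr scaleCA.
Qed.

Variable d : C -> C.
Hypothesis d_linear : linear d.
Hypothesis d_degree : forall n x, gr n x -> gr (n - 1) (d x).

(* The derivation of the tensor algebra of C[1] induced by d and Delta, on
   single letters. *)
Definition nab (Z : lmodType k) (G : seq letter -> Z) (a : letter) : Z :=
  G [:: (a.1 - 1, d a.2)] - cop (fun p q => sgn (p.1 - 1) *: G [:: p; q]) a.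

Section Nab.
Variable Z : lmodType k.
Implicit Types G : seq letter -> Z.

Lemma eq_nab G G' a : gr a.1 a.2 ->
    (forall W, homog W -> wdeg W = a.1 - 1 - 1 -> G W = G' W) ->
  nab G a = nab G' a.
Proof.
move=> ga GG; rewrite /nab GG.
- congr (_ - _); apply: eq_cop => // p q gp gq e; rewrite GG //.
    by do 2?[apply/homog_cons; split=> //].
  by rewrite !wdegE -e; ring.
- by apply/homog_cons; split=> //; apply: d_degree.
- by rewrite !wdegE addr0.
Qed.

Lemma nabD G G' a : nab (fun W => G W + G' W) a = nab G a + nab G' a.
Proof.
rewrite /nab addrACA -opprD -copD; congr (_ - _).
by congr cop; apply/funext=> p; apply/funext=> q; rewrite scalerDr.
Qed.

Lemma nabZ c G a : c *: nab G a = nab (fun W => c *: G W) a.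
Proof.
rewrite /nab scalerBr copZ; congr (_ - _).
by congr cop; apply/funext=> p; apply/funext=> q; rewrite scaleCA.
Qed.

Lemma nab_spl w (F : seq letter -> seq letter -> letter -> seq letter -> Z) a :
  nab (fun W => spl w (F W)) a = spl w (fun P x Q => nab (fun W => F W P x Q) a).
Proof.
rewrite /nab; under [X in cop X]eq_fun2 do rewrite splZ.
by rewrite cop_spl splN -splD.
Qed.

Lemma nab_cyc1 w (F : seq letter -> letter -> seq letter -> Z) a :
  nab (fun W => cyc1 w (F W)) a = cyc1 w (fun c X => nab (fun W => F W c X) a).
Proof.
by rewrite /cyc1 nab_spl; apply: eq_spl => P x Q _; rewrite nabZ.
Qed.

Lemma nab_hlin G : mlin gr G -> hlin gr (nab G).
Proof.
move=> mG n c a a' ga ga'; rewrite /nab /= d_linear.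
rewrite (mlin_head mG (homog_nil gr)); try exact: d_degree.
rewrite (cop_hlin (hbilin_mulr (fun i _ => sgn (i - 1)) (mlin_hbilin mG))) //.
by rewrite opprD scalerBr addrACA.
Qed.

Lemma nab_mlin (F : seq letter -> seq letter -> Z) a : gr a.1 a.2 ->
  (forall W, homog W -> mlin gr (F W)) -> mlin gr (fun w => nab (F^~ w) a).
Proof.
move=> ga mF; apply: mlin_add.
  by apply: mF; apply/homog_cons; split=> //; apply: d_degree.
apply: mlin_opp; apply: (cop_mlin ga) => p q gp gq; apply: mlin_cst; apply: mF.
by do 2?[apply/homog_cons; split=> //].
Qed.

End Nab.

Lemma nab_linear (Z Z' : lmodType k) (f : Z -> Z') G a : linear f ->
  f (nab G a) = nab (fun W => f (G W)) a.
Proof.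
move=> lf; rewrite /nab (linear_funD lf) (linear_funN lf) (cop_linear _ _ lf).
congr (_ - _); congr cop; apply/funext=> p; apply/funext=> q.
exact: (linear_funZ lf).
Qed.

Lemma nab_exchange (Z : lmodType k) (G : seq letter -> seq letter -> Z) a c :
  nab (fun W => nab (G W) c) a = nab (fun W' => nab (fun W => G W W') a) c.
Proof.
rewrite {1 3}/nab [X in _ - X](_ : _ = cop (fun p q => sgn (p.1 - 1) *:
   G [:: p; q] [:: (c.1 - 1, d c.2)]) a
   - cop (fun p q => cop (fun x y => sgn (p.1 - 1) *: (sgn (x.1 - 1) *:
       G [:: p; q] [:: x; y])) c) a); last first.
  rewrite -[X in _ - X]scale1r -scaleNr copZ -copD.
  congr cop; apply/funext=> p; apply/funext=> q.
  by rewrite /nab scalerBr copZ scaleN1r.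
rewrite [X in _ = _ - X](_ : _ = cop (fun x y => sgn (x.1 - 1) *:
   G [:: (a.1 - 1, d a.2)] [:: x; y]) c
   - cop (fun x y => cop (fun p q => sgn (p.1 - 1) *: (sgn (x.1 - 1) *:
       G [:: p; q] [:: x; y])) a) c); last first.
  rewrite -[X in _ - X]scale1r -scaleNr copZ -copD.
  congr cop; apply/funext=> x; apply/funext=> y.
  rewrite /nab scalerBr copZ scaleN1r; congr (_ - _); congr cop.
  by apply/funext=> p; apply/funext=> q; rewrite scaleCA.
rewrite /nab cop_exchange !opprB.
by rewrite addrACA [X in _ + X]addrC addrACA.
Qed.

End Coproduct.

Section Differential.
Variables (k : fieldType) (C : lmodType k) (gr : int -> C -> Prop).
Variables (d : C -> C) (Delta : C -> tensor C C).
Hypothesis char_k : [pchar k] =i pred0.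
Hypothesis grC : grading gr.
Hypothesis Delta_linear : linear Delta.
Hypothesis Delta_degree :
  forall n a, gr n a -> exists s, sweedler gr n (Delta a) s.
Hypothesis d_linear : linear d.
Hypothesis d_degree : forall n x, gr n x -> gr (n - 1) (d x).
Hypothesis d_square : forall x, d (d x) = 0.
Local Notation letter := (int * C)%type.
Local Notation homog := (homog gr).
Local Notation cop := (cop gr Delta).
Local Notation nab := (nab gr Delta d).
Local Notation eq_nab := (eq_nab (gr := gr) Delta_degree d_degree).
Local Notation eq_cop := (eq_cop (gr := gr) Delta_degree).

Hypothesis cop_coassoc : forall (Z : lmodType k) (K : letter -> letter -> letter -> Z) a,
  (forall x y, gr x.1 x.2 -> gr y.1 y.2 -> hlin gr (K x y)) ->
  (forall x z, gr x.1 x.2 -> gr z.1 z.2 -> hlin gr (fun y => K x y z)) ->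
  (forall y z, gr y.1 y.2 -> gr z.1 z.2 -> hlin gr (fun x => K x y z)) ->
  gr a.1 a.2 ->
  cop (fun p q => cop (fun x y => K x y q) p) a = cop (fun p q => cop (K p) q) a.
Hypothesis cop_coleibniz : forall (Z : lmodType k) (F : letter -> letter -> Z) a,
  hbilin gr gr F -> gr a.1 a.2 ->
  cop F (a.1 - 1, d a.2) =
  cop (fun p q => F (p.1 - 1, d p.2) q + sgn p.1 *: F p (q.1 - 1, d q.2)) a.
Implicit Types (u v w : seq letter).

Lemma homog1 a : gr a.1 a.2 -> homog [:: a].
Proof. by move=> ga; apply/homog_cons. Qed.

Lemma homog2 a c : gr a.1 a.2 -> gr c.1 c.2 -> homog [:: a; c].
Proof. by move=> ga gc; apply/homog_cons; split=> //; apply: homog1. Qed.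

Lemma nabE (Z : lmodType k) (G : seq letter -> Z) a :
  nab G a = G [:: (a.1 - 1, d a.2)] - cop (fun p q => sgn (p.1 - 1) *: G [:: p; q]) a.
Proof. by []. Qed.

(** The terms with d twice vanish since d squares to 0, those with d once cancel by the co-Leibniz
    rule, and those with two coproducts cancel by coassociativity. *)
Lemma nab_square (Z : lmodType k) (F : seq letter -> Z) a : mlin gr F -> gr a.1 a.2 ->
  nab (fun W => spl W (fun P b Q =>
    sgn (wdeg P) *: nab (fun W' => F (P ++ W' ++ Q)) b)) a = 0.
Proof.
move=> mF ga.
have D1 x : spl [:: x] (fun P b Q =>
    sgn (wdeg P) *: nab (fun W' => F (P ++ W' ++ Q)) b) = nab F x.
  rewrite /= wdeg_nil sgn_scale0 addr0.
  by congr nab; apply/funext=> W; rewrite cats0.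
have D2 p q : spl [:: p; q] (fun P b Q =>
    sgn (wdeg P) *: nab (fun W' => F (P ++ W' ++ Q)) b) =
    nab (fun W' => F (W' ++ [:: q])) p + sgn (p.1 - 1) *: nab (fun W' => F (p :: W')) q.
  rewrite /= wdeg_nil sgn_scale0 addr0 wdeg_cons wdeg_nil addr0.
  by congr (_ + _ *: nab _ _); apply/funext=> W; rewrite cats0.
rewrite nabE D1 nabE.
have gda := d_degree ga.
have -> : F [:: (a.1 - 1 - 1, d (d a.2))] = 0.
  by rewrite d_square (hlin0 grC (mlin_head mF (homog_nil gr))).
rewrite (cop_coleibniz (hbilin_mulr (fun i _ => sgn (i - 1)) (mlin_hbilin mF)) ga).
(* The triples of letters from an iterated coproduct enter through [K1]; the terms with a single d
   form [A], which occurs once with each sign. *)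
pose K1 (x y z : letter) : Z := sgn y.1 *: F [:: x; y; z].
pose A p q : Z := sgn p.1 *: F [:: (p.1 - 1, d p.2); q] - F [:: p; (q.1 - 1, d q.2)].
have -> : cop (fun p q => sgn (p.1 - 1 - 1) *: F [:: (p.1 - 1, d p.2); q] +
    sgn p.1 *: (sgn (p.1 - 1) *: F [:: p; (q.1 - 1, d q.2)])) a = cop A a.
  apply: eq_cop => // p q _ _ _; rewrite /A sgn_scaleA; congr (_ + _); first by kscale.
  by apply: sgn_scale_odd; parity_cases.
have -> : cop (fun p q => sgn (p.1 - 1) *: spl [:: p; q] (fun P b Q =>
    sgn (wdeg P) *: nab (fun W' => F (P ++ W' ++ Q)) b)) a =
    - cop A a + (cop (fun p q => cop (K1 p) q) a - cop (fun p q => cop (fun x y => K1 x y q) p) a).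
  rewrite -!copN -!copD; apply: eq_cop => // p q gp gq epq.
  rewrite D2 !nabE scalerDr sgn_scaleA.
  rewrite (sgn_scale_even (n := p.1 - 1 + (p.1 - 1))); last by parity_cases.
  have -> : cop (fun x y => sgn (x.1 - 1) *: F [:: p, x & [:: y]]) q = - cop (K1 p) q.
    rewrite -copN; apply: eq_cop => // x y gx gy exy; rewrite /K1 sgn_scaleN.
    by congr (_ *: _); ksign.
  rewrite scalerBr copZ.
  have -> : cop (fun x y => sgn (p.1 - 1) *: (sgn (x.1 - 1) *: F ([:: x; y] ++ [:: q]))) p =
      cop (fun x y => K1 x y q) p.
    apply: eq_cop => // x y gx gy exy; rewrite sgn_scaleA.
    by congr (_ *: _); apply: sgn_eq; rewrite -exy; parity_cases.
  rewrite /A opprB !opprK sgn_scaleN addrACA [X in _ + X]addrC; congr (_ + _).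
  by rewrite addrC; congr (_ + _ *: _); ksign.
rewrite (cop_coassoc (K := K1)) //; first by rewrite subrr addr0 sub0r opprK addNr.
- move=> x y gx gy n c z z' gz gz'; rewrite /K1 (mF [:: x; y] [::]) //; last exact: homog2.
  by rewrite scalerDr scaleCA.
- move=> x z gx gz n c y y' gy gy'; rewrite /K1 (mF [:: x] [:: z]) //; try exact: homog1.
  by rewrite scalerDr scaleCA.
- move=> y z gy gz n c x x' gx gx'; rewrite /K1 (mF [::] [:: y; z]) //; last exact: homog2.
  by rewrite scalerDr scaleCA.
Qed.

(* The value of G on the image under b of the cyclic word w. *)
Definition dw (Z : lmodType k) (G : seq letter -> Z) w : Z :=
  cyc1 w (fun a A => nab (fun W => G (W ++ A)) a).

Section Dw.
Variables (Z : lmodType k) (G : seq letter -> Z).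
Hypothesis mG : mlin gr G.
Hypothesis cG : cyclic gr G.

Let mG_ctx A : homog A -> mlin gr (fun W => G (W ++ A)).
Proof. by move=> hA; apply: (mlin_ctx (A := [::]) mG (homog_nil gr) hA). Qed.

Lemma dw_mlin : mlin gr (dw G).
Proof.
apply: cyc1_mlin => [a ga|A hA].
  apply: (nab_mlin Delta_degree d_degree ga) => W hW.
  have := mlin_ctx mG hW (homog_nil gr).
  by under eq_fun do rewrite cats0.
exact: (nab_hlin grC Delta_linear Delta_degree d_linear d_degree (mG_ctx hA)).
Qed.

Lemma dw_cyclic : cyclic gr (dw G).
Proof. by move=> u v _ _; apply: cyc1_rot. Qed.

(** The second b acts either on the letters produced by the first, where [nab_square] applies, or on
    another letter of w. In the latter case the two actions can be made in either order with
    opposite signs, so that sum is its own negative. *)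
Lemma dw_square w : homog w -> dw (dw G) w = 0.
Proof.
move=> hw.
transitivity (cyc1 w (fun a A => nab (fun W => spl W (fun P b Q => sgn (wdeg P) *:
      nab (fun W' => G ((P ++ W' ++ Q) ++ A)) b)) a) +
    cyc2 w (fun a P b Q => nab (fun W => nab (fun W' =>
      sgn ((a.1 + wdeg P) * (wdeg Q + (b.1 - 1))) *: G (W' ++ Q ++ W ++ P)) b) a)).
  rewrite -cyc1D; apply: (eq_cyc1 hw) => a A ga hA ew.
  rewrite -nab_spl -nabD; apply: (eq_nab ga) => W hW dW.
  rewrite /dw cyc1_cat; congr (_ + _).
    apply: (eq_splh hW) => P b Q hP gb hQ eW; rewrite !nabZ.
    apply: (eq_nab gb) => W' hW' dW'.
    have h : homog (W' ++ Q ++ A) by do 2?[apply/homog_cat; split=> //].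
    rewrite -!catA (cG hP h) -!catA sgn_scaleA; congr (_ *: _); apply: sgn_eq.
    by rewrite !wdegE dW'; parity_cases.
  apply: (eq_splh hA) => P b Q hP gb hQ eA; rewrite !nabZ.
  apply: (eq_nab gb) => W' hW' dW'; congr (_ *: _); apply: sgn_eq.
  by rewrite dW; parity_cases.
rewrite [X in X + _](_ : _ = 0) ?add0r; last first.
  rewrite -[RHS](cyc1_0 _ w); apply: (eq_cyc1 hw) => a A ga hA ew.
  exact: (nab_square (mG_ctx hA) ga).
apply: (eq_oppr0 char_k); rewrite {1}cyc2_sym cyc2N.
apply: (eq_cyc2 hw) => a P b Q ga hP gb hQ ew.
rewrite nab_exchange -scaleN1r !nabZ; apply: (eq_nab ga) => W hW dW.
rewrite !nabZ; apply: (eq_nab gb) => W' hW' dW'.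
have h1 : homog (W ++ P) by apply/homog_cat.
have h2 : homog (W' ++ Q) by apply/homog_cat.
rewrite (catA W P) (catA W' Q) (cG h1 h2) scaleN1r !sgn_scaleA sgn_scaleN.
by congr (_ *: _); apply: sgn_eq; rewrite !wdegE dW dW'; parity_cases.
Qed.

End Dw.

(** ** The Hochschild differential *)

Section Hochschild.
Variables (Z : lmodType k) (G : seq letter -> Z).
Hypothesis mG : mlin gr G.

(** The last sum of the Hochschild differential: the coproduct of the first letter straddles the
    base point of the cyclic word. *)
Definition hoch_wrap w : Z :=
  if w is a :: w' then
    cop (fun p q => sgn ((p.1 - 1) * (a.1 + wdeg w' - p.1)) *: G (q :: w' ++ [:: p])) a
  else 0.

Definition hoch w : Z :=
  spl w (fun P a Q => sgn (wdeg P) *: nab (fun W => G (P ++ W ++ Q)) a)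
  - hoch_wrap w.

Let hoch_wrap_hbilin n q : homog q -> hbilin gr gr (fun p r : letter =>
  sgn ((p.1 - 1) * (n + wdeg q - p.1)) *: G (r :: q ++ [:: p])).
Proof.
move=> hq.
apply: (hbilin_mulr (fun i _ => sgn ((i - 1) * (n + wdeg q - i)))
  (F := fun p r => G (r :: q ++ [:: p]))).
split=> [i u gu j e w w' gw gw'|i w gw j e u u' gu gu'] /=.
  by apply: (@mG [::]) => //; apply/homog_cat; split=> //; apply: homog1.
by apply: (@mG ((i, w) :: q)) => //; apply/homog_cons.
Qed.

Lemma hoch_wrap_mlin : mlin gr hoch_wrap.
Proof.
move=> [|b p] q n c x x' hp hq gx gx' /=.
  exact: (cop_hlin grC Delta_linear Delta_degree (hoch_wrap_hbilin n hq)).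
move: hp => /homog_cons[gb hp]; rewrite copZ -copD; apply: eq_cop => // y z gy gz _.
rewrite !wdegE /= scaleCA -scalerDr -!catA /=; congr (_ *: _).
apply: (@mG (z :: p)) => //; first exact/homog_cons.
by apply/homog_cat; split=> //; apply: homog1.
Qed.

Lemma hoch_mlin : mlin gr hoch.
Proof.
apply: mlin_add; last exact: (mlin_opp hoch_wrap_mlin).
apply: mlin_spl => [a Q ga hQ|P Q hP hQ|P a hP ga].
- apply: mlin_scale => [p q n x y|]; first by rewrite !wdegE.
  apply: (nab_mlin Delta_degree d_degree ga) => W hW.
  apply: (mlin_ctx (A := [::]) mG (homog_nil gr)); exact/homog_cat.
- move=> n c a a' ga ga'.
  rewrite (nab_hlin grC Delta_linear Delta_degree d_linear d_degree (mlin_ctx mG hP hQ)) //.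
  by rewrite scalerDr scaleCA.
- apply: mlin_cst; apply: (nab_mlin Delta_degree d_degree ga) => W hW.
  have hPW : homog (P ++ W) by apply/homog_cat.
  have := mlin_ctx mG hPW (homog_nil gr).
  by under eq_fun do rewrite cats0 -catA.
Qed.

Lemma hoch_sumE w (s : letter -> seq (letter * letter)) :
    w <> [::] -> homog w ->
    (forall a, a \in w -> sweedler gr a.1 (Delta a.2) (s a)) ->
  hoch w =
    - \sum_(i < size w) sgn (epsilon (take i w)) *:
        G (take i w ++ ((nth (0, 0) w i).1 - 1, d (nth (0, 0) w i).2) :: drop i.+1 w)
    + \sum_(i < size w) \sum_(p <- s (nth (0, 0) w i))
        sgn (epsilon (take i w) + p.1.1 - 1) *:
        G (take i w ++ [:: p.1; p.2] ++ drop i.+1 w)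
    - \sum_(p <- s (nth (0, 0) w 0)) sgn ((p.1.1 - 1) * (epsilon w - p.1.1)) *:
        G (p.2 :: behead w ++ [:: p.1]).
Proof.
move=> w0 hw hs; rewrite /hoch; congr (_ - _); last first.
  case: w w0 hw hs => // a w _ hw hs.
  have [ga hw'] : gr a.1 a.2 /\ homog w by apply/homog_cons.
  have sa := hs a (mem_head _ _).
  rewrite /hoch_wrap -(copE grC Delta_degree ga (hoch_wrap_hbilin a.1 hw') sa).
  apply: eq_bigr => p _; congr (_ *: _); congr sgn; congr (_ * _).
  by rewrite epsilonE wdeg_cons; ring.
rewrite -(spl_nth (0, 0) w (fun P a Q => sgn (epsilon P) *:
    G (P ++ (a.1 - 1, d a.2) :: Q))).
rewrite -(spl_nth (0, 0) w (fun P a Q => \sum_(p <- s a)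
  sgn (epsilon P + p.1.1 - 1) *: G (P ++ [:: p.1; p.2] ++ Q))).
rewrite splN -splD; apply: eq_spl => P a Q ew.
have aw : a \in w by rewrite ew mem_cat mem_head orbT.
have [hP [ga hQ]] : homog P /\ gr a.1 a.2 /\ homog Q.
  by move: hw; rewrite ew => /homog_cat[? /homog_cons[? ?]].
have hF : hbilin gr gr (fun p q => sgn (epsilon P + p.1 - 1) *:
    G (P ++ [:: p; q] ++ Q)).
  apply: (hbilin_mulr (fun i _ => sgn (epsilon P + i - 1))
    (F := fun p q => G (P ++ [:: p; q] ++ Q))).
  exact: mlin_hbilin (mlin_ctx mG hP hQ).
rewrite (copE grC Delta_degree ga hF (hs a aw)) nabE scalerBr copZ -copN sgn_scaleN.
congr (_ + _); first by rewrite epsilonE; congr (_ *: _); ksign.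
apply: eq_cop => // p q _ _ _; rewrite sgn_scaleA sgn_scaleN epsilonE.
by congr (_ *: _); ksign.
Qed.

(** Both sides sum over a letter hit by b and over the letter at which the resulting cyclic word is
    opened. The wrapping term supplies the words that open at the second factor of a coproduct; the
    other terms of [hoch] supply all remaining openings. *)
Lemma hoch_cyc1 w : homog w ->
  cyc1 w (fun a A => hoch (a :: A)) = dw (fun u => cyc1 u (fun a A => G (a :: A))) w.
Proof.
move=> hw.
transitivity (cyc1 w (fun a A => nab (fun W => G (W ++ A)) a - hoch_wrap (a :: A)) +
  cyc2 w (fun x P a Q => sgn (x.1 - 1 + wdeg P) *:
    nab (fun W => G (x :: P ++ W ++ Q)) a)).
  rewrite -cyc1D; apply: (eq_cyc1 hw) => a A ga hA ew.
  rewrite /hoch /= wdeg_nil sgn_scale0 addrAC; congr (_ + _).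
  by apply: eq_spl => P b Q _; rewrite wdeg_cons.
rewrite [X in _ + X]cyc2_sym -cyc1D; apply: (eq_cyc1 hw) => a A ga hA ew.
transitivity (nab (fun W => spl W (fun P y Q =>
    sgn (wdeg P * (wdeg Q + wdeg A + (y.1 - 1))) *: G (y :: Q ++ A ++ P))) a +
  nab (fun W => spl A (fun Y y Z => sgn ((wdeg W + wdeg Y) * (wdeg Z + (y.1 - 1))) *:
    G (y :: Z ++ W ++ Y))) a); last first.
  by rewrite -nabD; congr nab; apply/funext=> W; rewrite cyc1_cat.
congr (_ + _); last first.
  rewrite nab_spl; apply: (eq_splh hA) => Y y Z' hY gy hZ eA.
  rewrite sgn_scaleA nabZ; apply: (eq_nab ga) => W hW dW; congr (_ *: _).
  by apply: sgn_eq; rewrite dW; parity_cases.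
rewrite !nabE /= wdeg_nil mul0r sgn_scale0 addr0 cats0 -addrA -opprD -copD.
congr (_ - _); apply: eq_cop => // p q gp gq epq.
rewrite mul0r sgn_scale0 addr0 scalerDr sgn_scaleA; congr (_ + _ *: _).
by apply: sgn_eq; rewrite !wdegE -epq; parity_cases.
Qed.

End Hochschild.

Definition hochb := mlift grC (hoch (@hword k C)).

Let hoch_hword_mlin := hoch_mlin (@hword_mlin k C gr).

Lemma hochb_linear : linear hochb.
Proof. exact: (mlift_linear grC hoch_hword_mlin). Qed.

Lemma hochb_differential : hochschild_differential gr d Delta hochb.
Proof.
move=> w s w0 hw hs; rewrite /hochb (mliftE grC hoch_hword_mlin hw).
exact: (hoch_sumE (@hword_mlin k C gr)).
Qed.

Lemma hochb_cycN w : homog w -> hochb (cycN w) = dw (@cycN k C) w.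
Proof.
move=> hw; rewrite cycNE (cyc1_linear _ _ hochb_linear).
transitivity (cyc1 w (fun a A => hoch (@hword k C) (a :: A))).
  apply: (eq_cyc1 hw) => a A ga hA ew.
  by apply: (mliftE grC hoch_hword_mlin); apply/homog_cons.
have -> : @cycN k C = fun u => cyc1 u (fun a A => hword (a :: A)).
  by apply/funext=> u; apply: cycNE.
exact: (hoch_cyc1 _ hw).
Qed.

End Differential.

(** * The differential on the Connes complex *)

Section ConnesDifferential.
Variables (k : fieldType) (C : lmodType k) (gr : int -> C -> Prop).
Variables (d : C -> C) (Delta : C -> tensor C C) (m : int).
Hypothesis char_k : [pchar k] =i pred0.
Hypothesis grC : grading gr.
Hypothesis Delta_linear : linear Delta.
Hypothesis Delta_degree :
  forall n a, gr n a -> exists s, sweedler gr n (Delta a) s.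
Hypothesis d_linear : linear d.
Hypothesis d_degree : forall n x, gr n x -> gr (n - 1) (d x).
Local Notation letter := (int * C)%type.
Local Notation homog := (homog gr).
Local Notation CC := (CC gr).
Local Notation ccN := (ccN gr).
Local Notation Lgr := (@L_gr k C gr m).
Local Notation ldeg := (ldeg m).
Local Notation cop := (cop gr Delta).
Local Notation nab := (nab gr Delta d).
Local Notation dw := (dw gr d Delta).
Local Notation eq_nab := (eq_nab (gr := gr) Delta_degree d_degree).
Implicit Types (u v w : seq letter).

Lemma nab_closed (Z : lmodType k) (S : Z -> Prop) (G : seq letter -> Z) a :
    S 0 -> (forall c x y, S x -> S y -> S (c *: x + y)) -> gr a.1 a.2 ->
    (forall W, homog W -> wdeg W = a.1 - 1 - 1 -> S (G W)) ->
  S (nab G a).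
Proof.
move=> S0 SP ga SG; rewrite nabE addrC -scaleN1r; apply: (SP); last first.
  by apply: SG; [apply: homog1; exact: d_degree | rewrite !wdegE addr0].
have [hs _] := swP Delta_degree ga.
rewrite /cop big_seq; apply: (big_rec S) => // p x /hs[gp gq e] Sx; apply: (SP) => //.
by apply: SG; [apply: homog2 | rewrite !wdegE -e; ring].
Qed.

Let ccN_mlin := @ccN_mlin k C gr grC.
Let ccN_cyclic : cyclic gr ccN := @ccN_rot k C gr.

Definition bL : CC -> CC := clift grC (dw ccN).

Let dw_ccN_mlin := dw_mlin grC Delta_linear Delta_degree d_linear d_degree ccN_mlin.

Lemma bL_linear : linear bL.
Proof. exact: (clift_linear grC dw_ccN_mlin). Qed.

Lemma bLE w : homog w -> bL (ccN w) = dw ccN w.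
Proof.
by move=> hw; apply: (cliftE char_k grC dw_ccN_mlin) => //; apply: dw_cyclic.
Qed.

Lemma dw_linear (Z Z' : lmodType k) (f : Z -> Z') (G : seq letter -> Z) w :
  linear f -> f (dw G w) = dw (fun u => f (G u)) w.
Proof.
move=> lf; rewrite /dw (cyc1_linear _ _ lf).
by apply: eq_spl => P a Q _; rewrite (nab_linear _ _ _ _ _ lf).
Qed.

Lemma eq_dw (Z : lmodType k) (G G' : seq letter -> Z) w : homog w ->
    (forall u, homog u -> wdeg u = wdeg w - 1 -> G u = G' u) ->
  dw G w = dw G' w.
Proof.
move=> hw GG; apply: (eq_cyc1 hw) => a A ga hA ew; apply: (eq_nab ga) => W hW dW.
by apply: GG; [apply/homog_cat | rewrite wdegE dW ew; ring].
Qed.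

Lemma bL_degree n x : Lgr n x -> Lgr (n - 1) (bL x).
Proof.
have S0 := @L_gr0 k C gr m (n - 1).
have SP : forall c x y, Lgr (n - 1) x -> Lgr (n - 1) y -> Lgr (n - 1) (c *: x + y).
  by move=> c {}x y; apply: L_grP.
elim/L_gr_ind=> [|c x1 x2 IH1 IH2|w hw dw].
- by rewrite (linear_fun0 bL_linear).
- by rewrite (bL_linear c x1 x2); apply: L_grP.
rewrite bLE //; apply: (cyc1_closed S0 SP hw) => a A ga hA ew.
apply: (nab_closed S0 SP ga) => W hW dW.
have <- : ldeg (W ++ A) = n - 1 by rewrite -dw !ldegE ew wdegE dW; ring.
exact/L_gr_ccN/homog_cat.
Qed.

Lemma bL_val x : cc_val (bL x) =
  hochb d Delta grC (cc_val x).
Proof.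
have lh := hochb_linear grC Delta_linear Delta_degree d_linear d_degree.
move: x; apply: (eq_on_CC (lin_comp (@cc_val_linear k C gr) bL_linear)
  (lin_comp lh (@cc_val_linear k C gr))) => w hw.
rewrite bLE // ccNE // hochb_cycN // (dw_linear _ _ (@cc_val_linear k C gr)).
by apply: eq_dw => // u hu _; apply: ccNE.
Qed.

Hypothesis d_square : forall x, d (d x) = 0.
Hypothesis cop_coassoc : forall (Z : lmodType k) (K : letter -> letter -> letter -> Z) a,
  (forall x y, gr x.1 x.2 -> gr y.1 y.2 -> hlin gr (K x y)) ->
  (forall x z, gr x.1 x.2 -> gr z.1 z.2 -> hlin gr (fun y => K x y z)) ->
  (forall y z, gr y.1 y.2 -> gr z.1 z.2 -> hlin gr (fun x => K x y z)) ->
  gr a.1 a.2 ->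
  cop (fun p q => cop (fun x y => K x y q) p) a = cop (fun p q => cop (K p) q) a.
Hypothesis cop_coleibniz : forall (Z : lmodType k) (F : letter -> letter -> Z) a,
  hbilin gr gr F -> gr a.1 a.2 ->
  cop F (a.1 - 1, d a.2) =
  cop (fun p q => F (p.1 - 1, d p.2) q + sgn p.1 *: F p (q.1 - 1, d q.2)) a.

Lemma bL_square x : bL (bL x) = 0.
Proof.
move: x; apply: eq_on_CC => [||w hw].
- exact: (lin_comp bL_linear bL_linear).
- exact: lin_zero.
rewrite (bLE hw) (dw_linear _ _ bL_linear).
rewrite -(dw_square char_k grC Delta_degree d_degree d_square cop_coassoc cop_coleibniz
  ccN_mlin ccN_cyclic hw).
by apply: eq_dw => // u hu _; apply: bLE.
Qed.

End ConnesDifferential.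

(** The cancellation pattern of [local_relation]: z and z' are the terms with d, the pairs x, x' and
    y, y' are the coproduct sums matched by the Frobenius relation, and the terms u1 to u4 are its
    defects. *)
Lemma assemble (Z : zmodType) (z z' x x' y y' u1 u2 u3 u4 : Z) :
  z + z' = 0 -> x + x' = 0 -> y + y' = 0 ->
  z + (x + u1 + u2 + y) + (z' + (x' + (y' + u3 + u4))) = u2 + u3 + (u1 + u4).
Proof.
move=> ez ex ey; rewrite !addrA.
rewrite [LHS](ACl ((1*6)*(2*7)*(5*8)*3*4*9*10))%AC /= ez ex ey !add0r -addrA.
by rewrite [u1 + u2]addrC addrACA addrA.
Qed.

(** * Compatibility of the differential with the bracket and the cobracket *)

Section DGCompatibility.
Variables (k : fieldType) (C : lmodType k) (gr : int -> C -> Prop).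
Variables (d : C -> C) (Delta : C -> tensor C C).
Variables (pr : C -> C -> k) (m : int) (chi : C -> k^o).
Hypothesis char_k : [pchar k] =i pred0.
Hypothesis grC : grading gr.
Hypothesis Delta_linear : linear Delta.
Hypothesis Delta_degree :
  forall n a, gr n a -> exists s, sweedler gr n (Delta a) s.
Hypothesis d_linear : linear d.
Hypothesis d_degree : forall n x, gr n x -> gr (n - 1) (d x).
Hypothesis pr_bilin : bilin (pr : C -> C -> k^o).
Hypothesis pr_degree : forall i j a c, gr i a -> gr j c -> i + j != m -> pr a c = 0.
Hypothesis pr_sym : forall i j a c, gr i a -> gr j c ->
  pr a c = sgn (i * j + m) * pr c a.
Hypothesis pr_d : forall i j a c, gr i a -> gr j c ->
  pr (d a) c = sgn (i + 1) * pr a (d c).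
Hypothesis chi_degree : forall i a, gr i a -> i != m -> chi a = 0.
Local Notation letter := (int * C)%type.
Local Notation homog := (homog gr).
Local Notation CC := (CC gr).
Local Notation ccN := (ccN gr).
Local Notation Lgr := (@L_gr k C gr m).
Local Notation ldeg := (ldeg m).
Local Notation cop := (cop gr Delta).
Local Notation nab := (nab gr Delta d).
Local Notation dw := (dw gr d Delta).
Local Notation br := (br pr m grC).
Local Notation brw := (brw gr pr m).
Local Notation br_bilin := (br_bilinear m char_k grC pr_bilin).
Local Notation brE := (brE m char_k grC pr_bilin).
Local Notation cobr := (cobr pr m grC).
Local Notation cobr_lin := (cobr_lin m grC pr_bilin).
Local Notation cobrE := (cobrE m char_k grC pr_bilin).
Local Notation L_grading := (@L_grading k C gr m char_k grC).
Local Notation bL := (bL d Delta grC).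
Local Notation bLE := (bLE char_k grC Delta_linear Delta_degree d_linear d_degree).
Local Notation bL_linear := (bL_linear grC Delta_linear Delta_degree d_linear d_degree).
Local Notation eq_cop := (eq_cop (gr := gr) Delta_degree).
Local Notation eq_nab := (eq_nab (gr := gr) Delta_degree d_degree).
Local Notation eq_dw := (eq_dw (gr := gr) Delta_degree d_degree).
Implicit Types (u v w : seq letter).

(* chi measures the failure of the Frobenius relation: it vanishes for C = V,
   while for Coker(eta) it is the pairing with eta(1). *)
Hypothesis pr_frobenius : forall (Z : lmodType k) (G : letter -> Z) a c,
  gr a.1 a.2 -> gr c.1 c.2 -> hlin gr G ->
  cop (fun p q => pr a.2 p.2 *: G q) c + chi a.2 *: G c =
  cop (fun p q => sgn (m * p.1) *: (pr q.2 c.2 *: G p)) a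
  + sgn (m * (a.1 + 1)) *: (chi c.2 *: G a).

Section Local.
Variables (Z : lmodType k).

(* Here b acts on one of two letters a, c, and a letter of the result is paired with
   the other one; n is the degree of what separates them. *)
Definition loc1 (a c : letter) (n : int) (J : seq letter -> seq letter -> Z) : Z :=
  nab (fun W => spl W (fun P x Q =>
    sgn (wdeg P * wdeg Q + (x.1 - 1) * wdeg Q + (wdeg P + (x.1 - 1)) * n
         + (m + 1) * (x.1 - 1)) *: (pr x.2 c.2 *: J Q P))) a.

Definition loc2 (a c : letter) (n : int) (J : seq letter -> seq letter -> Z) : Z :=
  nab (fun W => spl W (fun P x Q =>
    sgn (wdeg Q * (a.1 - 1 + m + n)) *: (pr a.2 x.2 *: J P Q))) c.

Variables (a c : letter) (n : int) (J : seq letter -> seq letter -> Z).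
Hypothesis ga : gr a.1 a.2.
Hypothesis gc : gr c.1 c.2.
Hypothesis J1 : hlin gr (fun z => J [:: z] [::]).
Hypothesis J2 : hlin gr (fun z => J [::] [:: z]).

(** In [A1] and [A2] the letter c is paired with the first, respectively the second, factor of the
    coproduct of a; in [B2] and [B1] the letter a is paired with the first, respectively the second,
    factor of that of c. The Frobenius relation identifies [A1] with [B1] and [B2] with [A2], up to
    terms with [chi]. *)
Let A1 := cop (fun p q => pr c.2 p.2 *: J [:: q] [::]) a.
Let A2 := cop (fun p q => sgn (m * p.1) *: (pr q.2 c.2 *: J [::] [:: p])) a.
Let B1 := cop (fun p q => sgn (m * p.1) *: (pr q.2 a.2 *: J [:: p] [::])) c.
Let B2 := cop (fun p q => pr a.2 p.2 *: J [::] [:: q]) c.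

Let loc1E : loc1 a c n J =
  sgn ((a.1 - 1 + 1) * (n + m + 1)) *: (pr (d a.2) c.2 *: J [::] [::])
  + (sgn (1 + (m + (c.1 - 1)) * (a.1 - 1 + 1 + (c.1 - 1) + n) + (m + 1) * c.1 + m) *: A1
     + sgn (1 + m + (a.1 - 1 + 1) * (n + m + 1)) *: A2).
Proof.
rewrite /loc1 nabE /= wdeg_nil addr0; congr (_ + _); first by congr (_ *: _); ksign.
rewrite /A1 /A2 !copZ -copD -copN; apply: eq_cop => // p q gp gq epq.
have eq := parity_summand epq.
rewrite !wdegE !addr0 scalerDr opprD !sgn_scaleA !sgn_scaleN.
rewrite (pr_swap pr_sym _ gp gc) sgn_scaleA; congr (_ + _).
  by apply: (sgn_pr pr_degree _ gc gp) => ep; rewrite !parityE eq ep; parity_cases.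
apply: (sgn_pr pr_degree _ gq gc) => ep; rewrite !parityE ?ep eq; parity_cases.
Qed.

Let loc2E : loc2 a c n J =
  pr a.2 (d c.2) *: J [::] [::]
  + (sgn (1 + (c.1 - 1 + m + (a.1 - 1) + 1) + (a.1 - 1 + 1) * (m + (a.1 - 1) + 1) + m
          + m * (c.1 - 1 + m + (a.1 - 1))) *: B1
     + sgn (1 + m + (a.1 - 1) + (c.1 - 1 + 1 + m + (a.1 - 1)) * (a.1 - 1 + m + n)) *: B2).
Proof.
rewrite /loc2 nabE /= wdeg_nil mul0r sgn_scale0 addr0; congr (_ + _).
rewrite /B1 /B2 !copZ -copD -copN; apply: eq_cop => // p q gp gq epq.
have eq := parity_summand epq.
rewrite !wdegE sgn_scale0 !addr0 scalerDr opprD !sgn_scaleA !sgn_scaleN addrC.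
rewrite (pr_swap pr_sym _ ga gq) sgn_scaleA; congr (_ + _).
  apply: (sgn_pr pr_degree _ gq ga) => ep; rewrite !parityE ep.
  by move: ep; rewrite eq; parity_cases.
by apply: (sgn_pr pr_degree _ ga gp) => ep; rewrite !parityE eq ep; parity_cases.
Qed.

(** The terms with d cancel because d is skew-adjoint for the pairing up to sign ([pr_d]), and the
    coproduct terms cancel by the Frobenius relation. Only its defect remains on the right, where
    one of the two letters is absorbed by [chi] and the other is put back on one side or the other
    of the cut. Since J is arbitrary, this applies to the bracket and to the cobracket alike. *)
Lemma local_relation :
  loc1 a c n J + sgn ((a.1 - 1 + m + n) * (c.1 - 1 + m)) *: loc2 a c n J =
  chi c.2 *: (sgn (a.1 - 1 + n) *: J [:: a] [::]
              + sgn ((a.1 - 1 + 1) * (n + 1)) *: J [::] [:: a])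
  + chi a.2 *: (sgn (m + m * n) *: (sgn ((c.1 - 1) * n) *: J [:: c] [::]
                                    - J [::] [:: c])).
Proof.
(* As in [sgn_pr]: [chi] vanishes outside degree m, so the parity of the absorbed letter may be
   taken to be that of m. *)
have sgn_chi (b : letter) e e' (z : Z) : gr b.1 b.2 ->
    (parity b.1 = parity m -> parity e = parity e') ->
    sgn e *: (chi b.2 *: z) = sgn e' *: (chi b.2 *: z).
  move=> gb ee; case: (eqVneq b.1 m) => [eb|ne].
    by congr (_ *: _); apply: sgn_eq; apply: ee; rewrite eb.
  by rewrite (chi_degree gb ne) !scale0r !scaler0.
have F1 : A1 = B1 + sgn (m * (c.1 + 1)) *: (chi a.2 *: J [:: c] [::])
    - chi c.2 *: J [:: a] [::].
  by apply/eqP; rewrite eq_sym subr_eq eq_sym; apply/eqP; exact: (pr_frobenius gc ga J1).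
have F2 : B2 = A2 + sgn (m * (a.1 + 1)) *: (chi c.2 *: J [::] [:: a])
    - chi a.2 *: J [::] [:: c].
  by apply/eqP; rewrite eq_sym subr_eq eq_sym; apply/eqP; exact: (pr_frobenius ga gc J2).
rewrite loc1E loc2E F1 F2 (pr_d ga gc) -scalerA.
rewrite !(scalerDr, scalerBr) !sgn_scaleA.
rewrite ![chi _ *: (sgn _ *: _)]sgn_scaleC.
have gdc := d_degree gc.
rewrite (sgn_pr pr_degree (a := a) (c := (c.1 - 1, d c.2))
  (e' := 1 + (a.1 - 1 + m + n) * (c.1 - 1 + m))) //; last first.
  by move=> ec; move: ec; parity_cases.
rewrite assemble ?sgn_cancel //; try by parity_cases.
by rewrite !scalerN !sgn_scaleN; congr (_ + _ + (_ + _));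
  apply: sgn_chi => // eb; rewrite !parityE eb; parity_cases.
Qed.

End Local.

Section DerivationWords.
Variables (Z : lmodType k) (G : seq letter -> Z).
Hypothesis mG : mlin gr G.
Hypothesis cG : cyclic gr G.

Definition brG u v : Z := cyc1 u (fun a A => cyc1 v (fun c W =>
  sgn ((a.1 - 1) * wdeg A + (m + 1) * a.1) *: (pr a.2 c.2 *: G (A ++ W)))).

(* The terms in which b acts on a letter e of u other than the paired letter a. *)
Definition brd_in u v : Z := cyc1 u (fun a A => cyc1 v (fun c B =>
  sgn ((a.1 - 1) * wdeg A + (m + 1) * a.1) *: (pr a.2 c.2 *:
  spl A (fun X e Y => sgn (wdeg X * (wdeg Y + wdeg B + (e.1 - 1))) *:
    nab (fun W => G (W ++ Y ++ B ++ X)) e)))).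

(* The terms of the bracket of b(u) with v that pair c with a letter of b(a). *)
Definition brd_loc u v : Z := cyc1 u (fun a A => cyc1 v (fun c B =>
  sgn (m + 1) *: loc1 a c (wdeg A) (fun g1 g2 => G (g1 ++ A ++ g2 ++ B)))).

Lemma dw_brG u v : homog u -> homog v ->
  cyc1 u (fun a A => cyc1 v (fun c W =>
    sgn ((a.1 - 1) * wdeg A + (m + 1) * a.1) *: (pr a.2 c.2 *: dw G (A ++ W)))) =
  brd_in u v - sgn (ldeg u * ldeg v) *: brd_in v u.
Proof.
move=> hu hv; rewrite /brd_in sgn_scaleN [X in _ + _ *: X]cyc1_exchange cyc1Z -cyc1D.
apply: (eq_cyc1 hu) => a A ga hA eu; rewrite cyc1Z -cyc1D.
apply: (eq_cyc1 hv) => c B gc hB ev.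
rewrite /dw cyc1_cat [pr a.2 c.2 *: _]scalerDr scalerDr; congr (_ + _).
rewrite !splZ; apply: (eq_splh hB) => P e Q hP ge hQ eB.
rewrite (pr_swap pr_sym _ gc ga).
rewrite ![pr _ _ *: (sgn _ *: _)]sgn_scaleC !sgn_scaleA.
apply: (sgn_pr pr_degree _ ga gc) => ec.
by rewrite !ldegE eu ev eB !parityE ec; parity_cases.
Qed.

(** In the bracket of b(u) with v, the letter paired with c is either an untouched letter of u or
    one of the letters that b has produced; the first case is [brd_in] and the second [brd_loc]. *)
Lemma brG_dw u v : homog u -> homog v ->
  dw (fun w => brG w v) u = brd_in u v + brd_loc u v.
Proof.
move=> hu hv.
pose K (a : letter) X (e : letter) Y : Z := cyc1 v (fun c B =>
  sgn ((a.1 - 1) * (wdeg X + (e.1 - 1) + wdeg Y) + (m + 1) * a.1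
       + wdeg X * (wdeg Y + wdeg B + (e.1 - 1))) *:
  (pr a.2 c.2 *: nab (fun W => G (W ++ Y ++ B ++ X)) e)).
have -> : brd_in u v = cyc2 u K.
  apply: (eq_cyc1 hu) => a A ga hA eu.
  rewrite -cyc1_spl_exchange; apply: (eq_cyc1 hv) => c B gc hB ev.
  rewrite !splZ; apply: (eq_splh hA) => X e Y hX ge hY eA.
  rewrite ![pr _ _ *: (sgn _ *: _)]sgn_scaleC !sgn_scaleA.
  by rewrite eA; congr (_ *: _); ksign.
rewrite addrC [X in _ + X]cyc2_sym /brd_loc -cyc1D.
apply: (eq_cyc1 hu) => a A ga hA eu.
transitivity (nab (fun W => spl W (fun P x Q => cyc1 v (fun c B =>
     sgn (wdeg P * (wdeg Q + wdeg A + (x.1 - 1)) + (x.1 - 1) * wdeg (Q ++ A ++ P)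
       + (m + 1) * x.1) *: (pr x.2 c.2 *: G ((Q ++ A ++ P) ++ B))))) a +
  nab (fun W => spl A (fun X e Y => cyc1 v (fun c B =>
     sgn ((wdeg W + wdeg X) * (wdeg Y + (e.1 - 1)) + (e.1 - 1) * wdeg (Y ++ W ++ X)
       + (m + 1) * e.1) *: (pr e.2 c.2 *: G ((Y ++ W ++ X) ++ B))))) a).
  rewrite -nabD; apply: (eq_nab ga) => W hW dW; rewrite /brG cyc1_cat.
  congr (_ + _); [apply: (eq_splh hW) | apply: (eq_splh hA)] => P x Q hP gx hQ eW;
    rewrite cyc1Z; apply: (eq_cyc1 hv) => c B gc hB ev; by rewrite !sgn_scaleA addrA.
congr (_ + _).
  under [X in nab X]eq_fun do rewrite -cyc1_spl_exchange.
  rewrite nab_cyc1; apply: (eq_cyc1 hv) => c B gc hB ev.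
  rewrite /loc1 nabZ; apply: (eq_nab ga) => W hW dW; rewrite splZ.
  apply: (eq_splh hW) => P x Q hP gx hQ eW.
  rewrite sgn_scaleA -!catA; congr (_ *: _); apply: sgn_eq.
  by rewrite !wdegE; parity_cases.
rewrite nab_spl; apply: (eq_splh hA) => X e Y hX ge hY eA.
rewrite nab_cyc1 cyc1Z; apply: (eq_cyc1 hv) => c B gc hB ev.
rewrite !nabZ; apply: (eq_nab ga) => W hW dW.
have h : homog (W ++ X ++ B) by do 2?[apply/homog_cat; split=> //].
rewrite -!catA (cG hY h) -!catA.
rewrite ![pr _ _ *: (sgn _ *: _)]sgn_scaleC !sgn_scaleA.
by congr (_ *: _); apply: sgn_eq; rewrite !wdegE dW; parity_cases.
Qed.

(** For fixed a and c the two sums are [loc1] and, after a rotation of the final word, [loc2]. They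
    are compared with A as the separating word and with J inserting its arguments before A and
    between A and B. *)
Lemma brd_locE u v : homog u -> homog v ->
  brd_loc u v - sgn (ldeg u * ldeg v) *: brd_loc v u =
  cyc1 u (fun a A => cyc1 v (fun c B => sgn (m + 1) *: (
    chi c.2 *: (sgn (a.1 - 1 + wdeg A) *: G (a :: A ++ B)
                + sgn ((a.1 - 1 + 1) * (wdeg A + 1)) *: G (A ++ a :: B))
    + chi a.2 *: (sgn (m + m * wdeg A) *: (sgn ((c.1 - 1) * wdeg A) *: G (c :: A ++ B)
                                           - G (A ++ c :: B)))))).
Proof.
move=> hu hv; rewrite sgn_scaleN [X in _ + _ *: X]cyc1_exchange cyc1Z -cyc1D.
apply: (eq_cyc1 hu) => a A ga hA eu; rewrite cyc1Z -cyc1D.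
apply: (eq_cyc1 hv) => c B gc hB ev.
pose J g1 g2 := G (g1 ++ A ++ g2 ++ B).
have hAB : homog (A ++ B) by apply/homog_cat.
have J1 : hlin gr (fun z => J [:: z] [::]) by exact: (mlin_head mG hAB).
have J2 : hlin gr (fun z => J [::] [:: z]).
  by move=> i x z z' gz gz'; apply: mG.
rewrite -(local_relation (wdeg A) ga gc J1 J2) [RHS]scalerDr; congr (_ + _).
rewrite !sgn_scaleA /loc1 /loc2 nabZ.
apply: (etrans _ (esym (nabZ _ _ _ _ _ _))); apply: (eq_nab gc) => W hW dW.
rewrite !splZ; apply: (eq_splh hW) => P x Q hP gx hQ eW.
have h1 : homog (Q ++ B) by apply/homog_cat.
have h2 : homog (P ++ A) by apply/homog_cat.
rewrite /J (pr_swap pr_sym _ gx ga) (catA Q) (catA P A) (cG h1 h2).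
rewrite ![pr _ _ *: (sgn _ *: _)]sgn_scaleC !sgn_scaleA.
apply: (sgn_pr pr_degree _ ga gx) => ex.
by rewrite !ldegE eu ev !wdegE !parityE ex; parity_cases.
Qed.

(** When [chi] absorbs c, what is left is u cut open and joined to B. Successive cuts of u differ by
    one letter carried from one end to the other, so the sum over the cuts telescopes; the two
    extreme cuts give the same word u ++ B with the same sign. The terms where a is absorbed behave
    likewise, with v cut open and joined to A. *)
Lemma brd_loc0 u v : homog u -> homog v ->
  brd_loc u v - sgn (ldeg u * ldeg v) *: brd_loc v u = 0.
Proof.
move=> hu hv; rewrite brd_locE //.
pose F (a : letter) A (c : letter) B : Z := sgn (m + 1) *: (chi c.2 *:
  (sgn (a.1 - 1 + wdeg A) *: G (a :: A ++ B)
   + sgn ((a.1 - 1 + 1) * (wdeg A + 1)) *: G (A ++ a :: B))).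
pose H (a : letter) A (c : letter) B : Z := sgn (m + 1) *: (chi a.2 *: (sgn (m + m * wdeg A) *:
  (sgn ((c.1 - 1) * wdeg A) *: G (c :: A ++ B) - G (A ++ c :: B)))).
transitivity (cyc1 v (fun c B => cyc1 u (fun a A => F a A c B)) +
              cyc1 u (fun a A => cyc1 v (fun c B => H a A c B))).
  rewrite (cyc1_exchange v u (fun c B a A => F a A c B)) -cyc1D.
  apply: (eq_cyc1 hu) => a A _ _ _.
  by rewrite -cyc1D; apply: (eq_cyc1 hv) => c B _ _ _; rewrite -scalerDr.
rewrite [X in X + _](_ : _ = 0); last first.
  rewrite -[RHS](cyc1_0 _ v); apply: (eq_cyc1 hv) => c B gc hB ev.
  rewrite /F -!cyc1Z [X in chi _ *: X](_ : _ = 0) ?scaler0 //.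
  pose J P Q : Z := sgn (wdeg P * wdeg Q + wdeg P + wdeg Q) *: G (Q ++ P ++ B).
  transitivity (- spl u (fun P a Q => J (rcons P a) Q - J P (a :: Q))).
    rewrite splN; apply: (eq_splh hu) => P a Q hP ga hQ eu.
    rewrite opprB /J scalerDr !sgn_scaleA sgn_scaleN cat_rcons -catA.
    by rewrite !wdegE -catA; congr (_ *: _ + _ *: _); ksign.
  rewrite spl_telescope /J !wdegE /= opprB.
  by apply/eqP; rewrite subr_eq0; apply/eqP; congr (_ *: _); ksign.
rewrite add0r -[RHS](cyc1_0 _ u); apply: (eq_cyc1 hu) => a A ga hA eu.
rewrite /H -!cyc1Z [X in sgn (m + m * _) *: X](_ : _ = 0) ?scaler0 //.
pose J P Q : Z := sgn (wdeg P * wdeg Q) *: G (A ++ Q ++ P).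
transitivity (spl v (fun P c Q => J (rcons P c) Q - J P (c :: Q))).
  apply: (eq_splh hv) => P c Q hP gc hQ ev.
  have h1 : homog [:: c] by apply: homog1.
  have h2 : homog (A ++ Q ++ P) by do 2?[apply/homog_cat; split=> //].
  rewrite scalerBr /J sgn_scaleA -cats1 (cG h1 h2) sgn_scaleA -!catA.
  by rewrite !wdegE; congr (_ *: _ - _ *: _); ksign.
by rewrite spl_telescope /J !wdegE mulr0 mul0r cats0 subrr.
Qed.

End DerivationWords.

Let ccN_mlin := @ccN_mlin k C gr grC.
Let ccN_cyclic : cyclic gr ccN := @ccN_rot k C gr.
Local Notation bIN := (brd_in ccN).
Local Notation bLOC := (brd_loc ccN).

Let br_bLl u v : homog u -> homog v ->
  br (bL (ccN u)) (ccN v) = bIN u v + bLOC u v.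
Proof.
move=> hu hv; have [l1 l2] := br_bilin.
rewrite bLE // (dw_linear _ _ _ _ _ (l2 (ccN v))) -(brG_dw ccN_cyclic hu hv).
by apply: eq_dw => // w hw _; rewrite brE.
Qed.

Let br_bL_signs (Z : lmodType k) (i j : int) (x y z t : Z) :
  x - sgn (i * j) *: y = 0 ->
  z - sgn (i * j) *: t = z + x + sgn i *: (- sgn (i * (j - 1)) *: (t + y)).
Proof.
move=> xy; rewrite sgnS sgn_scaleA -(subrK (sgn (i * j) *: y) x) xy add0r.
rewrite [X in X *: (t + y)](_ : _ = - sgn (i * j)); last by rewrite sgnS; ksign.
by rewrite scaleNr scalerDr opprD addrACA subrr addr0.
Qed.

Lemma br_bL i x y : Lgr i x -> bL (br x y) = br (bL x) y + sgn i *: br x (bL y).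
Proof.
have [l1 l2] := br_bilin; have lb := bL_linear.
move=> hx; move: x hx; apply: eq_on_L_gr => [||u hu <-].
- exact: (lin_comp lb (l2 y)).
- exact: (lin_add (lin_comp (l2 y) lb) (lin_scale _ (l2 _))).
move: y; apply: eq_on_CC => [||v hv].
- exact: (lin_comp lb (l1 _)).
- exact: (lin_add (l1 _) (lin_scale _ (lin_comp (l1 _) lb))).
have e1 := br_bLl hu hv.
(* The action of b on the second argument is reduced to the first by skew symmetry, with the degree
   of v lowered by one. *)
have e2 : br (ccN u) (bL (ccN v)) =
    - sgn (ldeg u * (ldeg v - 1)) *: (bIN v u + bLOC v u).
  rewrite -(br_bLl hv hu); apply: (br_skew_L char_k grC pr_bilin pr_degree pr_sym).
    exact: L_gr_ccN.
  exact: (bL_degree char_k grC Delta_linear Delta_degree d_linear d_degree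
    (L_gr_ccN m hv)).
have e3 : bL (br (ccN u) (ccN v)) = bIN u v - sgn (ldeg u * ldeg v) *: bIN v u.
  rewrite (brE hu hv) -(dw_brG _ hu hv).
  rewrite /brw (cyc1_linear _ _ lb); apply: (eq_cyc1 hu) => a A ga hA eu.
  rewrite (cyc1_linear _ _ lb); apply: (eq_cyc1 hv) => c W gc hW ev.
  rewrite !(linear_funZ lb) bLE //; exact/homog_cat.
rewrite e1 e2 e3; apply: br_bL_signs.
exact: (brd_loc0 ccN_mlin ccN_cyclic hu hv).
Qed.

(** * The coderivation property of the differential *)

Section CoderivationWords.
Variables (Z : lmodType k) (T : CC -> CC -> Z).
Hypothesis T_bilin : bilin T.
Local Notation H := (fun a X c Y =>
  sgn ((a.1 - 1) * wdeg X + a.1 + m + 1) *: (pr a.2 c.2 *: T (ccN X) (ccN Y))).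

Let J X Y g1 g2 : Z := T (ccN (g1 ++ X)) (ccN (g2 ++ Y)).

(* Two cut letters which both come from b(a) enclose an empty word. *)
Lemma cobd_two a A : nab (fun W => spl W (fun P e B => spl B (fun X f Y =>
  cut H P e X f (Y ++ A)))) a = 0.
Proof.
have [t1 t2] := T_bilin.
rewrite nabE /= addr0 sub0r -copN -[RHS](scale0r (cop (fun _ _ => 0) a)) copZ.
apply: (congr1 (fun F => cop F a)); apply/funext=> p; apply/funext=> q.
rewrite /cut (@ccN_nil k C gr) (linear_fun0 (t1 _)) (linear_fun0 (t2 _)).
by rewrite !scaler0 !addr0 scaler0 oppr0.
Qed.

(** One cut letter is produced by b and the other is an untouched letter. The reading starts at
    either of them, which yields [loc1] and [loc2]; the separating degree is [m + wdeg X] here,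
    against [wdeg A] for the bracket. *)
Lemma cobd_mixedE w : homog w ->
  cyc1 w (fun a A => nab (fun W => spl W (fun P e B => spl A (fun X f Y =>
    cut H P e (B ++ X) f Y))) a) =
  cyc2 w (fun a X c Y => sgn m *: (loc1 a c (m + wdeg X) (J X Y)
    + sgn ((a.1 - 1 + m + (m + wdeg X)) * (c.1 - 1 + m)) *:
      loc2 a c (m + wdeg X) (J X Y))).
Proof.
move=> hw; have [t1 t2] := T_bilin.
pose F1 (a : letter) X (f : letter) Y := nab (fun W => spl W (fun P e B =>
  sgn (wdeg P * (e.1 - 1 + (wdeg B + wdeg X) + (f.1 - 1) + wdeg Y)
       + (e.1 - 1) * (wdeg B + wdeg X) + e.1 + m + 1) *:
  (pr e.2 f.2 *: T (ccN (B ++ X)) (ccN (Y ++ P))))) a.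
pose F2 (a : letter) X (f : letter) Y := nab (fun W => spl W (fun P e B =>
  sgn ((wdeg P + (e.1 - 1) + (wdeg B + wdeg X)) * (f.1 - 1 + wdeg Y)
       + (f.1 - 1) * (wdeg Y + wdeg P) + f.1 + m + 1) *:
  (pr f.2 e.2 *: T (ccN (Y ++ P)) (ccN (B ++ X))))) a.
transitivity (cyc2 w F1 + cyc2 w F2).
  rewrite -cyc2D; apply: (eq_cyc1 hw) => a A ga hA ew.
  transitivity (nab (fun W => spl A (fun X f Y => spl W (fun P e B =>
    cut H P e (B ++ X) f Y))) a).
    by apply: (eq_nab ga) => W hW dW; rewrite spl_exchange.
  rewrite nab_spl; apply: (eq_splh hA) => X f Y hX gf hY eA.
  rewrite -nabD; apply: (eq_nab ga) => W hW dW.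
  rewrite -splD; apply: (eq_splh hW) => P e B hP ge hB eW.
  rewrite /cut !sgn_scaleA.
  by congr (_ + _); congr (_ *: _); word_sign.
rewrite [X in _ + X]cyc2_sym -cyc2D.
apply: (eq_cyc2 hw) => a X c Y ga hX gc hY ew.
rewrite [RHS]scalerDr sgn_scaleA; congr (_ + _).
  rewrite /loc1; apply: (etrans _ (esym (nabZ _ _ _ _ _ _))).
  apply: (eq_nab ga) => W hW dW; rewrite splZ.
  apply: (eq_splh hW) => P x Q hP gx hQ eW.
  rewrite /J (ccN_rot hY hP) (linear_funZ (t1 _)).
  rewrite ![pr _ _ *: (sgn _ *: _)]sgn_scaleC !sgn_scaleA.
  by apply: (sgn_pr pr_degree _ gx gc) => ec; rewrite !parityE ec; parity_cases.
rewrite /loc2 /F2; apply: (etrans _ (esym (nabZ _ _ _ _ _ _))).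
apply: (etrans (nabZ _ _ _ _ _ _)); apply: (eq_nab gc) => W hW dW.
rewrite !splZ; apply: (eq_splh hW) => P x Q hP gx hQ eW.
have ec : parity c.1 = ~~ (parity (wdeg P) (+) parity (x.1 - 1) (+) parity (wdeg Q)
    (+) true).
  have : parity (wdeg W) = parity (c.1 - 1 - 1) by rewrite dW.
  by rewrite eW !parityE; parity_cases.
rewrite /J (ccN_rot hX hP) (linear_funZ (t2 _)).
rewrite ![pr _ _ *: (sgn _ *: _)]sgn_scaleC !sgn_scaleA.
apply: (sgn_pr pr_degree _ ga gx) => ex.
by rewrite !parityE ec !parityE ex; parity_cases.
Qed.

(** Once [chi] has absorbed one letter, the other letter of the pair is put back into one of the two
    components of the cut, and the sum over its positions telescopes. Unlike for the bracket, the
    end terms vanish separately: one of their components is the empty cyclic word. *)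
Lemma cobd_mixed w : homog w ->
  cyc1 w (fun a A => nab (fun W => spl W (fun P e B => spl A (fun X f Y =>
    cut H P e (B ++ X) f Y))) a) = 0.
Proof.
move=> hw; rewrite cobd_mixedE //; have [t1 t2] := T_bilin.
pose F (a : letter) X (c : letter) Y := chi c.2 *:
  (sgn m *: (sgn (a.1 - 1 + (m + wdeg X)) *: J X Y [:: a] [::]
   + sgn ((a.1 - 1 + 1) * (m + wdeg X + 1)) *: J X Y [::] [:: a])).
pose G (a : letter) X (c : letter) Y := chi a.2 *:
  (sgn m *: (sgn (m + m * (m + wdeg X)) *:
    (sgn ((c.1 - 1) * (m + wdeg X)) *: J X Y [:: c] [::] - J X Y [::] [:: c]))).
transitivity (cyc2 w F + cyc2 w G).
  rewrite -cyc2D; apply: (eq_cyc2 hw) => a X c Y ga hX gc hY ew.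
  have ctx u : homog u -> mlin gr (fun W => ccN (W ++ u)).
    exact: (mlin_ctx (A := [::]) ccN_mlin (homog_nil gr)).
  have J1 : hlin gr (fun z => J X Y [:: z] [::]).
    exact: (mlin_head (mlin_lin (t2 (ccN Y)) (ctx X hX)) (homog_nil gr)).
  have J2 : hlin gr (fun z => J X Y [::] [:: z]).
    exact: (mlin_head (mlin_lin (t1 (ccN X)) (ctx Y hY)) (homog_nil gr)).
  rewrite (local_relation (m + wdeg X) ga gc J1 J2) scalerDr.
  by congr (_ + _); rewrite scaleCA.
(* After this exchange the letter absorbed by [chi] is a in both families, and the remaining letter
   c runs over the word A. *)
rewrite [X in X + _]cyc2_sym -cyc2D -[RHS](cyc1_0 _ w).
apply: (eq_cyc1 hw) => a A ga hA ew.
rewrite splD [X in X + _](_ : _ = 0) ?add0r.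
  pose Psi X Y : Z := sgn (m * wdeg X) *: T (ccN X) (ccN Y).
  transitivity (chi a.2 *: (sgn m *: spl A (fun X c Y =>
      Psi (rcons X c) Y - Psi X (c :: Y)))); last first.
    rewrite spl_telescope /Psi (@ccN_nil k C gr).
    by rewrite (linear_fun0 (t1 _)) (linear_fun0 (t2 _)) !scaler0 subrr !scaler0.
  rewrite !splZ; apply: (eq_splh hA) => X c Y hX gc hY eA.
  have hc : homog [:: c] by apply: homog1.
  rewrite /G /J /Psi; congr (_ *: (_ *: _)); rewrite -cat1s (ccN_rot hc hX) cats1.
  rewrite (linear_funZ (t2 _)) scalerBr !sgn_scaleA.
  by rewrite !wdegE /=; congr (_ *: _ - _ *: _); ksign.
pose Psi X Y : Z := sgn ((a.1 - 1 + wdeg X) * wdeg Y + wdeg Y) *: T (ccN Y) (ccN X).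
transitivity (chi a.2 *: - spl A (fun X c Y => Psi (rcons X c) Y - Psi X (c :: Y))).
  rewrite splN splZ; apply: (eq_splh hA) => X c Y hX gc hY eA.
  have hc : homog [:: c] by apply: homog1.
  rewrite opprB /F /J /Psi /=; case: (eqVneq a.1 m) => [ea|ne]; last first.
    by rewrite (chi_degree ga ne) !scale0r scaler0.
  rewrite scaleCA; congr (_ *: _).
  rewrite -(cat1s c X) (ccN_rot hc hX) cats1.
  rewrite (linear_funZ (t1 _)) !scalerDr !sgn_scaleA sgn_scaleN ea.
  by rewrite !wdegE /=; congr (_ *: _ + _ *: _); ksign.
rewrite spl_telescope /Psi (@ccN_nil k C gr).
by rewrite (linear_fun0 (t1 _)) (linear_fun0 (t2 _)) !scaler0 subrr oppr0 scaler0.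
Qed.

(** Both cut letters are untouched by b. As in [brcob_inE], reading from a cut letter places the
    letter hit by b on one of the two arcs, and the sum over its positions is b of that arc. *)
Lemma cobd_outE w : homog w ->
  cyc1 w (fun a A => nab (fun W => spl A (fun P e B => spl B (fun X f Y =>
    cut H (W ++ P) e X f Y))) a) =
  cyc2 w (fun a X c Y => sgn ((a.1 - 1) * wdeg X + a.1 + m + 1) *:
    (pr a.2 c.2 *: (T (dw ccN X) (ccN Y) + sgn (ldeg X) *: T (ccN X) (dw ccN Y)))).
Proof.
move=> hw; have [t1 t2] := T_bilin.
pose K1 (a : letter) P (e : letter) X (f : letter) Y : Z := nab (fun W =>
  sgn ((wdeg W + wdeg P) * (e.1 - 1 + wdeg X + (f.1 - 1) + wdeg Y)
       + (e.1 - 1) * wdeg X + e.1 + m + 1) *: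
  (pr e.2 f.2 *: T (ccN X) (ccN (Y ++ W ++ P)))) a.
pose K2 (a : letter) P (e : letter) X (f : letter) Y : Z := nab (fun W =>
  sgn ((wdeg W + wdeg P + (e.1 - 1) + wdeg X) * (f.1 - 1 + wdeg Y)
       + (f.1 - 1) * (wdeg Y + wdeg W + wdeg P) + f.1 + m + 1) *:
  (pr f.2 e.2 *: T (ccN (Y ++ W ++ P)) (ccN X))) a.
transitivity (cyc3 w K1 + cyc3 w K2).
  rewrite -cyc3D; apply: (eq_cyc1 hw) => a A ga hA ew.
  rewrite nab_spl; apply: (eq_splh hA) => P e B hP ge hB eA.
  rewrite nab_spl; apply: (eq_splh hB) => X f Y hX gf hY eB.
  rewrite -nabD; apply: (eq_nab ga) => W hW dW.
  by rewrite /cut !sgn_scaleA; congr (_ + _); congr (_ *: _); word_sign.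
pose L1 (e : letter) X (f : letter) Y (a : letter) P : Z := nab (fun W =>
  sgn ((e.1 - 1) * wdeg X + e.1 + m + 1 + ldeg X + wdeg Y * (wdeg P + (a.1 - 1))) *:
  (pr e.2 f.2 *: T (ccN X) (ccN (W ++ P ++ Y)))) a.
pose L2 (e : letter) P (a : letter) Q (f : letter) Y : Z := nab (fun W =>
  sgn ((e.1 - 1) * (wdeg P + (a.1 - 1) + wdeg Q) + e.1 + m + 1
       + wdeg P * (wdeg Q + (a.1 - 1))) *:
  (pr e.2 f.2 *: T (ccN (W ++ Q ++ P)) (ccN Y))) a.
transitivity (cyc3 w L2 + cyc3 w L1).
  rewrite [RHS]addrC; congr (_ + _).
    rewrite [RHS](cyc3_rot _ hw) [RHS](cyc3_rot _ hw).
    apply: (eq_cyc3 hw) => a P e X f Y ga hP ge hX gf hY ew.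
    rewrite sgn_scaleA; apply: (etrans _ (esym (nabZ _ _ _ _ _ _))).
    apply: (eq_nab ga) => W hW dW.
    have hWP : homog (W ++ P) by apply/homog_cat.
    rewrite (ccN_rot hY hWP) -catA (linear_funZ (t1 _)).
    rewrite ![pr _ _ *: (sgn _ *: _)]sgn_scaleC !sgn_scaleA.
    apply: (sgn_pr pr_degree _ ge gf) => ef.
    by rewrite !ldegE !wdegE dW !parityE ?ef; parity_cases.
  rewrite [RHS](cyc3_rot _ hw).
  apply: (eq_cyc3 hw) => a P e X f Y ga hP ge hX gf hY ew.
  apply: (etrans _ (esym (nabZ _ _ _ _ _ _))); apply: (eq_nab ga) => W hW dW.
  have hWP : homog (W ++ P) by apply/homog_cat.
  rewrite (ccN_rot hY hWP) -catA (linear_funZ (t2 _)).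
  rewrite ![pr _ _ *: (sgn _ *: _)]sgn_scaleC !sgn_scaleA.
  apply: (sgn_pr pr_degree _ gf ge) => ef.
  by rewrite !wdegE dW !parityE ?ef; parity_cases.
rewrite -[X in X + _]cyc3_sub.
rewrite -[cyc3 w L1]/(cyc2 w (fun e X f B => spl B (fun Y a P => L1 e X f Y a P))).
rewrite -cyc2D; apply: (eq_cyc2 hw) => e A f B ge hA gf hB ew.
rewrite [pr e.2 f.2 *: _]scalerDr scalerDr; congr (_ + _).
  rewrite (dw_linear _ _ _ _ _ (t2 (ccN B))) /dw [cyc1 A _]/cyc1 !splZ.
  apply: (eq_splh hA) => P a Q hP ga hQ eA; rewrite !nabZ.
  apply: (eq_nab ga) => W hW dW.
  rewrite ![pr _ _ *: (sgn _ *: _)]sgn_scaleC !sgn_scaleA.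
  by rewrite eA; congr (_ *: _); word_sign.
rewrite (dw_linear _ _ _ _ _ (t1 (ccN A))) /dw [cyc1 B _]/cyc1 !splZ.
apply: (eq_splh hB) => Y a P hY ga hP eB; rewrite !nabZ.
apply: (eq_nab ga) => W hW dW.
rewrite ![pr _ _ *: (sgn _ *: _)]sgn_scaleC !sgn_scaleA.
by congr (_ *: _); word_sign.
Qed.

Lemma dw_cobw w : homog w ->
  dw (cobw pr m T) w =
  cyc2 w (fun a X c Y => sgn ((a.1 - 1) * wdeg X + a.1 + m + 1) *:
    (pr a.2 c.2 *: (T (dw ccN X) (ccN Y) + sgn (ldeg X) *: T (ccN X) (dw ccN Y)))).
Proof.
move=> hw; rewrite -(cobd_outE hw) -[RHS]add0r -(cobd_mixed hw) -!cyc1D.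
apply: (eq_cyc1 hw) => a A ga hA ew.
rewrite -[X in _ = X]add0r -(cobd_two a A) -!nabD.
by apply: (eq_nab ga) => W hW dW; rewrite /cobw cyc2_cat addrA.
Qed.

End CoderivationWords.
Lemma cobr_bL n x s e :
    sweedler Lgr (n + e) (cobr x) s ->
  cobr (bL x) = \sum_(p <- s)
    (bL p.1.2 ⊗ p.2.2 + sgn p.1.1 *: (p.1.2 ⊗ bL p.2.2)).
Proof.
move=> ss; have [t1 t2] := tens_bilin CC CC; have lb := bL_linear.
pose F (p q : int * CC) := bL p.2 ⊗ q.2 + sgn p.1 *: (p.2 ⊗ bL q.2).
have hF : hbilin Lgr Lgr F.
  apply: hbilin_add.
    apply: (hbilin_bilin _ _ (f := fun p q => bL p ⊗ q)).
    by split=> [p|q]; [exact: t1 | exact: (lin_comp (t2 q) lb)].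
  apply: (hbilin_scale _ _ (fun i _ => sgn i) (f := fun p q => p ⊗ bL q)).
  by split=> [p|q]; [exact: (lin_comp (t1 p) lb) | exact: t2].
rewrite (sweedler_hlift2 L_grading hF ss).
move: x {ss}; apply: eq_on_CC => [||w hw].
- exact: (lin_comp cobr_lin lb).
- exact: (lin_comp (hlift2_linear L_grading L_grading hF) cobr_lin).
rewrite (hlift2_cobr char_k grC pr_bilin hF hw) bLE // (dw_linear _ _ _ _ _ cobr_lin).
transitivity (dw (cobw pr m (@tens k CC CC)) w).
  by apply: eq_dw => // u hu _; apply: cobrE.
rewrite (dw_cobw (tens_bilin CC CC) hw).
apply: (eq_cyc2 hw) => a X c Y ga hX gc hY ew.
by rewrite /F -(bLE hX) -(bLE hY).
Qed.

End DGCompatibility.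

(** * The Lie bialgebra of a DG coalgebra with a pairing *)

Section Assembly.
Variables (k : fieldType) (C : lmodType k) (gr : int -> C -> Prop).
Variables (d : C -> C) (Delta : C -> tensor C C).
Variables (pr : C -> C -> k) (m : int) (chi : C -> k^o).
Hypothesis char_k : [pchar k] =i pred0.
Hypothesis C_dg : dg_space gr d.
Hypothesis Delta_linear : linear Delta.
Hypothesis Delta_degree :
  forall n a, gr n a -> exists s, sweedler gr n (Delta a) s.
Local Notation letter := (int * C)%type.
Local Notation cop := (cop gr Delta).
Hypothesis cop_coassoc : forall (Z : lmodType k) (K : letter -> letter -> letter -> Z) a,
  (forall x y, gr x.1 x.2 -> gr y.1 y.2 -> hlin gr (K x y)) ->
  (forall x z, gr x.1 x.2 -> gr z.1 z.2 -> hlin gr (fun y => K x y z)) ->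
  (forall y z, gr y.1 y.2 -> gr z.1 z.2 -> hlin gr (fun x => K x y z)) ->
  gr a.1 a.2 ->
  cop (fun p q => cop (fun x y => K x y q) p) a = cop (fun p q => cop (K p) q) a.
Hypothesis cop_coleibniz : forall (Z : lmodType k) (F : letter -> letter -> Z) a,
  hbilin gr gr F -> gr a.1 a.2 ->
  cop F (a.1 - 1, d a.2) =
  cop (fun p q => F (p.1 - 1, d p.2) q + sgn p.1 *: F p (q.1 - 1, d q.2)) a.
Hypothesis pr_bilin : bilin (pr : C -> C -> k^o).
Hypothesis pr_degree : forall i j a c, gr i a -> gr j c -> i + j != m -> pr a c = 0.
Hypothesis pr_sym : forall i j a c, gr i a -> gr j c ->
  pr a c = sgn (i * j + m) * pr c a.
Hypothesis pr_d : forall i j a c, gr i a -> gr j c ->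
  pr (d a) c = sgn (i + 1) * pr a (d c).
Hypothesis chi_degree : forall i a, gr i a -> i != m -> chi a = 0.
Hypothesis pr_frobenius : forall (Z : lmodType k) (G : letter -> Z) a c,
  gr a.1 a.2 -> gr c.1 c.2 -> hlin gr G ->
  cop (fun p q => pr a.2 p.2 *: G q) c + chi a.2 *: G c =
  cop (fun p q => sgn (m * p.1) *: (pr q.2 c.2 *: G p)) a
  + sgn (m * (a.1 + 1)) *: (chi c.2 *: G a).

Let grC := dg_grading C_dg.
Let d_linear := dg_linear C_dg.
Let d_degree := dg_degree C_dg.
Let d_square := dg_square C_dg.
Local Notation bL := (bL d Delta grC).
Local Notation br := (br pr m grC).
Local Notation cobr := (cobr pr m grC).
Local Notation Lgr := (@L_gr k C gr m).

Lemma L_dg_space : dg_space Lgr bL.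
Proof.
split; first exact: L_grading.
- exact: (bL_linear grC Delta_linear Delta_degree d_linear d_degree).
- exact: (bL_degree char_k grC Delta_linear Delta_degree d_linear d_degree).
- exact: (bL_square char_k grC Delta_linear Delta_degree d_linear d_degree d_square
    cop_coassoc cop_coleibniz).
Qed.

Lemma L_lie_algebra : lie_algebra Lgr br.
Proof.
split; first exact: (br_bilinear m char_k grC pr_bilin).
- exact: (br_degree_L char_k grC pr_bilin pr_degree).
- exact: (br_skew_L char_k grC pr_bilin pr_degree pr_sym).
- exact: (br_jacobi_L char_k grC pr_bilin pr_degree pr_sym).
Qed.

Lemma L_lie_coalgebra : lie_coalgebra Lgr cobr (2 * (2 - m)).
Proof.
split; first exact: (cobr_lin m grC pr_bilin).
- exact: (cobr_degree char_k grC pr_bilin pr_degree).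
- by move=> n x s hx hs; apply: (cobr_skew_L char_k pr_bilin pr_degree pr_sym hx hs).
- by move=> n x s r hx hs hr; apply: (cobr_jacobi_L char_k pr_bilin pr_degree pr_sym hx hs hr).
Qed.

Lemma L_involutive_dg_lie_bialgebra :
  involutive_dg_lie_bialgebra Lgr bL br cobr (2 * (2 - m)).
Proof.
split; [by exists (2 - m) | exact: L_dg_space | exact: L_lie_algebra |
  exact: L_lie_coalgebra | | | |].
- move=> i j x y s t; exact: (cobr_br char_k pr_bilin pr_degree pr_sym).
- exact: (br_cobr char_k grC pr_bilin pr_degree pr_sym).
- move=> i x y; exact: (br_bL char_k grC Delta_linear Delta_degree d_linear d_degree
    pr_bilin pr_degree pr_sym pr_d chi_degree pr_frobenius).
- move=> n x s _; exact: (cobr_bL char_k Delta_linear Delta_degree d_linear d_degree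
    pr_bilin pr_degree pr_sym pr_d chi_degree pr_frobenius).
Qed.

(** The coproduct and the pairing enter through their formal properties, with the defect [chi] of
    the Frobenius relation as a parameter. Both cases of the theorem are instances: V with [chi]
    equal to 0, and the coideal with [chi] equal to [coaug_pairing]. *)
Theorem CC_involutive : CC_involutive_dg_lie_bialgebra gr d Delta pr m.
Proof.
have lb := hochb_linear grC Delta_linear Delta_degree d_linear d_degree.
pose b : {linear tensor_powers C -> tensor_powers C} :=
  HB.pack (hochb d Delta grC) (GRing.isLinear.Build k (tensor_powers C)
    (tensor_powers C) _ (hochb d Delta grC) lb).
exists b, bL, br, cobr; split.
- exact: (hochb_differential grC Delta_linear Delta_degree d_linear d_degree).
- exact: (bL_val char_k grC Delta_linear Delta_degree d_linear d_degree).
- exact: (br_bracket_formula m char_k grC pr_bilin).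
- exact: (cobr_cobracket_formula char_k grC pr_bilin pr_degree pr_sym).
- exact: L_involutive_dg_lie_bialgebra.
Qed.

End Assembly.

(** * Open Frobenius algebras *)

Section TensorThreeLift.
Variables (k : fieldType) (A B D Z : lmodType k) (M : A -> B -> D -> Z).
Hypothesis M1 : forall y z, linear (fun x => M x y z).
Hypothesis M2 : forall x z, linear (fun y => M x y z).
Hypothesis M3 : forall x y, linear (M x y).

Definition tlift3 : tensor (tensor A B) D -> Z :=
  tlift (fun t z => tlift (fun x y => M x y z) t).

Let bilinM z : bilin (fun x y => M x y z).
Proof. by split=> [x|y]; [apply: M2 | apply: M1]. Qed.

Let bilin_lift : bilin (fun t z => tlift (fun x y => M x y z) t).
Proof.
split=> [t c z z'|z]; last exact: (tlift_linear (bilinM z)).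
by rewrite -tliftP; apply: eq_tlift => x y; apply: M3.
Qed.

Lemma tlift3_linear : linear tlift3.
Proof. exact: (tlift_linear bilin_lift). Qed.

Lemma tlift3E x y z : tlift3 (x ⊗ y ⊗ z) = M x y z.
Proof. by rewrite /tlift3 (tliftE bilin_lift) (tliftE (bilinM z)). Qed.

End TensorThreeLift.

Lemma sgn_scale_move (k : fieldType) (Z : lmodType k) (n p : int) (x y : Z) :
  sgn n *: x = sgn p *: y -> x = sgn (n + p) *: y.
Proof.
by move=> e; rewrite -sgn_scaleA -e sgn_scaleA sgn_scale_even //; parity_cases.
Qed.

Section OpenFrobenius.
Variables (k : fieldType) (m : int) (V : lmodType k) (gr : int -> V -> Prop).
Variables (d : V -> V) (mul : V -> V -> V) (Delta : V -> tensor V V).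
Variable eps : V -> k^o.
Hypothesis V_frobenius : dg_open_frobenius m gr d mul Delta.
Hypothesis V_counital : counit gr d Delta eps.
Local Notation letter := (int * V)%type.
Local Notation cop := (cop gr Delta).

Let grV : grading gr := dg_grading (frob_dg V_frobenius).
Let V_mul := frob_mul V_frobenius.
Let V_comul := frob_comul V_frobenius.
Let mul_bilin := mul_bilin V_mul.
Let d_degree := dg_degree (frob_dg V_frobenius).
Let Delta_linear := comul_linear V_comul.
Let Delta_degree := comul_degree V_comul.
Let eps_linear := counit_linear V_counital.

Definition frob_pairing (x y : V) : k := eps (mul x y).

Lemma frob_pairing_bilin : bilin (frob_pairing : V -> V -> k^o).
Proof.
have [m1 m2] := mul_bilin.
by split=> [x|y]; [apply: (lin_comp eps_linear (m1 x)) | apply: (lin_comp eps_linear (m2 y))].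
Qed.

Lemma frob_pairing_degree i j a c : gr i a -> gr j c -> i + j != m ->
  frob_pairing a c = 0.
Proof.
move=> ga gc ne; apply: (counit_degree V_counital (mul_degree V_mul ga gc)).
by rewrite subr_eq0.
Qed.

(** Modulo 2, the exponent (i - m)(j - m) of graded commutativity and the shifts m i and m j of the
    two products add up to i j + m. *)
Lemma frob_pairing_sym i j a c : gr i a -> gr j c ->
  frob_pairing a c = sgn (i * j + m) * frob_pairing c a.
Proof.
move=> ga gc; have /(congr1 eps) := mul_comm V_mul ga gc.
rewrite /frob_pairing /shifted_mul !(linear_funZ eps_linear) sgn_scaleA => /sgn_scale_move ->.
by congr (_ * _); ksign.
Qed.

(** The counit kills the boundary d(a.c), and the Leibniz rule expands it. *)
Lemma frob_pairing_d i j a c : gr i a -> gr j c ->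
  frob_pairing (d a) c = sgn (i + 1) * frob_pairing a (d c).
Proof.
move=> ga gc; have /(congr1 eps) := mul_leibniz V_mul ga gc.
rewrite /frob_pairing (counit_d V_counital) /shifted_mul (linear_funD eps_linear).
rewrite sgn_scaleA !(linear_funZ eps_linear) => /esym/eqP.
rewrite addr_eq0 sgn_scaleN => /eqP/sgn_scale_move ->.
by congr (_ * _); ksign.
Qed.

(** The counit axiom recovers the product from its coproduct, which the right Frobenius relation
    expands over the coproduct of c. With the other side of the counit and the left relation, the
    same product is expanded over the coproduct of a in [mul_counit_r]. *)
Lemma mul_counit_l i j a c : gr i a -> gr j c ->
  mul a c = cop (fun p q => frob_pairing a p.2 *: q.2) (j, c).
Proof.
move=> ga gc; rewrite -[LHS](counit_l V_counital).
have sc := swP Delta_degree (a := (j, c)) gc.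
have hb : bilin (fun x y => eps x *: y : V).
  split=> [x|y]; first exact: lin_scale.
  by move=> e x x'; rewrite eps_linear scalerDl scalerA.
rewrite (frob_right V_frobenius ga gc sc) (linear_fun_bigop (tlift_linear hb)).
by apply: eq_bigr => p _; rewrite (tliftE hb).
Qed.

Lemma mul_counit_r i j a c : gr i a -> gr j c ->
  mul a c = cop (fun p q => sgn (m * p.1) *: (frob_pairing q.2 c *: p.2)) (i, a).
Proof.
move=> ga gc; rewrite -[LHS](counit_r V_counital).
have sa := swP Delta_degree (a := (i, a)) ga.
have hb : bilin (fun x y => eps y *: x : V).
  split=> [x|y]; last exact: lin_scale.
  by move=> e y y'; rewrite eps_linear scalerDl scalerA.
rewrite (frob_left V_frobenius ga gc sa) (linear_fun_bigop (tlift_linear hb)).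
apply: eq_bigr => p _.
by rewrite (linear_funZ (tlift_linear hb)) (tliftE hb).
Qed.

Lemma cop_counit_l (Z : lmodType k) (G : letter -> Z) a :
  gr a.1 a.2 -> hlin gr G -> cop (fun p q => eps p.2 *: G q) a = G a.
Proof.
case: a => i a ga hG; have [hs es] := swP Delta_degree (a := (i, a)) ga.
have lG := hlift_linear grV hG.
have hb : bilin (fun x y => eps x *: y : V).
  split=> [x|y]; first exact: lin_scale.
  by move=> e x x'; rewrite eps_linear scalerDl scalerA.
rewrite -(hliftE grV hG ga) -[a in RHS](counit_l V_counital) es.
rewrite (linear_fun_bigop (tlift_linear hb)) (linear_fun_bigop lG).
rewrite /cop [LHS]big_seq [RHS]big_seq; apply: eq_bigr => -[p [j y]] /hs[_ gy _].
by rewrite (tliftE hb) (linear_funZ lG) (hliftE grV hG gy).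
Qed.

Lemma cop_counit_r (Z : lmodType k) (G : letter -> Z) a :
  gr a.1 a.2 -> hlin gr G -> cop (fun p q => eps q.2 *: G p) a = G a.
Proof.
case: a => i a ga hG; have [hs es] := swP Delta_degree (a := (i, a)) ga.
have lG := hlift_linear grV hG.
have hb : bilin (fun x y => eps y *: x : V).
  split=> [x|y]; last exact: lin_scale.
  by move=> e y y'; rewrite eps_linear scalerDl scalerA.
rewrite -(hliftE grV hG ga) -[a in RHS](counit_r V_counital) es.
rewrite (linear_fun_bigop (tlift_linear hb)) (linear_fun_bigop lG).
rewrite /cop [LHS]big_seq [RHS]big_seq; apply: eq_bigr => -[[j y] p] /hs[gy _ _].
by rewrite (tliftE hb) (linear_funZ lG) (hliftE grV hG gy).
Qed.

(** The coassociativity axiom is an equality in a triple tensor product, while K is only linear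
    within degrees. Lifting K in each variable gives a trilinear map M that can be evaluated on that
    equality. *)
Lemma frob_cop_coassoc (Z : lmodType k) (K : letter -> letter -> letter -> Z) a :
  (forall x y, gr x.1 x.2 -> gr y.1 y.2 -> hlin gr (K x y)) ->
  (forall x z, gr x.1 x.2 -> gr z.1 z.2 -> hlin gr (fun y => K x y z)) ->
  (forall y z, gr y.1 y.2 -> gr z.1 z.2 -> hlin gr (fun x => K x y z)) ->
  gr a.1 a.2 ->
  cop (fun p q => cop (fun x y => K x y q) p) a = cop (fun p q => cop (K p) q) a.
Proof.
move=> K3 K2 K1 ga.
pose M x y z := hlift grV (fun p => hlift grV (fun q => hlift grV (K p q) z) y) x.
have h3 p z : gr p.1 p.2 -> hlin gr (fun q => hlift grV (K p q) z).
  move=> gp n c b b' gb gb'; rewrite -hliftP; apply: eq_hlift => i x gx.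
  exact: (K2 p (i, x)).
have h2 y z : hlin gr (fun p => hlift grV (fun q => hlift grV (K p q) z) y).
  move=> n c b b' gb gb'; rewrite -hliftP; apply: eq_hlift => i x gx.
  rewrite -hliftP; apply: eq_hlift => j x' gx'; exact: (K1 (i, x) (j, x')).
have M1 y z : linear (fun x => M x y z) by apply: hlift_linear.
have M2 x z : linear (fun y => M x y z).
  move=> c y y'; rewrite /M -hliftP; apply: eq_hlift => i b gb.
  by apply: hlift_linear; apply: h3.
have M3 x y : linear (M x y).
  move=> c z z'; rewrite /M -hliftP; apply: eq_hlift => i b gb; rewrite -hliftP.
  apply: eq_hlift => j b' gb'; apply: hlift_linear; exact: K3.
have ME p q r : gr p.1 p.2 -> gr q.1 q.2 -> gr r.1 r.2 -> M p.2 q.2 r.2 = K p q r.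
  case: p q r => [i x] [j y] [l z] /= gx gy gz.
  rewrite /M (hliftE _ _ gx) // (hliftE _ _ gy); last exact: h3.
  by rewrite (hliftE _ _ gz) //; apply: K3.
have lM := tlift3_linear M1 M2 M3.
have [sa _] := swP Delta_degree ga.
have hr p : p \in sw gr Delta a ->
    sweedler gr p.1.1 (Delta p.1.2) (sw gr Delta p.1) /\
    sweedler gr p.2.1 (Delta p.2.2) (sw gr Delta p.2).
  by move=> /sa[g1 g2 _]; split; apply: (swP Delta_degree).
have sumE (I J : Type) (s : seq I) (r : I -> seq J) F :
    tlift3 M (\sum_(p <- s) \sum_(q <- r p) F p q) =
    \sum_(p <- s) \sum_(q <- r p) tlift3 M (F p q).
  apply: (etrans (linear_fun_bigop lM _ _ _)); apply: eq_bigr => p _.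
  exact: (linear_fun_bigop lM).
have := congr1 (tlift3 M) (comul_coassoc V_comul ga (swP Delta_degree ga) hr).
rewrite [LHS]sumE [RHS]sumE => e.
refine (etrans _ (etrans e _)).
  rewrite /cop [LHS]big_seq [RHS]big_seq; apply: eq_bigr => p /sa[g1 g2 _].
  have [s1 _] := swP Delta_degree g1; rewrite [LHS]big_seq [RHS]big_seq.
  by apply: eq_bigr => q /s1[h1 h2' _]; rewrite (tlift3E M1 M2 M3) ME.
rewrite /cop [LHS]big_seq [RHS]big_seq; apply: eq_bigr => p /sa[g1 g2 _].
have [s2 _] := swP Delta_degree g2; rewrite [LHS]big_seq [RHS]big_seq.
by apply: eq_bigr => q /s2[h1 h2' _]; rewrite (tlift3E M1 M2 M3) ME.
Qed.

Lemma frob_cop_coleibniz (Z : lmodType k) (F : letter -> letter -> Z) a :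
  hbilin gr gr F -> gr a.1 a.2 ->
  cop F (a.1 - 1, d a.2) =
  cop (fun p q => F (p.1 - 1, d p.2) q + sgn p.1 *: F p (q.1 - 1, d q.2)) a.
Proof.
move=> hF ga; have gda : gr (a.1 - 1, d a.2).1 (a.1 - 1, d a.2).2 by exact: d_degree.
have sa := swP Delta_degree ga.
rewrite /cop (sweedler_hlift2 grV hF (swP Delta_degree gda)) /=.
rewrite (comul_coleibniz V_comul ga sa).
have lF := hlift2_linear grV grV hF; rewrite (linear_fun_bigop lF).
case: sa => sa _; rewrite [LHS]big_seq [RHS]big_seq.
apply: eq_bigr => p /sa[g1 g2 _].
rewrite (linear_funD lF) (linear_funZ lF).
rewrite (hlift2E grV grV hF (d_degree g1) g2) (hlift2E grV grV hF g1 (d_degree g2)).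
by case: p {g1 g2} => [[i x] [j y]].
Qed.

(* Frobenius relation and counit: both sides are the product. *)
Lemma frob_cop_frobenius (Z : lmodType k) (G : letter -> Z) a c :
  gr a.1 a.2 -> gr c.1 c.2 -> hlin gr G ->
  cop (fun p q => frob_pairing a.2 p.2 *: G q) c =
  cop (fun p q => sgn (m * p.1) *: (frob_pairing q.2 c.2 *: G p)) a.
Proof.
move=> ga gc hG; have lG := hlift_linear grV hG.
have GE p : gr p.1 p.2 -> hlift grV G p.2 = G p.
  by case: p => i x gx; apply: hliftE.
transitivity (hlift grV G (mul a.2 c.2)).
  rewrite (mul_counit_l ga gc) (cop_linear _ _ _ _ lG) -surjective_pairing.
  by apply: (eq_cop Delta_degree gc) => p q _ gq _; rewrite (linear_funZ lG) GE.
rewrite (mul_counit_r ga gc) (cop_linear _ _ _ _ lG) -surjective_pairing.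
apply: (eq_cop Delta_degree ga) => p q gp _ _.
by rewrite !(linear_funZ lG) GE.
Qed.

Theorem frobenius_CC_involutive : [pchar k] =i pred0 ->
  CC_involutive_dg_lie_bialgebra gr d Delta frob_pairing m.
Proof.
move=> char_k; apply: (@CC_involutive _ _ _ _ _ _ _ (fun _ => 0)) => //.
- exact: frob_dg V_frobenius.
- exact: frob_cop_coassoc.
- exact: frob_cop_coleibniz.
- exact: frob_pairing_bilin.
- exact: frob_pairing_degree.
- exact: frob_pairing_sym.
- exact: frob_pairing_d.
- move=> Z G a c ga gc hG.
  by rewrite !scale0r scaler0 !addr0; apply: frob_cop_frobenius.
Qed.

End OpenFrobenius.

(** * The coaugmentation coideal *)

Section Reduced.
Variables (k : fieldType) (m : int) (V : lmodType k) (gr : int -> V -> Prop).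
Variables (d : V -> V) (mul : V -> V -> V) (Delta : V -> tensor V V).
Variables (eps : V -> k^o) (eta : k^o -> V).
Hypothesis V_frobenius : dg_open_frobenius m gr d mul Delta.
Hypothesis V_counital : counit gr d Delta eps.
Hypothesis V_coaug : coaugmentation gr d Delta eps eta.
Local Notation K := (coker eta).
Local Notation pi := (to_coker eta).
Local Notation sec := (@coker_section k V eps eta).
Local Notation grK := (coker_gr gr eta).
Local Notation dK := (coker_d d eta).
Local Notation DeltaK := (coker_comul Delta eta).
Local Notation prV := (frob_pairing mul eps).
Local Notation prK := (coker_pairing mul eps eta).

Let grV : grading gr := dg_grading (frob_dg V_frobenius).
Let V_comul := frob_comul V_frobenius.
Let d_linear := dg_linear (frob_dg V_frobenius).
Let d_degree := dg_degree (frob_dg V_frobenius).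
Let Delta_linear := comul_linear V_comul.
Let Delta_degree := comul_degree V_comul.
Let eps_linear := counit_linear V_counital.
Let eta_linear := coaug_linear V_coaug.

Let etaE c : eta c = c *: eta 1.
Proof. by rewrite -(linear_funZ eta_linear) /GRing.scale /= mulr1. Qed.

Lemma to_coker_linear : linear pi.
Proof. exact: qclass_linear. Qed.

Lemma to_coker_eta c : pi (eta c) = 0.
Proof.
rewrite -(linear_fun0 to_coker_linear); apply/qclassP/span_gen.
by rewrite subr0; exists c.
Qed.

Lemma to_cokerK (x : K) : pi (repr x) = x.
Proof. exact: qclassK. Qed.

Section Lift.
Variables (Z : lmodType k) (f : V -> Z).
Hypothesis f_linear : linear f.
Hypothesis f_eta : forall c, f (eta c) = 0.

Let g : {linear V -> Z} := HB.pack f (GRing.isLinear.Build _ _ _ _ f f_linear).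

Let g_eta x : eta_image eta x -> g x = 0.
Proof. by case=> c ->; apply: f_eta. Qed.

Lemma coker_liftE v : f (repr (pi v)) = f v.
Proof. exact: (quotient_liftE g_eta). Qed.

Lemma coker_lift_linear : linear (fun x : K => f (repr x)).
Proof. exact: (quotient_lift_linear g_eta). Qed.

End Lift.

Let ker_proj v : V := v - eta (eps v).

Let ker_proj_linear : linear ker_proj.
Proof.
apply: lin_add; first by [].
by apply: lin_opp; apply: (lin_comp eta_linear eps_linear).
Qed.

Let ker_proj_eta c : ker_proj (eta c) = 0.
Proof. by rewrite /ker_proj (coaug_counit V_coaug) subrr. Qed.

Lemma coker_sectionE v : sec (pi v) = v - eta (eps v).
Proof. exact: (coker_liftE ker_proj_linear ker_proj_eta). Qed.

Lemma coker_section_linear : linear sec.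
Proof. exact: (coker_lift_linear ker_proj_linear ker_proj_eta). Qed.

Lemma to_coker_section x : pi (sec x) = x.
Proof.
rewrite -[x in LHS]to_cokerK coker_sectionE (linear_funD to_coker_linear).
by rewrite (linear_funN to_coker_linear) to_coker_eta subr0 to_cokerK.
Qed.

(** The correction eta(eps v) lives in degree 0, and it vanishes when v has another degree because
    eps does. *)
Lemma coker_section_degree n x : grK n x -> gr n (sec x).
Proof.
case=> v gv ->; rewrite coker_sectionE; case: (eqVneq n 0) gv => [-> gv|ne gv].
  rewrite addrC etaE -scaleNr; apply: (grP grV _ _ gv); exact: (coaug_degree V_coaug).
by rewrite (counit_degree V_counital gv ne) (linear_fun0 eta_linear) subr0.
Qed.

Let pid v : K := pi (d v).

Let pid_linear : linear pid.
Proof. exact: (lin_comp to_coker_linear d_linear). Qed.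

Let pid_eta c : pid (eta c) = 0.
Proof. by rewrite /pid (coaug_d V_coaug) (linear_fun0 to_coker_linear). Qed.

Lemma coker_dE v : dK (pi v) = pi (d v).
Proof. exact: (coker_liftE pid_linear pid_eta). Qed.

Lemma coker_d_linear : linear dK.
Proof. exact: (coker_lift_linear pid_linear pid_eta). Qed.

Lemma coker_section_d x : sec (dK x) = d (sec x).
Proof.
rewrite -[x]to_cokerK coker_dE !coker_sectionE (linear_funD d_linear).
by rewrite (linear_funN d_linear) (coaug_d V_coaug) (counit_d V_counital)
  (linear_fun0 eta_linear).
Qed.

Let pi2 := tlift (fun u v => pi u ⊗ pi v).

Let pi2_bilin : bilin (fun u v => pi u ⊗ pi v).
Proof.
have [t1 t2] := tens_bilin K K.
by split=> [u|v]; [apply: (lin_comp (t1 _)) | apply: (lin_comp (t2 _))];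
  apply: to_coker_linear.
Qed.

Let pi2_linear : linear (fun v => pi2 (Delta v)).
Proof. exact: (lin_comp (tlift_linear pi2_bilin) Delta_linear). Qed.

Let pi2_eta c : pi2 (Delta (eta c)) = 0.
Proof.
have [t1 _] := tens_bilin K K.
rewrite etaE (linear_funZ pi2_linear) (coaug_comul V_coaug) /pi2 (tliftE pi2_bilin).
by rewrite to_coker_eta (linear_fun0 (t1 _)) scaler0.
Qed.

Lemma coker_comulE v : DeltaK (pi v) = pi2 (Delta v).
Proof. exact: (coker_liftE pi2_linear pi2_eta). Qed.

Lemma coker_comul_linear : linear DeltaK.
Proof. exact: (coker_lift_linear pi2_linear pi2_eta). Qed.

Lemma coker_grading : grading grK.
Proof.
split=> [n|x|s hs us s0 p ps].
- split=> [|c x y [u gu ->] [v gv ->]].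
    by exists 0; [apply: gr0 | rewrite (linear_fun0 to_coker_linear)].
  by exists (c *: u + v); [apply: grP | rewrite to_coker_linear].
- have [s [hs es]] := gr_span grV (repr x).
  exists [seq (p.1, pi p.2) | p <- s]; split.
    by move=> q /mapP[p /hs gp ->]; exists p.2.
  by rewrite big_map -[LHS]to_cokerK es (linear_fun_bigop to_coker_linear).
(* Independence of the homogeneous parts is pulled back to V along the section, which is linear and
   preserves degrees. *)
pose s' := [seq (p.1, sec p.2) | p <- s].
have hs' : homog gr s'.
  by move=> q /mapP[r /hs gq ->]; apply: coker_section_degree.
have us' : uniq [seq p.1 | p <- s'] by rewrite -map_comp.
have s0' : \sum_(p <- s') p.2 = 0.
  rewrite big_map -(linear_fun_bigop coker_section_linear) s0.
  exact: (linear_fun0 coker_section_linear).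
have := gr_free grV hs' us' s0' (map_f _ ps) => /= e.
by rewrite -(to_coker_section p.2) e (linear_fun0 to_coker_linear).
Qed.

Lemma coker_dg_space : dg_space grK dK.
Proof.
split; [exact: coker_grading | exact: coker_d_linear | | ].
  by move=> n x [v gv ->]; exists (d v); [apply: d_degree | rewrite coker_dE].
move=> x; rewrite -[x]to_cokerK !coker_dE (dg_square (frob_dg V_frobenius)).
exact: (linear_fun0 to_coker_linear).
Qed.

Local Notation plet p := (p.1, pi p.2).

Let coker_sweedler n v s : sweedler gr n (Delta v) s ->
  sweedler grK n (DeltaK (pi v)) [seq (plet p.1, plet p.2) | p <- s].
Proof.
move=> [hs es]; split=> [q /mapP[p /hs[g1 g2 e] ->] /=|].
  by split=> //; [exists p.1.2 | exists p.2.2].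
rewrite coker_comulE es /pi2 (linear_fun_bigop (tlift_linear pi2_bilin)) big_map.
by apply: eq_bigr => p _; rewrite (tliftE pi2_bilin).
Qed.

Lemma coker_comul_degree n a : grK n a -> exists s, sweedler grK n (DeltaK a) s.
Proof.
case=> v /Delta_degree[s /coker_sweedler ss] ->.
by eexists; apply: ss.
Qed.

Local Notation letter := (int * K)%type.
Local Notation copV := (cop gr Delta).
Local Notation copK := (cop grK DeltaK).

Lemma coker_cop (Z : lmodType k) (F : letter -> letter -> Z) n v :
    gr n v -> hbilin grK grK F ->
  copK F (n, pi v) = copV (fun p q => F (plet p) (plet q)) (n, v).
Proof.
move=> gv hF; have sv := swP Delta_degree (a := (n, v)) gv.
have gp : grK (n, pi v).1 (n, pi v).2 by exists v.
rewrite -(copE coker_grading coker_comul_degree gp hF (coker_sweedler sv)).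
by rewrite big_map.
Qed.

Let hlin_pi (Z : lmodType k) (G : letter -> Z) :
  hlin grK G -> hlin gr (fun p => G (plet p)).
Proof.
move=> hG n c a a' ga ga'; rewrite /= to_coker_linear.
by apply: hG; [exists a | exists a'].
Qed.

Let hbilin_pi (Z : lmodType k) (F : letter -> letter -> Z) :
  hbilin grK grK F -> hbilin gr gr (fun p q => F (plet p) (plet q)).
Proof.
move=> [F1 F2]; split=> [n u gu|n w gw].
  by apply: (hlin_pi (F1 n (pi u) _)); exists u.
by apply: (hlin_pi (F2 n (pi w) _)); exists w.
Qed.

Lemma coker_cop_coassoc (Z : lmodType k) (F : letter -> letter -> letter -> Z) a :
  (forall x y, grK x.1 x.2 -> grK y.1 y.2 -> hlin grK (F x y)) ->
  (forall x z, grK x.1 x.2 -> grK z.1 z.2 -> hlin grK (fun y => F x y z)) ->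
  (forall y z, grK y.1 y.2 -> grK z.1 z.2 -> hlin grK (fun x => F x y z)) ->
  grK a.1 a.2 ->
  copK (fun p q => copK (fun x y => F x y q) p) a = copK (fun p q => copK (F p) q) a.
Proof.
move=> F3 F2 F1; case: a => n a [v gv] /= ->.
have bl q : grK q.1 q.2 -> hbilin grK grK (fun x y => F x y q).
  by move=> gq; split=> [i x gx|i x gx]; [apply: (F2 (i, x)) | apply: (F1 (i, x))].
have br p : grK p.1 p.2 -> hbilin grK grK (F p).
  by move=> gp; split=> [i x gx|i x gx]; [apply: (F3 p (i, x)) | apply: (F2 p (i, x))].
have gpi p : gr p.1 p.2 -> grK p.1 (pi p.2) by move=> gp; exists p.2.
have hlin_cop := cop_hlin coker_grading coker_comul_linear coker_comul_degree.
have hbl : hbilin grK grK (fun p q => copK (fun x y => F x y q) p).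
  split=> [i x gx|i x gx]; last exact: (hlin_cop _ _ (bl (i, x) gx)).
  apply: (cop_hlinr coker_comul_degree (a := (i, x)) gx) => p q gp gq; exact: F3.
have hbr : hbilin grK grK (fun p q => copK (F p) q).
  split=> [i x gx|i x gx]; first exact: (hlin_cop _ _ (br (i, x) gx)).
  apply: (cop_hlinr coker_comul_degree (a := (i, x)) gx) => p q gp gq; exact: F1.
rewrite (coker_cop gv hbl) (coker_cop gv hbr).
transitivity (copV (fun p q => copV (fun x y => F (plet x) (plet y) (plet q)) p) (n, v)).
  apply: (eq_cop Delta_degree (a := (n, v)) gv) => p q gp gq _.
  by rewrite (coker_cop gp (bl (plet q) (gpi q gq))) -surjective_pairing.
rewrite (frob_cop_coassoc V_frobenius (K := fun x y z => F (plet x) (plet y) (plet z))) //.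
- apply: (eq_cop Delta_degree (a := (n, v)) gv) => p q gp gq _.
  by rewrite (coker_cop gq (br (plet p) (gpi p gp))) -surjective_pairing.
- move=> x y gx gy; exact: hlin_pi (F3 (plet x) (plet y) (gpi _ gx) (gpi _ gy)).
- move=> x y gx gy; exact: hlin_pi (F2 (plet x) (plet y) (gpi _ gx) (gpi _ gy)).
- move=> x y gx gy; exact: hlin_pi (F1 (plet x) (plet y) (gpi _ gx) (gpi _ gy)).
Qed.

Lemma coker_cop_coleibniz (Z : lmodType k) (F : letter -> letter -> Z) a :
  hbilin grK grK F -> grK a.1 a.2 ->
  copK F (a.1 - 1, dK a.2) =
  copK (fun p q => F (p.1 - 1, dK p.2) q + sgn p.1 *: F p (q.1 - 1, dK q.2)) a.
Proof.
move=> hF; case: a => n a [v gv] /= ->.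
have dgK := dg_degree coker_dg_space.
have hF' : hbilin grK grK (fun p q : letter =>
    F (p.1 - 1, dK p.2) q + sgn p.1 *: F p (q.1 - 1, dK q.2)).
  have [F1 F2] := hF; apply: hbilin_add; last apply: (hbilin_mulr (fun i _ => sgn i)
      (F := fun p q => F p (q.1 - 1, dK q.2))).
    split=> [i x gx|i x gx]; first exact: F1 _ _ (dgK _ _ gx).
    by move=> j c y y' gy gy'; rewrite /= coker_d_linear; apply: (F2 i x); rewrite ?dgK //;
       apply: dgK.
  split=> [i x gx|i x gx]; last exact: F2 _ _ (dgK _ _ gx).
  by move=> j c y y' gy gy'; rewrite /= coker_d_linear; apply: (F1 i x) => //; apply: dgK.
rewrite coker_dE (coker_cop (d_degree gv) hF) (coker_cop gv hF').
rewrite (frob_cop_coleibniz V_frobenius (a := (n, v)) (hbilin_pi hF) gv).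
by apply: (eq_cop Delta_degree (a := (n, v)) gv) => p q _ _ _; rewrite /= !coker_dE.
Qed.

Lemma coker_pairing_bilin : bilin (prK : K -> K -> k^o).
Proof.
have [p1 p2] := frob_pairing_bilin V_frobenius V_counital.
by split=> [x|y]; [apply: (lin_comp (p1 (sec x))) | apply: (lin_comp (p2 (sec y)))];
  apply: coker_section_linear.
Qed.

Lemma coker_pairing_degree i j a c : grK i a -> grK j c -> i + j != m -> prK a c = 0.
Proof.
move=> /coker_section_degree ga /coker_section_degree gc.
exact: (frob_pairing_degree V_frobenius V_counital ga gc).
Qed.

Lemma coker_pairing_sym i j a c : grK i a -> grK j c ->
  prK a c = sgn (i * j + m) * prK c a.
Proof.
move=> /coker_section_degree ga /coker_section_degree gc.
exact: (frob_pairing_sym V_frobenius V_counital ga gc).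
Qed.

Lemma coker_pairing_d i j a c : grK i a -> grK j c ->
  prK (dK a) c = sgn (i + 1) * prK a (dK c).
Proof.
rewrite /coker_pairing !coker_section_d.
move=> /coker_section_degree ga /coker_section_degree gc.
exact: (frob_pairing_d V_frobenius V_counital ga gc).
Qed.

Definition coaug_pairing (x : K) : k^o := prV (sec x) (eta 1).

Lemma coaug_pairing_degree i a : grK i a -> i != m -> coaug_pairing a = 0.
Proof.
move=> /coker_section_degree ga ne.
apply: (frob_pairing_degree V_frobenius V_counital ga (coaug_degree V_coaug)).
by rewrite addr0.
Qed.

Let prK_r x v : prK x (pi v) = prV (sec x) v - eps v * coaug_pairing x.
Proof.
have l1 := (frob_pairing_bilin V_frobenius V_counital).1 (sec x).
rewrite -[prK _ _]/(prV (sec x) (sec (pi v))) coker_sectionE.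
by rewrite (linear_funD l1) (linear_funN l1) etaE (linear_funZ l1).
Qed.

(** The correction pairs eta(1), of degree 0, with the section of y; bringing eta(1) to the right by
    symmetry costs the sign of m. *)
Let prK_l j y v : grK j y ->
  prK (pi v) y = prV v (sec y) - sgn m * (eps v * coaug_pairing y).
Proof.
move=> /coker_section_degree gy.
have l2 := (frob_pairing_bilin V_frobenius V_counital).2 (sec y).
rewrite -[prK _ _]/(prV (sec (pi v)) (sec y)) coker_sectionE.
rewrite (linear_funD l2) (linear_funN l2) etaE (linear_funZ l2).
rewrite (frob_pairing_sym V_frobenius V_counital (coaug_degree V_coaug) gy).
by rewrite mul0r add0r -[_ *: _]/(eps v * (sgn m * _)) mulrCA.
Qed.

Let hbilin_prod (f : K -> k^o) (Z : lmodType k) (G : letter -> Z) :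
  linear f -> hlin grK G -> hbilin grK grK (fun p q => f p.2 *: G q).
Proof.
move=> lf hG; split=> [n u gu i c w w' gw gw'|n w gw i c u u' gu gu'] /=.
  by rewrite hG // scalerDr scaleCA.
by rewrite lf scalerDl scalerA.
Qed.

Let hbilin_prod_r (f : K -> k^o) (Z : lmodType k) (G : letter -> Z) :
  linear f -> hlin grK G -> hbilin grK grK (fun p q => f q.2 *: G p).
Proof. by move=> lf hG; have [h1 h2] := hbilin_prod lf hG; split. Qed.

(** Both sums are computed in V on the sections of a and c. There the reduced pairing with a factor
    differs from the full one by the counit of that factor times [coaug_pairing]; the counit axiom
    collapses these corrections to the very terms added on the two sides, and the relation in V
    remains. *)
Lemma coker_cop_frobenius (Z : lmodType k) (G : letter -> Z) a c :
  grK a.1 a.2 -> grK c.1 c.2 -> hlin grK G ->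
  copK (fun p q => prK a.2 p.2 *: G q) c + coaug_pairing a.2 *: G c =
  copK (fun p q => sgn (m * p.1) *: (prK q.2 c.2 *: G p)) a
  + sgn (m * (a.1 + 1)) *: (coaug_pairing c.2 *: G a).
Proof.
case: a => i x; case: c => j y /= gx gy hG.
have [pK1 pK2] := coker_pairing_bilin.
have sx := coker_section_degree gx; have sy := coker_section_degree gy.
have hG' := hlin_pi hG.
pose x' := (i, sec x); pose y' := (j, sec y).
have ey : copV (fun p q => eps p.2 *: G (plet q)) y' = G (j, y).
  by rewrite (cop_counit_l V_frobenius V_counital (a := y') sy hG') /= to_coker_section.
have ex : copV (fun p q => eps q.2 *: G (plet p)) x' = G (i, x).
  by rewrite (cop_counit_r V_frobenius V_counital (a := x') sx hG') /= to_coker_section.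
have -> : copK (fun p q => prK x p.2 *: G q) (j, y) =
    copV (fun p q => prV (sec x) p.2 *: G (plet q)) y' - coaug_pairing x *: G (j, y).
  rewrite -[in LHS](to_coker_section y) (coker_cop sy (hbilin_prod (pK1 x) hG)).
  rewrite -ey -scaleNr (@copZ _ _ gr Delta) -copD; apply: (eq_cop Delta_degree (a := y') sy).
  by move=> p q _ _ _; rewrite prK_r scalerBl scalerA mulNr scaleNr [eps _ * _]mulrC.
have -> : copK (fun p q => sgn (m * p.1) *: (prK q.2 y *: G p)) (i, x) =
    copV (fun p q => sgn (m * p.1) *: (prV q.2 (sec y) *: G (plet p))) x'
    - sgn (m * (i + 1)) *: (coaug_pairing y *: G (i, x)).
  rewrite -[in LHS](to_coker_section x) (coker_cop sx (hbilin_mulr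
    (fun i _ => sgn (m * i)) (hbilin_prod_r (pK2 y) hG))).
  rewrite -ex -scaleNr scalerA (@copZ _ _ gr Delta) -copD.
  apply: (eq_cop Delta_degree (a := x') sx).
  move=> p q _ gq epq; rewrite (prK_l _ gy) scalerBl scalerBr; congr (_ + _).
  (* The counit of q vanishes unless q has degree 0, and then p has the full degree i; this turns
     the sign of m p.1 + m into that of m (i + 1). *)
  case: (eqVneq q.1 0) => [q0|ne].
    have -> : p.1 = i by move: epq; rewrite q0 addr0.
    rewrite -scaleNr !scalerA !mulNr; congr (- _ *: _).
    rewrite mulrA -sgnD [eps _ * _]mulrC mulrA; congr (_ * _ * _); ksign.
  by rewrite (counit_degree V_counital gq ne) mul0r mulr0 !scale0r !scaler0 oppr0.
rewrite !subrK.
exact: (frob_cop_frobenius V_frobenius V_counital (a := x') (c := y') sx sy hG').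
Qed.

Theorem coker_CC_involutive : [pchar k] =i pred0 ->
  CC_involutive_dg_lie_bialgebra grK dK DeltaK prK m.
Proof.
move=> char_k; apply: (@CC_involutive _ _ _ _ _ _ _ coaug_pairing char_k).
- exact: coker_dg_space.
- exact: coker_comul_linear.
- exact: coker_comul_degree.
- exact: coker_cop_coassoc.
- exact: coker_cop_coleibniz.
- exact: coker_pairing_bilin.
- exact: coker_pairing_degree.
- exact: coker_pairing_sym.
- exact: coker_pairing_d.
- exact: coaug_pairing_degree.
- exact: coker_cop_frobenius.
Qed.

End Reduced.

Theorem theorem9 (k : fieldType) (char_k : [pchar k] =i pred0)
    (m : int) (V : lmodType k) (gr : int -> V -> Prop)
    (d : V -> V) (mul : V -> V -> V) (Delta : V -> tensor V V)
    (eps : V -> k^o) (eta : k^o -> V)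
    (V_frobenius : dg_open_frobenius m gr d mul Delta)
    (V_counital : counit gr d Delta eps)
    (V_coaugmented : coaugmentation gr d Delta eps eta)
    (V_simply_connected : simply_connected gr eta) :
  CC_involutive_dg_lie_bialgebra (coker_gr gr eta)
    (coker_d d eta) (coker_comul Delta eta) (coker_pairing mul eps eta) m
  /\
  CC_involutive_dg_lie_bialgebra gr
    d Delta (fun x y => eps (mul x y)) m.
Proof.
split; first exact: (coker_CC_involutive V_frobenius V_counital V_coaugmented char_k).
exact: (frobenius_CC_involutive V_frobenius V_counital char_k).
Qed.
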